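(* Let $\Omega\subsetneq\mathbb{C}$ be a domain. Then the Hurwitz density $\eta_\Omega:\Omega\to(0,\infty)$ is a continuous function.
   Context: A domain is a nonempty open connected subset of $\mathbb{C}$. $\mathbb{D}=\{z\in\mathbb{C}:|z|<1\}$ and $\mathbb{D}^*=\mathbb{D}\setminus\{0\}$. Hurwitz density: for a domain $\Omega\subsetneq\mathbb{C}$ and $w\in\Omega$, let $\mathcal{H}_0^w(\mathbb{D},\Omega)$ be the collection of all holomorphic functions $f:\mathbb{D}\to\Omega$ such that $f(0)=w$, $f(s)\neq w$ for all $s\in\mathbb{D}^*$, and $f'(0)>0$ (real and positive). Put $r_\Omega(w)=\max\{f'(0): f\in\mathcal{H}_0^w(\mathbb{D},\Omega)\}$ (the maximum is known to exist) and $\eta_\Omega(w)=2/r_\Omega(w)$. *)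

(* Defs.v *)
From Stdlib Require Import Reals ClassicalEpsilon.
From Coquelicot Require Import Coquelicot.
Open Scope R_scope.

(* Relative form: no two open sets of the plane separate A. *)
Definition connected (A : C -> Prop) : Prop :=
  forall U V : C -> Prop,
    open (T := C_UniformSpace) U -> open (T := C_UniformSpace) V ->
    (forall z, A z -> U z \/ V z) ->
    (exists z, A z /\ U z) -> (exists z, A z /\ V z) ->
    exists z, A z /\ U z /\ V z.

Definition is_domain (Omega : C -> Prop) : Prop :=
  (exists z, Omega z) /\ open (T := C_UniformSpace) Omega /\ connected Omega.

Definition unit_disk (z : C) : Prop := Cmod z < 1.

Definition punctured_disk (z : C) : Prop := unit_disk z /\ z <> RtoC 0.

Definition holomorphic_on (U : C -> Prop) (f : C -> C) : Prop :=
  forall z, U z -> ex_derive (K := C_AbsRing) (V := C_NormedModule) f z.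

(* A function on the unit disk is represented by a total function whose values
   outside the disk are irrelevant: the disk is open, so they do not affect
   derivatives at its points. *)
Definition hurwitz_family (Omega : C -> Prop) (w : C) (f : C -> C) : Prop :=
  holomorphic_on unit_disk f /\
  (forall z, unit_disk z -> Omega (f z)) /\
  f (RtoC 0) = w /\
  (forall s, punctured_disk s -> f s <> w) /\
  Im (C_derive f (RtoC 0)) = 0 /\ 0 < Re (C_derive f (RtoC 0)).

Definition is_max (E : R -> Prop) (m : R) : Prop :=
  E m /\ forall x, E x -> x <= m.

(* The maximum is unique when it exists; [epsilon] returns an unspecified real
   otherwise. *)
Definition hurwitz_radius (Omega : C -> Prop) (w : C) : R :=
  epsilon (inhabits 0)
    (is_max (fun r => exists f, hurwitz_family Omega w f /\
                                C_derive f (RtoC 0) = RtoC r)).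

Definition hurwitz_density (Omega : C -> Prop) (w : C) : R :=
  2 / hurwitz_radius Omega w.

(* Main.v *)
Require Import Defs.
From Stdlib Require Import ZArith Reals Lra Lia Wf_nat ClassicalEpsilon.
From Coquelicot Require Import Coquelicot.
Open Scope R_scope.

(** Let [r(w)] be the maximum defining the density at [w]; the claim is that the
    maximum exists and that [r] is continuous and positive on [Omega].

    Lower semicontinuity ([hurwitz_radius_lsc]) is elementary: if [f] is extremal at
    [w] and [t < 1], then [f (t z) + (w' - w)] competes at [w'] as soon as [w'] is
    closer to [w] than the compact image of [|z| <= t] is to the complement of [Omega];
    its derivative at [0] is [t r(w)].

    Existence of the maximum and upper semicontinuity both follow from a compactness
    statement ([attains_limit]): if [w_n] tends to [w] and competitors [f_n] at [w_n] have
    derivatives at [0] tending to some [r > 0], then a subsequence tends to a competitor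
    at [w] with derivative [r].  This requires local bounds, uniform over all competitors.
    Fix [a] outside [Omega].  A competitor is [f = w + z q] with [q] free of zeros, and
    therefore [(f (z^2) - w) / (a - w)] is the square of a holomorphic [F] with [F 0 = 0]
    that omits [1] and [-1] ([hurwitz_family_bound]).  On a smaller disk such
    functions are bounded by a constant that depends on its radius only ([schottky]): write
    [F = cosh (i pi cosh H)], and [H] omits a net of points, so that every disk of radius
    [6] contains an omitted value; Bloch's argument then bounds the derivative of [H]
    ([bloch_net]).  With the bounds, Montel's theorem ([montel]) gives a limit, and
    Hurwitz's theorem ([hurwitz_limit]) shows that the limit, not being constant, still
    takes its values in [Omega] and the value [w] at [0] only.

    The function theory is developed on the unit disk from complex differentiability
    alone.  Goursat's bisection is carried out on the parameter rectangle of a cone over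
    a circle ([rect_vanish], [cone_integral]); shrinking the cone to its apex yields
    Cauchy's formula, and the geometric series its Taylor expansion together with Cauchy's
    estimates ([taylor]).  Conversely power series are holomorphic ([expands_cder]).
    Derivatives, primitives, the maximum principle, the isolation of zeros and Montel's
    theorem are all read off from the coefficients. *)

(** * Limits and derivatives of complex-valued functions *)

Lemma Rdiv_lt_1_bounds (x r : R) : 0 <= x -> x < r -> 0 <= x / r < 1.
Proof.
  intros Hx Hr. split.
  - apply Rmult_le_pos; [exact Hx|]. left. apply Rinv_0_lt_compat. lra.
  - apply Rmult_lt_reg_r with r; [lra|]. replace (x / r * r) with x by (field; lra). lra.
Qed.

Lemma Cmod_sub_sym (x y : C) : Cmod (x - y) = Cmod (y - x).
Proof. rewrite <- Cmod_opp. f_equal. ring. Qed.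

Lemma Cmod_sub_triangle (x y z : C) : Cmod (x - z) <= Cmod (x - y) + Cmod (y - z).
Proof. replace (x - z)%C with ((x - y) + (y - z))%C by ring. apply Cmod_triangle. Qed.

Lemma Cmod_triangle_rev (x y : C) : Cmod x - Cmod y <= Cmod (x - y).
Proof.
  assert (H := Cmod_triangle (x - y) y).
  replace (x - y + y)%C with x in H by ring. lra.
Qed.

Lemma Cmod_le_sub (x y : C) : Cmod x <= Cmod y + Cmod (x - y).
Proof. assert (H := Cmod_triangle_rev x y). lra. Qed.

Lemma Cmod_sub_0 (x y : C) : Cmod (x - y) = 0 -> x = y.
Proof.
  intros H. apply Cmod_eq_0 in H.
  replace x with ((x - y) + y)%C by ring. rewrite H. ring.
Qed.

Lemma Csub_neq_0 (x y : C) : x <> y -> (x - y)%C <> 0.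
Proof. intros H E. apply H, Cmod_sub_0. rewrite E. apply Cmod_0. Qed.

Lemma Cmod_le_0 (x : C) : (forall e, 0 < e -> Cmod x <= e) -> x = 0.
Proof.
  intros H. apply Cmod_eq_0. assert (H0 := Cmod_ge_0 x).
  destruct (Req_dec (Cmod x) 0) as [E|E]; [exact E|].
  specialize (H (Cmod x / 2)). lra.
Qed.

(** The neighbourhood filter for the modulus itself; the uniform structure of [C] is that
    of a product, whose balls are squares. *)
Definition nbhd (z : C) (P : C -> Prop) : Prop :=
  exists d, 0 < d /\ forall y, Cmod (y - z) < d -> P y.

Global Instance nbhd_filter (z : C) : ProperFilter (nbhd z).
Proof.
  constructor; [|constructor].
  - intros P [d [Hd H]]. exists z. apply H. replace (z - z)%C with (RtoC 0) by ring.
    rewrite Cmod_0. exact Hd.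
  - exists 1. split; [lra|trivial].
  - intros P Q [d [Hd H]] [e [He H']]. exists (Rmin d e). split.
    + now apply Rmin_pos.
    + intros y Hy. assert (Hl := Rmin_l d e). assert (Hr := Rmin_r d e).
      split; [apply H|apply H']; lra.
  - intros P Q HPQ [d [Hd H]]. exists d. split; [exact Hd|]. intros y Hy. apply HPQ, H, Hy.
Qed.

Lemma nbhd_ball (z : C) (r : R) : 0 < r -> nbhd z (fun y => Cmod (y - z) < r).
Proof. intros Hr. exists r. split; [exact Hr|]. now intros y Hy. Qed.

Lemma nbhd_self (z : C) (P : C -> Prop) : nbhd z P -> P z.
Proof.
  intros [d [Hd H]]. apply H. replace (z - z)%C with (RtoC 0) by ring. now rewrite Cmod_0.
Qed.

Lemma open_nbhd (U : C -> Prop) (z : C) :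
  open (T := C_UniformSpace) U -> U z -> nbhd z U.
Proof.
  intros HU Hz. destruct (HU z Hz) as [e He].
  exists e. split; [apply cond_pos|]. intros y Hy. apply He.
  apply C_NormedModule_mixin_compat1. exact Hy.
Qed.

(** Limits along an arbitrary filter: the same lemmas serve sequences,
    functions of a real parameter and functions of a complex variable. *)
Definition clim {T : Type} (F : (T -> Prop) -> Prop) (f : T -> C) (l : C) : Prop :=
  forall e, 0 < e -> F (fun x => Cmod (f x - l) < e).

Section Limits.
Context {T : Type} {F : (T -> Prop) -> Prop} {FF : Filter F}.

Lemma clim_const (c : C) : clim F (fun _ => c) c.
Proof.
  intros e He. apply filter_forall. intros _.
  replace (c - c)%C with (RtoC 0) by ring. now rewrite Cmod_0.
Qed.

Lemma clim_ext_loc (f g : T -> C) (l : C) :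
  F (fun x => f x = g x) -> clim F f l -> clim F g l.
Proof.
  intros E H e He. generalize (filter_and _ _ E (H e He)).
  apply filter_imp. intros x [<- Hx]. exact Hx.
Qed.

Lemma clim_ext (f g : T -> C) (l : C) :
  (forall x, f x = g x) -> clim F f l -> clim F g l.
Proof. intros E. apply clim_ext_loc. now apply filter_forall. Qed.

Lemma clim_plus (f g : T -> C) (l m : C) :
  clim F f l -> clim F g m -> clim F (fun x => (f x + g x)%C) (l + m)%C.
Proof.
  intros Hf Hg e He.
  assert (He2 : 0 < e / 2) by lra.
  generalize (filter_and _ _ (Hf _ He2) (Hg _ He2)).
  apply filter_imp. intros x [H1 H2].
  replace (f x + g x - (l + m))%C with ((f x - l) + (g x - m))%C by ring.
  assert (H := Cmod_triangle (f x - l) (g x - m)). lra.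
Qed.

Lemma clim_mult (f g : T -> C) (l m : C) :
  clim F f l -> clim F g m -> clim F (fun x => (f x * g x)%C) (l * m)%C.
Proof.
  intros Hf Hg e He.
  assert (Hl := Cmod_ge_0 l). assert (Hm := Cmod_ge_0 m).
  set (K := 1 + Cmod l + Cmod m).
  assert (HK : 0 < K) by (unfold K; lra).
  set (d := Rmin 1 (e / K)).
  assert (Hd : 0 < d).
  { apply Rmin_pos; [lra|]. now apply Rdiv_lt_0_compat. }
  assert (Hd1 : d <= 1) by apply Rmin_l.
  assert (HdK : d * K <= e).
  { assert (H : d <= e / K) by apply Rmin_r.
    apply Rmult_le_compat_r with (r := K) in H; [|lra].
    replace (e / K * K) with e in H by (field; lra). exact H. }
  generalize (filter_and _ _ (Hf _ Hd) (Hg _ Hd)).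
  apply filter_imp. intros x [H1 H2].
  replace (f x * g x - l * m)%C
    with ((f x - l) * (g x - m) + ((f x - l) * m + l * (g x - m)))%C by ring.
  eapply Rle_lt_trans; [apply Cmod_triangle|].
  eapply Rle_lt_trans; [apply Rplus_le_compat_l, Cmod_triangle|].
  rewrite !Cmod_mult.
  assert (Ha := Cmod_ge_0 (f x - l)). assert (Hb := Cmod_ge_0 (g x - m)).
  apply Rlt_le_trans with (d * K); [|exact HdK]. unfold K.
  assert (Cmod (f x - l) * Cmod (g x - m) <= Cmod (f x - l) * 1)
    by (apply Rmult_le_compat_l; lra).
  assert (Cmod (f x - l) * Cmod m <= d * Cmod m)
    by (apply Rmult_le_compat_r; lra).
  assert (Cmod l * Cmod (g x - m) <= Cmod l * d)
    by (apply Rmult_le_compat_l; lra).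
  lra.
Qed.

Lemma clim_opp (f : T -> C) (l : C) :
  clim F f l -> clim F (fun x => (- f x)%C) (- l)%C.
Proof.
  intros Hf e He. generalize (Hf e He). apply filter_imp. intros x H.
  replace (- f x - - l)%C with (- (f x - l))%C by ring. now rewrite Cmod_opp.
Qed.

Lemma clim_minus (f g : T -> C) (l m : C) :
  clim F f l -> clim F g m -> clim F (fun x => (f x - g x)%C) (l - m)%C.
Proof. intros Hf Hg. apply clim_plus; [exact Hf|]. now apply clim_opp. Qed.

Lemma clim_Cmod_gt (f : T -> C) (l : C) (m : R) :
  clim F f l -> m < Cmod l -> F (fun x => m < Cmod (f x)).
Proof.
  intros Hf Hm. assert (Hd : 0 < Cmod l - m) by lra.
  generalize (Hf _ Hd). apply filter_imp. intros x Hx.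
  rewrite Cmod_sub_sym in Hx. assert (H := Cmod_triangle_rev l (f x)). lra.
Qed.

Lemma clim_neq (f : T -> C) (l b : C) :
  clim F f l -> l <> b -> F (fun x => f x <> b).
Proof.
  intros Hf Hlb.
  assert (H : clim F (fun x => (f x - b)%C) (l - b)%C)
    by (apply clim_minus; [exact Hf|apply clim_const]).
  generalize (clim_Cmod_gt _ _ 0 H (proj1 (Cmod_gt_0 _) (Csub_neq_0 _ _ Hlb))).
  apply filter_imp. intros x Hx E. rewrite E in Hx.
  replace (b - b)%C with (RtoC 0) in Hx by ring. rewrite Cmod_0 in Hx. lra.
Qed.

Lemma clim_inv (f : T -> C) (l : C) :
  clim F f l -> l <> 0 -> clim F (fun x => (/ f x)%C) (/ l)%C.
Proof.
  intros Hf Hl e He.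
  assert (Hl0 : 0 < Cmod l) by now apply Cmod_gt_0.
  assert (Hd : 0 < e * (Cmod l * Cmod l) / 2).
  { apply Rdiv_lt_0_compat; [|lra]. apply Rmult_lt_0_compat; [lra|].
    now apply Rmult_lt_0_compat. }
  assert (Hh : Cmod l / 2 < Cmod l) by lra.
  generalize (filter_and _ _ (clim_Cmod_gt _ _ _ Hf Hh) (Hf _ Hd)).
  apply filter_imp. intros x [H1 H2].
  assert (Hx0 : f x <> 0) by (apply Cmod_gt_0; lra).
  replace (/ f x - / l)%C with ((l - f x) / (f x * l))%C by (field; now split).
  rewrite Cmod_div by now apply Cmult_neq_0.
  rewrite Cmod_mult, Cmod_sub_sym.
  apply Rmult_lt_reg_r with (Cmod (f x) * Cmod l); [apply Rmult_lt_0_compat; lra|].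
  unfold Rdiv. rewrite Rmult_assoc, Rinv_l, Rmult_1_r
    by (apply Rgt_not_eq, Rmult_lt_0_compat; lra).
  apply Rlt_le_trans with (1 := H2).
  assert (Cmod l / 2 * Cmod l <= Cmod (f x) * Cmod l) by (apply Rmult_le_compat_r; lra).
  apply Rle_trans with (e * (Cmod l / 2 * Cmod l)); [right; field|].
  apply Rmult_le_compat_l; lra.
Qed.

Lemma clim_comp (f : T -> C) (g : C -> C) (z l : C) :
  clim F f z -> clim (nbhd z) g l -> clim F (fun x => g (f x)) l.
Proof.
  intros Hf Hg e He. destruct (Hg e He) as [d [Hd H]].
  generalize (Hf d Hd). apply filter_imp. intros x Hx. now apply H.
Qed.

Lemma clim_squeeze (f : T -> C) (l : C) (u : T -> R) (K : R) :
  F (fun x => Cmod (f x - l) <= K * u x) ->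
  (forall e, 0 < e -> F (fun x => u x < e)) -> 0 <= K -> clim F f l.
Proof.
  intros H Hu HK e He.
  assert (HK1 : 0 < K + 1) by lra.
  generalize (filter_and _ _ H (Hu (e / (K + 1)) (Rdiv_lt_0_compat _ _ He HK1))).
  apply filter_imp. intros x [H1 H2].
  assert (H3 : K * u x <= K * (e / (K + 1))) by (apply Rmult_le_compat_l; lra).
  assert (H4 : K * (e / (K + 1)) < e).
  { apply Rmult_lt_reg_r with (K + 1); [lra|].
    replace (K * (e / (K + 1)) * (K + 1)) with (K * e) by (field; lra). lra. }
  lra.
Qed.

End Limits.

Lemma clim_le {T : Type} (F : (T -> Prop) -> Prop) {FF : ProperFilter F}
  (f : T -> C) (l : C) (M : R) :
  clim F f l -> F (fun x => Cmod (f x) <= M) -> Cmod l <= M.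
Proof.
  intros Hf HM. destruct (Rle_dec (Cmod l) M) as [H|H]; [exact H|].
  apply Rnot_le_lt in H.
  destruct (filter_ex _ (filter_and _ _ HM (clim_Cmod_gt _ _ _ Hf H))) as [x Hx]. lra.
Qed.

Lemma clim_unique {T : Type} (F : (T -> Prop) -> Prop) {FF : ProperFilter F}
  (f : T -> C) (l m : C) : clim F f l -> clim F f m -> l = m.
Proof.
  intros Hl Hm. apply Cmod_sub_0, Rle_antisym; [|apply Cmod_ge_0].
  assert (H : clim F (fun x => (f x - f x)%C) (l - m)%C) by now apply clim_minus.
  apply (clim_le F _ _ _ H). apply filter_forall. intros x.
  replace (f x - f x)%C with (RtoC 0) by ring. rewrite Cmod_0. lra.
Qed.

Lemma clim_id (z : C) : clim (nbhd z) (fun y => y) z.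
Proof. intros e He. now apply nbhd_ball. Qed.

(** Caratheodory's form of the derivative: the difference quotient, extended by
    the derivative at the point itself, is continuous there.  Sums, products,
    inverses and compositions then only need the calculus of limits. *)
Definition cder (f : C -> C) (z l : C) : Prop :=
  exists q : C -> C,
    clim (nbhd z) q l /\ nbhd z (fun y => f y = (f z + (y - z) * q y)%C).

Lemma cder_continuous (f : C -> C) (z l : C) :
  cder f z l -> clim (nbhd z) f (f z).
Proof.
  intros [q [Hq Hf]].
  apply clim_ext_loc with (fun y => (f z + (y - z) * q y)%C).
  - revert Hf. apply filter_imp. intros y E. now symmetry.
  - apply (eq_ind (f z + (z - z) * l)%C (clim (nbhd z) _)); [|ring].
    apply (clim_plus (fun _ => f z)); [apply clim_const|]. apply clim_mult; [|exact Hq].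
    apply clim_minus; [apply clim_id|apply clim_const].
Qed.

Lemma cder_ext_loc (f g : C -> C) (z l : C) :
  nbhd z (fun y => f y = g y) -> cder f z l -> cder g z l.
Proof.
  intros E [q [Hq Hf]]. exists q. split; [exact Hq|].
  assert (Ez := nbhd_self _ _ E). rewrite <- Ez.
  generalize (filter_and _ _ E Hf). apply filter_imp. intros y [<- H]. exact H.
Qed.

Lemma cder_ext (f g : C -> C) (z l : C) :
  (forall y, f y = g y) -> cder f z l -> cder g z l.
Proof. intros E. apply cder_ext_loc. now apply filter_forall. Qed.

Lemma cder_const (c z : C) : cder (fun _ => c) z 0.
Proof.
  exists (fun _ => 0). split; [apply clim_const|].
  apply filter_forall. intros y. ring.
Qed.

Lemma cder_id (z : C) : cder (fun y => y) z 1.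
Proof.
  exists (fun _ => 1). split; [apply clim_const|].
  apply filter_forall. intros y. ring.
Qed.

Lemma cder_plus (f g : C -> C) (z l m : C) :
  cder f z l -> cder g z m -> cder (fun y => (f y + g y)%C) z (l + m)%C.
Proof.
  intros [p [Hp Hf]] [q [Hq Hg]]. exists (fun y => (p y + q y)%C). split.
  - now apply clim_plus.
  - generalize (filter_and _ _ Hf Hg). apply filter_imp. intros y [-> ->]. ring.
Qed.

Lemma cder_mult (f g : C -> C) (z l m : C) :
  cder f z l -> cder g z m ->
  cder (fun y => (f y * g y)%C) z (l * g z + f z * m)%C.
Proof.
  intros Df Dg. assert (Cg := cder_continuous _ _ _ Dg).
  destruct Df as [p [Hp Hf]]. destruct Dg as [q [Hq Hg]].
  exists (fun y => (p y * g y + f z * q y)%C). split.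
  - apply clim_plus; apply clim_mult; try assumption. apply clim_const.
  - generalize (filter_and _ _ Hf Hg). apply filter_imp. intros y [-> E].
    replace ((f z + (y - z) * p y) * g y)%C
      with (f z * g y + (y - z) * p y * g y)%C by ring.
    rewrite E at 1. ring.
Qed.

Lemma cder_scal (f : C -> C) (z l c : C) :
  cder f z l -> cder (fun y => (c * f y)%C) z (c * l)%C.
Proof.
  intros H. replace (c * l)%C with (0 * f z + c * l)%C by ring.
  apply cder_mult with (f := fun _ => c); [apply cder_const|exact H].
Qed.

Lemma cder_opp (f : C -> C) (z l : C) :
  cder f z l -> cder (fun y => (- f y)%C) z (- l)%C.
Proof.
  intros H. apply cder_ext with (fun y => (RtoC (-1) * f y)%C).
  - intros y. ring.
  - replace (- l)%C with (RtoC (-1) * l)%C by ring.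
    now apply cder_scal.
Qed.

Lemma cder_minus (f g : C -> C) (z l m : C) :
  cder f z l -> cder g z m -> cder (fun y => (f y - g y)%C) z (l - m)%C.
Proof. intros Hf Hg. apply cder_plus; [exact Hf|]. now apply cder_opp. Qed.

Lemma cder_inv (f : C -> C) (z l : C) :
  cder f z l -> f z <> 0 -> cder (fun y => (/ f y)%C) z (- l / (f z * f z))%C.
Proof.
  intros Df Hz. assert (Cf := cder_continuous _ _ _ Df).
  destruct Df as [p [Hp Hf]].
  exists (fun y => (- p y * / (f y * f z))%C). split.
  - apply clim_mult; [now apply clim_opp|]. apply clim_inv.
    + apply clim_mult; [exact Cf|apply clim_const].
    + now apply Cmult_neq_0.
  - generalize (filter_and _ _ Hf (clim_neq _ _ _ Cf Hz)).
    apply filter_imp. intros y [E Hy].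
    assert (E' : ((y - z) * p y = f y - f z)%C) by (rewrite E; ring).
    replace ((y - z) * (- p y * / (f y * f z)))%C
      with (- ((y - z) * p y) * / (f y * f z))%C by ring.
    rewrite E'. field. now split.
Qed.

Lemma cder_comp (f g : C -> C) (z l m : C) :
  cder f (g z) l -> cder g z m -> cder (fun y => f (g y)) z (m * l)%C.
Proof.
  intros [p [Hp Hf]] Dg. assert (Cg := cder_continuous _ _ _ Dg).
  destruct Dg as [q [Hq Hg]].
  exists (fun y => (q y * p (g y))%C). split.
  - apply clim_mult; [exact Hq|]. now apply clim_comp with (g z).
  - destruct Hf as [d [Hd Hf]].
    generalize (filter_and _ _ (Cg d Hd) Hg). apply filter_imp. intros y [H1 H2].
    rewrite (Hf _ H1). rewrite H2 at 1. ring.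
Qed.

Lemma cder_affine (f : C -> C) (a b z l : C) :
  cder f (a + b * z)%C l -> cder (fun y => f (a + b * y)%C) z (b * l)%C.
Proof.
  intros H. apply cder_comp with (g := fun y => (a + b * y)%C); [exact H|].
  apply (eq_ind (0 + b * 1)%C (cder _ z)); [|ring].
  apply (cder_plus (fun _ => a)); [apply cder_const|]. apply cder_scal, cder_id.
Qed.

(** The two quotients agree off [z]; so their limits at [z] along a half-line agree. *)
Lemma cder_unique (f : C -> C) (z l m : C) : cder f z l -> cder f z m -> l = m.
Proof.
  intros [p [Hp Hf]] [q [Hq Hg]].
  assert (S : clim (at_right 0) (fun t : R => (z + t)%C) z).
  { intros e He. exists (mkposreal e He). intros t Ht Ht0.
    replace (z + t - z)%C with (RtoC t) by ring.
    rewrite Cmod_R. unfold ball in Ht; simpl in Ht.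
    unfold AbsRing_ball, abs, minus, plus, opp in Ht; simpl in Ht.
    rewrite Ropp_0, Rplus_0_r in Ht. exact Ht. }
  apply (clim_unique (at_right 0) (fun t : R => p (z + t)%C)).
  - now apply clim_comp with z.
  - apply clim_ext_loc with (fun t : R => q (z + t)%C).
    + destruct Hf as [d [Hd Hf]]. destruct Hg as [d' [Hd' Hg]].
      assert (Hpos : at_right 0 (fun t => 0 < t)).
      { exists (mkposreal 1 Rlt_0_1). now intros t _ Ht. }
      generalize (filter_and _ _ Hpos (filter_and _ _ (S d Hd) (S d' Hd'))).
      apply filter_imp. intros t [H0 [H1 H2]].
      assert (E := Hf _ H1). rewrite (Hg _ H2) in E.
      assert (Ht : RtoC t <> 0) by (intros X; apply RtoC_inj in X; lra).
      replace (q (z + t)%C) with ((f z + (z + t - z) * q (z + t) - f z) / t)%C by now field.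
      rewrite E. now field.
    + now apply clim_comp with z.
Qed.

Lemma cder_eps (f : C -> C) (z l : C) :
  (forall e, 0 < e -> nbhd z (fun y =>
     Cmod (f y - f z - (y - z) * l) <= e * Cmod (y - z))) ->
  cder f z l.
Proof.
  intros H.
  exists (fun y => if excluded_middle_informative (y = z) then l
                   else ((f y - f z) / (y - z))%C).
  split.
  - intros e He.
    assert (He2 : 0 < e / 2) by lra.
    generalize (H _ He2). apply filter_imp. intros y Hy.
    destruct (excluded_middle_informative (y = z)) as [->|Hyz].
    + replace (l - l)%C with (RtoC 0) by ring. now rewrite Cmod_0.
    + assert (Hn := Csub_neq_0 _ _ Hyz).
      assert (Hp := proj1 (Cmod_gt_0 _) Hn).
      apply Rmult_lt_reg_r with (Cmod (y - z)); [exact Hp|].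
      rewrite <- Cmod_mult.
      replace (((f y - f z) / (y - z) - l) * (y - z))%C
        with (f y - f z - (y - z) * l)%C by now field.
      apply Rle_lt_trans with (1 := Hy). apply Rmult_lt_compat_r; lra.
  - apply filter_forall. intros y.
    destruct (excluded_middle_informative (y = z)) as [->|Hyz]; [ring|].
    field. now apply Csub_neq_0.
Qed.

Lemma cder_bound (f : C -> C) (z l : C) (e : R) :
  cder f z l -> 0 < e ->
  nbhd z (fun y => Cmod (f y - f z - (y - z) * l) <= e * Cmod (y - z)).
Proof.
  intros [q [Hq Hf]] He.
  generalize (filter_and _ _ Hf (Hq e He)). apply filter_imp. intros y [E H].
  rewrite E.
  replace (f z + (y - z) * q y - f z - (y - z) * l)%C
    with ((q y - l) * (y - z))%C by ring.
  rewrite Cmod_mult. apply Rmult_le_compat_r; [apply Cmod_ge_0|]. now left.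
Qed.

(** Two uniform structures on [C] meet in [is_derive]: the domain carries the one of the
    modulus, the codomain that of a product; both sides only involve the modulus. *)
Lemma cder_iff (f : C -> C) (z l : C) :
  cder f z l <->
  is_derive (K := C_AbsRing) (V := C_NormedModule) f z l.
Proof.
  assert (Hloc : forall P : C -> Prop,
    locally (T := AbsRing_UniformSpace C_AbsRing) z P <-> nbhd z P).
  { intros P. split.
    - intros [d H]. exists d. split; [apply cond_pos|]. intros y Hy. now apply H.
    - intros [d [Hd H]]. exists (mkposreal d Hd). intros y Hy. now apply H. }
  split.
  - intros Hf. split; [apply is_linear_scal_l|].
    intros x Hx e.
    assert (Ex : x = z).
    { symmetry. apply (is_filter_lim_locally_unique
        (V := AbsRing_NormedModule C_AbsRing) z x Hx). }
    subst x. apply Hloc, (cder_bound _ _ _ _ Hf (cond_pos e)).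
  - intros [_ H].
    assert (Hz : is_filter_lim (T := AbsRing_UniformSpace C_AbsRing)
       (locally (T := AbsRing_UniformSpace C_AbsRing) z) z) by now intros P.
    apply cder_eps. intros e He.
    apply (proj1 (Hloc _) (H z Hz (mkposreal e He))).
Qed.

Lemma C_derive_eq (f : C -> C) (z l : C) : cder f z l -> C_derive f z = l.
Proof. intros H. apply is_C_derive_unique. now apply cder_iff. Qed.

(** * The complex exponential *)

Definition cexp (z : C) : C := (exp (Re z) * cos (Im z), exp (Re z) * sin (Im z)).

Lemma cexp_0 : cexp 0 = 1.
Proof.
  unfold cexp. simpl. rewrite exp_0, cos_0, sin_0. unfold RtoC. f_equal; ring.
Qed.

Lemma cexp_plus (z w : C) : cexp (z + w) = (cexp z * cexp w)%C.
Proof.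
  unfold cexp, Cmult, Cplus, Re, Im. simpl.
  rewrite exp_plus, cos_plus, sin_plus. f_equal; ring.
Qed.

Lemma Cmod_cexp (z : C) : Cmod (cexp z) = exp (Re z).
Proof.
  unfold cexp, Cmod, Re, Im. simpl.
  set (e := exp (fst z)). set (c := cos (snd z)). set (s := sin (snd z)).
  assert (H := sin2_cos2 (snd z)). fold c s in H. unfold Rsqr in H.
  replace (e * c * (e * c * 1) + e * s * (e * s * 1)) with (e * e * (s * s + c * c)) by ring.
  rewrite H, Rmult_1_r. apply sqrt_square. left. apply exp_pos.
Qed.

Lemma cexp_neq_0 (z : C) : cexp z <> 0.
Proof. apply Cmod_gt_0. rewrite Cmod_cexp. apply exp_pos. Qed.

Lemma cexp_opp (z : C) : cexp (- z) = (/ cexp z)%C.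
Proof.
  assert (H : (cexp z * cexp (- z))%C = 1).
  { rewrite <- cexp_plus. replace (z + - z)%C with (RtoC 0) by ring. apply cexp_0. }
  assert (H0 := cexp_neq_0 z).
  replace (cexp (- z)) with ((cexp z * cexp (- z)) / cexp z)%C by now field.
  rewrite H. now field.
Qed.

Lemma cexp_R (x : R) : cexp x = exp x.
Proof. unfold cexp. simpl. rewrite cos_0, sin_0. unfold RtoC. f_equal; ring. Qed.

Lemma cexp_iR (y : R) : cexp (0, y) = (cos y, sin y).
Proof. unfold cexp. simpl. rewrite exp_0. f_equal; ring. Qed.

Lemma Cmod_le_abs (a b : R) : Cmod (a, b) <= Rabs a + Rabs b.
Proof.
  replace ((a, b) : C) with (RtoC a + RtoC b * Ci)%C
    by (unfold Ci, RtoC, Cplus, Cmult; simpl; f_equal; ring).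
  apply Rle_trans with (1 := Cmod_triangle _ _).
  rewrite Cmod_mult, Cmod_Ci, !Cmod_R. lra.
Qed.

Lemma derivable_pt_lim_0_bound (f : R -> R) (l e : R) :
  derivable_pt_lim f 0 l -> 0 < e ->
  exists d, 0 < d /\ forall h, Rabs h < d -> Rabs (f h - f 0 - l * h) <= e * Rabs h.
Proof.
  intros H He. destruct (H e He) as [d Hd]. exists d. split; [apply cond_pos|].
  intros h Hh. destruct (Req_dec h 0) as [->|Hh0].
  - rewrite Rabs_R0, Rmult_0_r, Rminus_diag, Rmult_0_r, Rminus_diag, Rabs_R0. lra.
  - specialize (Hd h Hh0 Hh). rewrite Rplus_0_l in Hd.
    replace (f h - f 0 - l * h) with (((f h - f 0) / h - l) * h) by now field.
    rewrite Rabs_mult. apply Rmult_le_compat_r; [apply Rabs_pos|]. now left.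
Qed.

(** With [z = x + i y], the error splits into products of the first-order errors of the
    real functions [exp], [cos] and [sin] at [0] with bounded factors. *)
Lemma cder_cexp_0 : cder cexp 0 1.
Proof.
  apply cder_eps. intros e0 He0.
  set (e := Rmin 1 (e0 / 8)).
  assert (He : 0 < e) by (apply Rmin_pos; lra).
  assert (He1 : e <= 1) by apply Rmin_l.
  assert (He8 : 8 * e <= e0) by (assert (H : e <= e0 / 8) by apply Rmin_r; lra).
  destruct (derivable_pt_lim_0_bound exp 1 e) as [d1 [Hd1 H1]]; [|exact He|].
  { rewrite <- exp_0. apply derivable_pt_lim_exp. }
  destruct (derivable_pt_lim_0_bound cos 0 e) as [d2 [Hd2 H2]]; [|exact He|].
  { apply (eq_ind (- sin 0) (derivable_pt_lim cos 0)); [|rewrite sin_0; ring].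
    apply derivable_pt_lim_cos. }
  destruct (derivable_pt_lim_0_bound sin 1 e) as [d3 [Hd3 H3]]; [|exact He|].
  { rewrite <- cos_0. apply derivable_pt_lim_sin. }
  exists (Rmin (Rmin d1 d2) (Rmin d3 (e / 2))). split.
  { repeat apply Rmin_pos; lra. }
  intros [x y] Hh.
  rewrite cexp_0.
  assert (E0 : ((x, y) - 0)%C = (x, y)).
  { unfold Cminus, Copp, Cplus, RtoC. simpl. f_equal; ring. }
  rewrite E0 in *. clear E0.
  assert (Hx : Rabs x <= Cmod (x, y)) by apply (re_le_Cmod (x, y)).
  assert (Hy : Rabs y <= Cmod (x, y)).
  { apply Rle_trans with (2 := Rmax_Cmod (x, y)). apply Rmax_r. }
  set (m := Cmod (x, y)) in *.
  assert (B := Rmin_l (Rmin d1 d2) (Rmin d3 (e / 2))).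
  assert (B' := Rmin_r (Rmin d1 d2) (Rmin d3 (e / 2))).
  assert (B1 := Rmin_l d1 d2). assert (B2 := Rmin_r d1 d2).
  assert (B3 := Rmin_l d3 (e / 2)). assert (B4 := Rmin_r d3 (e / 2)).
  specialize (H1 x). specialize (H2 y). specialize (H3 y).
  rewrite exp_0 in H1. rewrite cos_0 in H2. rewrite sin_0 in H3.
  assert (G1 : Rabs (exp x - 1 - 1 * x) <= e * m).
  { apply Rle_trans with (1 := H1 ltac:(lra)). apply Rmult_le_compat_l; lra. }
  assert (G2 : Rabs (cos y - 1 - 0 * y) <= e * m).
  { apply Rle_trans with (1 := H2 ltac:(lra)). apply Rmult_le_compat_l; lra. }
  assert (G3 : Rabs (sin y - 0 - 1 * y) <= e * m).
  { apply Rle_trans with (1 := H3 ltac:(lra)). apply Rmult_le_compat_l; lra. }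
  assert (Hm : 0 <= m) by apply Cmod_ge_0.
  assert (Hem : e * m <= m) by (rewrite <- (Rmult_1_l m) at 2; apply Rmult_le_compat_r; lra).
  assert (G4 : Rabs (exp x - 1) <= 2 * m).
  { replace (exp x - 1) with ((exp x - 1 - 1 * x) + x) by ring.
    apply Rle_trans with (1 := Rabs_triang _ _). lra. }
  assert (G5 : Rabs (exp x) <= 2).
  { replace (exp x) with ((exp x - 1) + 1) by ring.
    apply Rle_trans with (1 := Rabs_triang _ _). rewrite Rabs_R1. lra. }
  assert (G6 : Rabs (exp x * (cos y - 1 - 0 * y)) <= 2 * (e * m)).
  { rewrite Rabs_mult. apply Rmult_le_compat; try apply Rabs_pos; assumption. }
  assert (G7 : Rabs (exp x * (sin y - 0 - 1 * y)) <= 2 * (e * m)).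
  { rewrite Rabs_mult. apply Rmult_le_compat; try apply Rabs_pos; assumption. }
  assert (G8 : Rabs ((exp x - 1) * y) <= e * m).
  { rewrite Rabs_mult. apply Rmult_le_compat; try apply Rabs_pos; lra. }
  unfold cexp, Cminus, Cmult, Copp, Cplus, RtoC. simpl.
  apply Rle_trans with (1 := Cmod_le_abs _ _).
  replace (exp x * cos y + - (1) + - (x * 1 - y * 0))
    with ((exp x - 1 - 1 * x) + exp x * (cos y - 1 - 0 * y)) by ring.
  replace (exp x * sin y + - 0 + - (x * 0 + y * 1))
    with (exp x * (sin y - 0 - 1 * y) + (exp x - 1) * y) by ring.
  assert (T1 := Rabs_triang (exp x - 1 - 1 * x) (exp x * (cos y - 1 - 0 * y))).
  assert (T2 := Rabs_triang (exp x * (sin y - 0 - 1 * y)) ((exp x - 1) * y)).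
  assert (8 * e * m <= e0 * m) by (apply Rmult_le_compat_r; lra).
  assert (0 <= e * m) by (apply Rmult_le_pos; lra).
  lra.
Qed.

Lemma cder_cexp (z : C) : cder cexp z (cexp z).
Proof.
  apply cder_ext with (fun y => (cexp z * cexp (- z + 1 * y))%C).
  - intros y. rewrite <- cexp_plus. f_equal. ring.
  - apply (eq_ind (cexp z * (1 * 1))%C (cder _ z)); [|ring].
    apply cder_scal, cder_affine.
    replace (- z + 1 * z)%C with (RtoC 0) by ring. apply cder_cexp_0.
Qed.

(** * Integrals of complex-valued functions of a real variable *)

Definition is_cint (f : R -> C) (a b : R) (I : C) : Prop :=
  is_RInt (V := C_R_NormedModule) f a b I.

Definition cint (f : R -> C) (a b : R) : C :=
  RInt (V := C_R_CompleteNormedModule) f a b.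

Definition ccont (f : R -> C) (t : R) : Prop := clim (locally t) f (f t).

Lemma C_R_norm (x : C) : norm (V := C_R_NormedModule) x = Cmod x.
Proof.
  destruct x as [x y]. unfold norm; simpl. unfold prod_norm, Cmod; simpl.
  unfold norm; simpl. unfold abs; simpl. f_equal.
  rewrite !Rmult_1_r, <- !Rabs_mult, !Rabs_pos_eq; [reflexivity| |];
  apply Rle_0_sqr.
Qed.

Lemma is_cint_unique (f : R -> C) (a b : R) (I : C) : is_cint f a b I -> cint f a b = I.
Proof. intros H. now apply (is_RInt_unique (V := C_R_CompleteNormedModule)). Qed.

Lemma ccont_is_cint (f : R -> C) (a b : R) :
  a <= b -> (forall t, a <= t <= b -> ccont f t) -> is_cint f a b (cint f a b).
Proof.
  intros Hab H. apply (RInt_correct (V := C_R_CompleteNormedModule)).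
  apply (ex_RInt_continuous (V := C_R_CompleteNormedModule)).
  rewrite Rmin_left, Rmax_right by exact Hab.
  intros t Ht. apply filterlim_locally. intros e.
  generalize (H t Ht e (cond_pos e)). apply filter_imp. intros s Hs.
  apply C_NormedModule_mixin_compat1. exact Hs.
Qed.

Lemma is_cint_ext (f g : R -> C) (a b : R) (I : C) :
  a <= b -> (forall t, a <= t <= b -> f t = g t) -> is_cint f a b I -> is_cint g a b I.
Proof.
  intros Hab E. apply (is_RInt_ext (V := C_R_NormedModule)).
  rewrite Rmin_left, Rmax_right by exact Hab.
  intros t Ht. apply E. lra.
Qed.

Lemma is_cint_plus (f g : R -> C) (a b : R) (I J : C) :
  is_cint f a b I -> is_cint g a b J -> is_cint (fun t => (f t + g t)%C) a b (I + J)%C.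
Proof. apply (is_RInt_plus (V := C_R_NormedModule)). Qed.

Lemma is_cint_scal (f : R -> C) (a b : R) (c I : C) :
  is_cint f a b I -> is_cint (fun t => (c * f t)%C) a b (c * I)%C.
Proof.
  intros H.
  assert (H1 := is_RInt_fct_extend_fst (U := R_NormedModule) (V := R_NormedModule) f a b I H).
  assert (H2 := is_RInt_fct_extend_snd (U := R_NormedModule) (V := R_NormedModule) f a b I H).
  unfold Cmult.
  apply (is_RInt_fct_extend_pair (U := R_NormedModule) (V := R_NormedModule)); simpl.
  - apply (is_RInt_minus (V := R_NormedModule)); now apply (is_RInt_scal (V := R_NormedModule)).
  - apply (is_RInt_plus (V := R_NormedModule)); now apply (is_RInt_scal (V := R_NormedModule)).
Qed.

Lemma is_cint_minus (f g : R -> C) (a b : R) (I J : C) :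
  is_cint f a b I -> is_cint g a b J -> is_cint (fun t => (f t - g t)%C) a b (I - J)%C.
Proof. apply (is_RInt_minus (V := C_R_NormedModule)). Qed.

Lemma is_cint_const (c : C) (a b : R) : is_cint (fun _ => c) a b (RtoC (b - a) * c)%C.
Proof.
  assert (E : (RtoC (b - a) * c)%C = scal (V := C_R_NormedModule) (b - a) c).
  { destruct c as [x y]. unfold RtoC, Cmult; simpl.
    unfold scal; simpl. unfold prod_scal, scal; simpl. unfold mult; simpl. f_equal; ring. }
  rewrite E. apply (is_RInt_const (V := C_R_NormedModule)).
Qed.

Lemma is_cint_bound (f : R -> C) (a b M : R) (I : C) :
  a <= b -> (forall t, a <= t <= b -> Cmod (f t) <= M) -> is_cint f a b I ->
  Cmod I <= (b - a) * M.
Proof.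
  intros Hab H HI. rewrite <- C_R_norm.
  apply (norm_RInt_le_const (V := C_R_NormedModule) f a b I M Hab); [|exact HI].
  intros t Ht. rewrite C_R_norm. now apply H.
Qed.

Lemma cint_Chasles (f : R -> C) (a b c : R) :
  a <= b -> b <= c -> (forall t, a <= t <= c -> ccont f t) ->
  cint f a c = (cint f a b + cint f b c)%C.
Proof.
  intros Hab Hbc H. apply is_cint_unique.
  apply (is_RInt_Chasles (V := C_R_NormedModule) f a b c);
    apply ccont_is_cint; try assumption; intros t Ht; apply H; lra.
Qed.

Lemma ccont_const (c : C) (t : R) : ccont (fun _ => c) t.
Proof. apply clim_const. Qed.

Lemma ccont_mult (f g : R -> C) (t : R) :
  ccont f t -> ccont g t -> ccont (fun s => (f s * g s)%C) t.
Proof. intros Hf Hg. now apply clim_mult. Qed.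

Lemma ccont_plus (f g : R -> C) (t : R) :
  ccont f t -> ccont g t -> ccont (fun s => (f s + g s)%C) t.
Proof. intros Hf Hg. now apply clim_plus. Qed.

Lemma ccont_minus (f g : R -> C) (t : R) :
  ccont f t -> ccont g t -> ccont (fun s => (f s - g s)%C) t.
Proof. intros Hf Hg. now apply clim_minus. Qed.

Lemma ccont_inv (f : R -> C) (t : R) :
  ccont f t -> f t <> 0 -> ccont (fun s => (/ f s)%C) t.
Proof. intros Hf Ht. now apply clim_inv. Qed.

Lemma ccont_RtoC (t : R) : ccont RtoC t.
Proof.
  intros e He. exists (mkposreal e He). intros s Hs.
  rewrite <- RtoC_minus, Cmod_R. exact Hs.
Qed.

Lemma ccont_comp (f : R -> C) (g : C -> C) (t : R) :
  ccont f t -> clim (nbhd (f t)) g (g (f t)) -> ccont (fun s => g (f s)) t.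
Proof. intros Hf Hg. now apply clim_comp with (f t). Qed.

Lemma cder_ccont (F : C -> C) (t : R) (l : C) : cder F t l -> ccont (fun s : R => F s) t.
Proof. intros H. apply ccont_comp; [apply ccont_RtoC|]. now apply cder_continuous with l. Qed.

Lemma ccont_bounded (f : R -> C) (a b : R) :
  a <= b -> (forall t, a <= t <= b -> ccont f t) ->
  exists M, forall t, a <= t <= b -> Cmod (f t) <= M.
Proof.
  intros Hab Hf.
  destruct (continuity_ab_maj (fun t => Cmod (f t)) a b Hab) as [m [Hm _]].
  - intros t Ht. apply continuity_pt_filterlim. apply filterlim_locally. intros e.
    generalize (Hf t Ht e (cond_pos e)). apply filter_imp. intros s Hs.
    assert (T1 := Cmod_triangle_rev (f s) (f t)).
    assert (T2 := Cmod_triangle_rev (f t) (f s)). rewrite Cmod_sub_sym in T2.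
    apply Rle_lt_trans with (2 := Hs).
    change (Rabs (Cmod (f s) - Cmod (f t)) <= Cmod (f s - f t)).
    apply Rabs_le. lra.
  - exists (Cmod (f m)). exact Hm.
Qed.

Lemma is_cint_cder (F : C -> C) (F' : R -> C) (a b : R) :
  a <= b -> (forall t : R, a <= t <= b -> cder F t (F' t)) ->
  (forall t, a <= t <= b -> ccont F' t) ->
  is_cint F' a b (F b - F a)%C.
Proof.
  intros Hab HF HF'.
  apply (is_RInt_derive (V := C_R_CompleteNormedModule) (fun t : R => F t) F');
    rewrite Rmin_left, Rmax_right by exact Hab; intros t Ht.
  - split; [apply is_linear_scal_l|].
    intros x Hx e.
    assert (Ex : x = t).
    { symmetry. apply (is_filter_lim_locally_unique (V := R_NormedModule) t x Hx). }
    subst x.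
    destruct (cder_bound _ _ _ _ (HF t Ht) (cond_pos e)) as [d [Hd H]].
    exists (mkposreal d Hd). intros s Hs.
    rewrite C_R_norm.
    assert (E : Cmod (s - t) = Rabs (s - t)) by (rewrite <- RtoC_minus; apply Cmod_R).
    change (norm (minus s t)) with (Rabs (s - t)). rewrite <- E.
    apply (eq_ind (F s - F t - (s - t) * F' t)%C (fun v => Cmod v <= e * Cmod (s - t))).
    + apply H. rewrite E. exact Hs.
    + transitivity (F s - F t - scal (V := C_R_NormedModule) (s - t)%R (F' t))%C;
        [|reflexivity].
      f_equal.
      destruct (F' t) as [x y]. unfold scal; simpl. unfold prod_scal, scal; simpl.
      unfold mult; simpl. unfold Cmult, Cminus, Cplus, Copp, RtoC; simpl.
      f_equal; ring.
  - apply filterlim_locally. intros e.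
    generalize (HF' t Ht e (cond_pos e)). apply filter_imp. intros s Hs.
    apply C_NormedModule_mixin_compat1. exact Hs.
Qed.

(** * Cauchy's theorem for cones over a closed curve *)

(** Goursat's bisection: among the four quarters of a rectangle one carries at least a
    quarter of the value; the nested quarters chosen in this way shrink to a point,
    near which the value is small against the area. *)
Lemma rect_vanish (J : R -> R -> R -> R -> C) (a b c d : R) :
  a < b -> c < d ->
  (forall x0 x1 x2 y0 y1, a <= x0 -> x0 <= x1 -> x1 <= x2 -> x2 <= b ->
     c <= y0 -> y0 <= y1 -> y1 <= d ->
     J x0 x2 y0 y1 = (J x0 x1 y0 y1 + J x1 x2 y0 y1)%C) ->
  (forall x0 x1 y0 y1 y2, a <= x0 -> x0 <= x1 -> x1 <= b ->
     c <= y0 -> y0 <= y1 -> y1 <= y2 -> y2 <= d ->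
     J x0 x1 y0 y2 = (J x0 x1 y0 y1 + J x0 x1 y1 y2)%C) ->
  (forall x y e, a <= x <= b -> c <= y <= d -> 0 < e ->
     exists r, 0 < r /\ forall s x0 y0, 0 < s -> s < r ->
       a <= x0 -> x0 <= x <= x0 + s * (b - a) -> x0 + s * (b - a) <= b ->
       c <= y0 -> y0 <= y <= y0 + s * (d - c) -> y0 + s * (d - c) <= d ->
       Cmod (J x0 (x0 + s * (b - a)) y0 (y0 + s * (d - c))) <= e * s ^ 2) ->
  J a b c d = 0.
Proof.
  intros Hab Hcd AX AY Loc.
  set (w := b - a). set (h := d - c).
  assert (Hw : 0 < w) by (unfold w; lra). assert (Hh : 0 < h) by (unfold h; lra).
  set (s := fun n => (/ 2) ^ n).
  assert (Hs : forall n, 0 < s n) by (intros n; apply pow_lt; lra).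
  assert (HsS : forall n, s n = 2 * s (S n)) by (intros n; unfold s; simpl; field).
  set (K := fun n (p : R * R) =>
    J (fst p) (fst p + s n * w) (snd p) (snd p + s n * h)).
  set (inside := fun n (p : R * R) =>
    a <= fst p /\ fst p + s n * w <= b /\ c <= snd p /\ snd p + s n * h <= d).
  set (good := fun n (p q : R * R) =>
    fst p <= fst q /\ fst q + s (S n) * w <= fst p + s n * w /\
    snd p <= snd q /\ snd q + s (S n) * h <= snd p + s n * h /\
    Cmod (K n p) <= 4 * Cmod (K (S n) q)).
  assert (Step : forall n p, inside n p -> exists q, good n p q).
  { intros n [x y] [I1 [I2 [I3 I4]]]. simpl in *.
    assert (Hn := Hs (S n)). assert (En := HsS n).
    assert (Hnw : 0 < s (S n) * w) by now apply Rmult_lt_0_compat.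
    assert (Hnh : 0 < s (S n) * h) by now apply Rmult_lt_0_compat.
    set (u := s (S n) * w) in *. set (v := s (S n) * h) in *.
    assert (Eu : s n * w = 2 * u) by (unfold u; rewrite En; ring).
    assert (Ev : s n * h = 2 * v) by (unfold v; rewrite En; ring).
    rewrite Eu in I2. rewrite Ev in I4.
    set (k00 := K (S n) (x, y)). set (k01 := K (S n) (x, y + v)).
    set (k10 := K (S n) (x + u, y)). set (k11 := K (S n) (x + u, y + v)).
    assert (Split : K n (x, y) = ((k00 + k01) + (k10 + k11))%C).
    { unfold k00, k01, k10, k11, K; simpl. rewrite Eu, Ev. fold u v.
      rewrite (AX x (x + u) (x + 2 * u)) by lra.
      rewrite (AY x (x + u) y (y + v)) by lra.
      rewrite (AY (x + u) (x + 2 * u) y (y + v)) by lra.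
      replace (x + u + u) with (x + 2 * u) by ring.
      replace (y + v + v) with (y + 2 * v) by ring. reflexivity. }
    assert (T := Cmod_triangle (k00 + k01) (k10 + k11)).
    assert (T1 := Cmod_triangle k00 k01). assert (T2 := Cmod_triangle k10 k11).
    rewrite <- Split in T.
    destruct (Rle_dec (Cmod (K n (x, y))) (4 * Cmod k00)) as [B1|B1].
    { exists (x, y). unfold good; cbn [fst snd]. fold u v k00 k01 k10 k11. rewrite Eu, Ev.
      repeat split; try lra. }
    destruct (Rle_dec (Cmod (K n (x, y))) (4 * Cmod k01)) as [B2|B2].
    { exists (x, y + v). unfold good; cbn [fst snd]. fold u v k00 k01 k10 k11. rewrite Eu, Ev.
      repeat split; try lra. }
    destruct (Rle_dec (Cmod (K n (x, y))) (4 * Cmod k10)) as [B3|B3].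
    { exists (x + u, y). unfold good; cbn [fst snd]. fold u v k00 k01 k10 k11. rewrite Eu, Ev.
      repeat split; try lra. }
    exists (x + u, y + v). unfold good; cbn [fst snd]. fold u v k00 k01 k10 k11. rewrite Eu, Ev.
    repeat split; try lra. }
  set (step := fun n p => epsilon (inhabits p) (good n p)).
  set (pt := fix pt n := match n with O => (a, c) | S m => step m (pt m) end).
  assert (In : forall n, inside n (pt n) /\ Cmod (J a b c d) <= 4 ^ n * Cmod (K n (pt n))).
  { induction n as [|n [I B]].
    - unfold inside, K, s; simpl. split; [repeat split; unfold w, h; lra|].
      right. unfold w, h. rewrite !Rmult_1_l. do 3 f_equal; ring.
    - assert (G : good n (pt n) (pt (S n))).
      { simpl. unfold step. apply epsilon_spec. now apply Step. }
      destruct I as [I1 [I2 [I3 I4]]]. destruct G as [G1 [G2 [G3 [G4 G5]]]].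
      split; [repeat split; lra|].
      apply Rle_trans with (1 := B).
      replace (4 ^ S n * Cmod (K (S n) (pt (S n))))
        with (4 ^ n * (4 * Cmod (K (S n) (pt (S n))))) by (simpl; ring).
      apply Rmult_le_compat_l; [apply pow_le; lra|exact G5]. }
  assert (G : forall n, good n (pt n) (pt (S n))).
  { intros n. simpl. unfold step. apply epsilon_spec, Step, In. }
  assert (Mono : forall n m, (n <= m)%nat ->
    fst (pt n) <= fst (pt m) /\ fst (pt m) + s m * w <= fst (pt n) + s n * w /\
    snd (pt n) <= snd (pt m) /\ snd (pt m) + s m * h <= snd (pt n) + s n * h).
  { intros n m Hnm. induction Hnm as [|m Hnm IH]; [lra|].
    destruct (G m) as [G1 [G2 [G3 [G4 _]]]]. lra. }
  (* the common point of the nested rectangles, one coordinate at a time *)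
  assert (Lub : forall (x : nat -> R) (l : R), 0 < l ->
    (forall n m, (n <= m)%nat -> x n <= x m /\ x m + s m * l <= x n + s n * l) ->
    exists X, forall n, x n <= X <= x n + s n * l).
  { intros x l Hl M.
    assert (Up : forall n m, x n <= x m + s m * l).
    { intros n m. assert (P := Rmult_lt_0_compat _ _ (Hs m) Hl).
      assert (P' := Rmult_lt_0_compat _ _ (Hs n) Hl).
      destruct (Nat.le_ge_cases n m) as [H|H]; specialize (M _ _ H); lra. }
    destruct (completeness (fun X => exists n, X = x n)) as [X [HX1 HX2]].
    - exists (x O + s O * l). intros X [n ->]. apply Up.
    - exists (x O). now exists O.
    - exists X. intros n. split; [apply HX1; now exists n|].
      apply HX2. intros Y [m ->]. apply Up. }
  destruct (Lub (fun n => fst (pt n)) w Hw) as [X HX].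
  { intros n m Hnm. specialize (Mono n m Hnm). lra. }
  destruct (Lub (fun n => snd (pt n)) h Hh) as [Y HY].
  { intros n m Hnm. specialize (Mono n m Hnm). lra. }
  apply Cmod_le_0. intros e He.
  assert (P : a <= X <= b /\ c <= Y <= d).
  { specialize (HX O). specialize (HY O). destruct (In O) as [[I1 [I2 [I3 I4]]] _]. lra. }
  destruct (Loc X Y e (proj1 P) (proj2 P) He) as [r [Hr L]].
  destruct (pow_lt_1_zero (/ 2) ltac:(rewrite Rabs_pos_eq; lra) r Hr) as [N HN].
  specialize (HN N (le_n N)).
  rewrite Rabs_pos_eq in HN by (apply pow_le; lra).
  destruct (In N) as [[I1 [I2 [I3 I4]]] B].
  specialize (L (s N) (fst (pt N)) (snd (pt N)) (Hs N) HN I1 (HX N) I2 I3 (HY N) I4).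
  change (Cmod (K N (pt N)) <= e * s N ^ 2) in L.
  apply Rle_trans with (1 := B).
  apply Rle_trans with (4 ^ N * (e * s N ^ 2)).
  { apply Rmult_le_compat_l; [apply pow_le; lra|exact L]. }
  right. unfold s. rewrite <- pow_mult, Nat.mul_comm, pow_mult.
  replace ((/ 2) ^ 2) with (/ 4) by field.
  replace (4 ^ N * (e * (/ 4) ^ N)) with (e * (4 * / 4) ^ N) by (rewrite Rpow_mult_distr; ring).
  rewrite Rinv_r, pow1 by lra. ring.
Qed.

(** The affine part [A + (x - c) * B] of [g] has the primitive [P], so that it contributes
    the increment of [P] exactly and only the error has to be estimated. *)
Lemma arc_integral_near_affine (g phi : C -> C) (dphi : R -> C) (u v K eta : R) (A B c : C) :
  u <= v ->
  (forall t : R, u <= t <= v -> cder phi t (dphi t)) ->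
  (forall t, u <= t <= v -> ccont dphi t) ->
  (forall t : R, u <= t <= v -> clim (nbhd (phi t)) g (g (phi t))) ->
  (forall t, u <= t <= v -> Cmod (dphi t) <= K) ->
  (forall t : R, u <= t <= v -> Cmod (g (phi t) - A - (phi t - c) * B) <= eta) ->
  let P := fun x : C => (A * (x - c) + B / 2 * ((x - c) * (x - c)))%C in
  Cmod (cint (fun t : R => (g (phi t) * dphi t)%C) u v - (P (phi v) - P (phi u)))
    <= (v - u) * (eta * K).
Proof.
  intros Huv Hphi Hdphi Hg HK Heta P.
  assert (Cphi : forall t : R, u <= t <= v -> ccont (fun s : R => phi s) t).
  { intros t Ht. now apply cder_ccont with (dphi t), Hphi. }
  assert (HP : is_cint (fun t : R => ((A + (phi t - c) * B) * dphi t)%C) u v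
                 (P (phi v) - P (phi u))%C).
  { apply (is_cint_cder (fun x => P (phi x))); [exact Huv| |].
    - intros t Ht.
      apply (eq_ind (dphi t * (A + (phi t - c) * B))%C (cder _ (RtoC t))); [|ring].
      apply cder_comp; [|now apply Hphi]. unfold P.
      set (x := phi t).
      assert (D : cder (fun y => (y - c)%C) x (1 - 0)%C)
        by (apply cder_minus; [apply cder_id|apply cder_const]).
      apply (eq_ind (A * (1 - 0) + B / 2 * ((1 - 0) * (x - c) + (x - c) * (1 - 0)))%C (cder _ x)).
      + apply cder_plus; apply cder_scal; [exact D|]. exact (cder_mult _ _ _ _ _ D D).
      + field.
    - intros t Ht. apply ccont_mult; [|now apply Hdphi].
      apply ccont_plus; [apply ccont_const|]. apply ccont_mult; [|apply ccont_const].
      apply ccont_minus; [now apply Cphi|apply ccont_const]. }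
  assert (Hint : is_cint (fun t : R => (g (phi t) * dphi t)%C) u v
                   (cint (fun t : R => (g (phi t) * dphi t)%C) u v)).
  { apply ccont_is_cint; [exact Huv|]. intros t Ht. apply ccont_mult; [|now apply Hdphi].
    apply (ccont_comp (fun s : R => phi s)); [now apply Cphi|now apply Hg]. }
  assert (D := is_cint_minus _ _ _ _ _ _ Hint HP).
  apply (is_cint_bound _ _ _ _ _ Huv) with (2 := D).
  intros t Ht.
  replace (g (phi t) * dphi t - (A + (phi t - c) * B) * dphi t)%C
    with ((g (phi t) - A - (phi t - c) * B) * dphi t)%C by ring.
  rewrite Cmod_mult. apply Rmult_le_compat; try apply Cmod_ge_0; auto.
Qed.

(** The closed curve [gamma] bounds the cone of the segments from [z] to its points.
    On the rectangle of parameters [(t, theta)] the boundary integral of a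
    holomorphic [g] is an additive function of rectangles, [o] of the area because
    [g] is nearly affine near each point; so it vanishes, and since [gamma] closes
    up the two sides [theta = u] and [theta = v] cancel. *)
Lemma cone_integral (g gamma : C -> C) (dgamma : R -> C) (z : C) (u v a : R) :
  u < v -> 0 < a -> a < 1 ->
  (forall s : R, u <= s <= v -> cder gamma s (dgamma s)) ->
  (forall s, u <= s <= v -> ccont dgamma s) ->
  (exists K, forall s : R, u <= s <= v -> Cmod (gamma s) <= K /\ Cmod (dgamma s) <= K) ->
  gamma u = gamma v ->
  (forall t s : R, a <= t <= 1 -> u <= s <= v -> exists l, cder g (z + t * gamma s)%C l) ->
  cint (fun s : R => (g (z + 1 * gamma s) * (1 * dgamma s))%C) u v =
  cint (fun s : R => (g (z + a * gamma s) * (a * dgamma s))%C) u v.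
Proof.
  intros Huv Ha0 Ha1 Hgam Hdgam [K HK] Hclosed Hg.
  assert (HK0 : 0 <= K).
  { apply Rle_trans with (Cmod (gamma u)); [apply Cmod_ge_0|]. apply HK. lra. }
  set (V := fun (t s0 s1 : R) =>
    cint (fun s : R => (g (z + t * gamma s) * (t * dgamma s))%C) s0 s1).
  set (H := fun (s t0 t1 : R) =>
    cint (fun t : R => (g (z + t * gamma s) * gamma s)%C) t0 t1).
  assert (CV : forall t s : R, a <= t <= 1 -> u <= s <= v ->
    ccont (fun s : R => (g (z + t * gamma s) * (t * dgamma s))%C) s).
  { intros t s Ht Hs. destruct (Hg t s Ht Hs) as [l Hl].
    apply ccont_mult.
    - apply (ccont_comp (fun s : R => (z + t * gamma s)%C)).
      + apply ccont_plus; [apply ccont_const|]. apply ccont_mult; [apply ccont_const|].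
        now apply cder_ccont with (dgamma s), Hgam.
      + now apply cder_continuous with l.
    - apply ccont_mult; [apply ccont_const|now apply Hdgam]. }
  assert (CH : forall t s : R, a <= t <= 1 -> u <= s <= v ->
    ccont (fun t : R => (g (z + t * gamma s) * gamma s)%C) t).
  { intros t s Ht Hs. destruct (Hg t s Ht Hs) as [l Hl].
    apply ccont_mult; [|apply ccont_const].
    apply (ccont_comp (fun t : R => (z + t * gamma s)%C)).
    - apply ccont_plus; [apply ccont_const|]. apply ccont_mult; [|apply ccont_const].
      apply ccont_RtoC.
    - now apply cder_continuous with l. }
  set (J := fun t0 t1 s0 s1 => (V t1 s0 s1 - V t0 s0 s1 - (H s1 t0 t1 - H s0 t0 t1))%C).
  assert (J0 : J a 1 u v = 0).
  { apply rect_vanish; [exact Ha1|exact Huv| | |].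
    - intros t0 t1 t2 s0 s1 ? ? ? ? ? ? ?. unfold J, H.
      rewrite (cint_Chasles _ t0 t1 t2) by (try assumption; intros t Ht; apply CH; lra).
      rewrite (cint_Chasles (fun t : R => (g (z + t * gamma s0) * gamma s0)%C) t0 t1 t2)
        by (try assumption; intros t Ht; apply CH; lra).
      ring.
    - intros t0 t1 s0 s1 s2 ? ? ? ? ? ? ?. unfold J, V.
      rewrite (cint_Chasles _ s0 s1 s2) by (try assumption; intros s Hs; apply CV; lra).
      rewrite (cint_Chasles (fun s : R => (g (z + t0 * gamma s) * (t0 * dgamma s))%C) s0 s1 s2)
        by (try assumption; intros s Hs; apply CV; lra).
      ring.
    - intros t s e Ht Hs He.
      set (c := (z + t * gamma s)%C).
      destruct (Hg t s Ht Hs) as [B HB]. fold c in HB.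
      set (L := K * ((1 - a) + (v - u))).
      set (W := (1 - a) + (v - u)).
      assert (HW : 0 < W) by (unfold W; lra).
      assert (HL : 0 <= L) by (apply Rmult_le_pos; [exact HK0|fold W; lra]).
      set (M := L * K * (2 * W) + 1).
      assert (HM : 0 < M).
      { assert (0 <= L * K * (2 * W)); [|unfold M; lra].
        apply Rmult_le_pos; [now apply Rmult_le_pos|lra]. }
      destruct (cder_bound g c B (e / M) HB (Rdiv_lt_0_compat _ _ He HM)) as [d [Hd Hnear]].
      exists (d / (L + 1)). split; [apply Rdiv_lt_0_compat; lra|].
      intros r t0 s0 Hr0 Hr Ht0 Ht1 Ht2 Hs0 Hs1 Hs2.
      set (t1 := t0 + r * (1 - a)) in *. set (s1 := s0 + r * (v - u)) in *.
      assert (Hrt : 0 <= r * (1 - a)) by (apply Rmult_le_pos; lra).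
      assert (Hrs : 0 <= r * (v - u)) by (apply Rmult_le_pos; lra).
      assert (Hrd : L * r < d).
      { apply Rle_lt_trans with ((L + 1) * r); [apply Rmult_le_compat_r; lra|].
        apply Rmult_lt_reg_l with (/ (L + 1)); [apply Rinv_0_lt_compat; lra|].
        rewrite <- Rmult_assoc, Rinv_l, Rmult_1_l by lra.
        rewrite Rmult_comm. exact Hr. }
      assert (Lip : forall x y : R, u <= x -> x <= y -> y <= v ->
        Cmod (gamma y - gamma x) <= K * (y - x)).
      { intros x y Hx Hxy Hy. rewrite Rmult_comm.
        apply (is_cint_bound dgamma x y K); [exact Hxy| |].
        - intros p Hp. apply HK. lra.
        - apply is_cint_cder; [exact Hxy| |]; intros p Hp; [apply Hgam|apply Hdgam]; lra. }
      assert (Lip' : forall x, s0 <= x <= s1 -> Cmod (gamma x - gamma s) <= K * (r * (v - u))).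
      { intros x Hx. destruct (Rle_dec s x) as [Hsx|Hsx].
        - apply Rle_trans with (K * (x - s)); [apply Lip; lra|].
          apply Rmult_le_compat_l; [exact HK0|unfold s1 in *; lra].
        - rewrite Cmod_sub_sym. apply Rle_trans with (K * (s - x)); [apply Lip; lra|].
          apply Rmult_le_compat_l; [exact HK0|unfold s1 in *; lra]. }
      assert (Near : forall t' s' : R, t0 <= t' <= t1 -> s0 <= s' <= s1 ->
        Cmod ((z + t' * gamma s') - c) <= L * r).
      { intros t' s' Ht' Hs'. unfold c.
        replace (z + t' * gamma s' - (z + t * gamma s))%C
          with ((t' - t) * gamma s' + t * (gamma s' - gamma s))%C by ring.
        apply Rle_trans with (1 := Cmod_triangle _ _). rewrite !Cmod_mult.
        rewrite <- RtoC_minus, !Cmod_R, (Rabs_pos_eq t) by lra.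
        assert (A1 : Rabs (t' - t) * Cmod (gamma s') <= (r * (1 - a)) * K).
        { apply Rmult_le_compat; [apply Rabs_pos|apply Cmod_ge_0| |apply HK; lra].
          apply Rabs_le. unfold t1 in *. lra. }
        assert (A2 : t * Cmod (gamma s' - gamma s) <= 1 * (K * (r * (v - u)))).
        { apply Rmult_le_compat; [lra|apply Cmod_ge_0|lra|now apply Lip']. }
        unfold L. replace (K * (1 - a + (v - u)) * r)
          with (r * (1 - a) * K + 1 * (K * (r * (v - u)))) by ring. lra. }
      assert (Eta : forall t' s' : R, t0 <= t' <= t1 -> s0 <= s' <= s1 ->
        Cmod (g (z + t' * gamma s') - g c - ((z + t' * gamma s') - c) * B)%C
          <= e / M * (L * r)).
      { intros t' s' Ht' Hs'. assert (N := Near t' s' Ht' Hs').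
        apply Rle_trans with (1 := Hnear (z + t' * gamma s')%C (Rle_lt_trans _ _ _ N Hrd)).
        apply Rmult_le_compat_l; [left; now apply Rdiv_lt_0_compat|exact N]. }
      assert (EV : forall t', t0 <= t' <= t1 -> _) by
        exact (fun t' Ht' =>
          arc_integral_near_affine g (fun x => (z + t' * gamma x)%C)
            (fun x => (t' * dgamma x)%C) s0 s1 K (e / M * (L * r)) (g c) B c).
      assert (EH : forall s', s0 <= s' <= s1 -> _) by
        exact (fun s' Hs' =>
          arc_integral_near_affine g (fun x => (z + x * gamma s')%C)
            (fun _ => gamma s') t0 t1 K (e / M * (L * r)) (g c) B c).
      cbv zeta in EV, EH.
      set (P := fun x : C => (g c * (x - c) + B / 2 * ((x - c) * (x - c)))%C) in *.
      assert (BV : forall t', t0 <= t' <= t1 ->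
        Cmod (V t' s0 s1 - (P (z + t' * gamma s1) - P (z + t' * gamma s0)))%C
          <= (s1 - s0) * (e / M * (L * r) * K)).
      { intros t' Ht'. apply (EV t' Ht'); [unfold s1; lra| | | | |].
        - intros x Hx. apply (eq_ind (0 + t' * dgamma x)%C (cder _ x)); [|ring].
          apply (cder_plus (fun _ => z)); [apply cder_const|]. apply cder_scal, Hgam. lra.
        - intros x Hx. apply ccont_mult; [apply ccont_const|apply Hdgam; lra].
        - intros x Hx. destruct (Hg t' x) as [l Hl]; [lra|lra|]. now apply cder_continuous with l.
        - intros x Hx. rewrite Cmod_mult, Cmod_R, Rabs_pos_eq by lra.
          rewrite <- (Rmult_1_l K).
          apply Rmult_le_compat; [lra|apply Cmod_ge_0|lra|apply HK; lra].
        - intros x Hx. now apply Eta. }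
      assert (BH : forall s', s0 <= s' <= s1 ->
        Cmod (H s' t0 t1 - (P (z + t1 * gamma s') - P (z + t0 * gamma s')))%C
          <= (t1 - t0) * (e / M * (L * r) * K)).
      { intros s' Hs'. apply (EH s' Hs'); [unfold t1; lra| | | | |].
        - intros x Hx. apply (eq_ind (0 + (1 * gamma s' + x * 0))%C (cder _ x)); [|ring].
          apply (cder_plus (fun _ => z)); [apply cder_const|].
          apply (cder_mult (fun y => y) (fun _ => gamma s')); [apply cder_id|apply cder_const].
        - intros x Hx. apply ccont_const.
        - intros x Hx. destruct (Hg x s') as [l Hl]; [lra|lra|]. now apply cder_continuous with l.
        - intros x Hx. apply HK; lra.
        - intros x Hx. now apply Eta. }
      assert (V1 := BV t1 ltac:(unfold t1; lra)). assert (V0 := BV t0 ltac:(unfold t1; lra)).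
      assert (H1 := BH s1 ltac:(unfold s1; lra)). assert (H0 := BH s0 ltac:(unfold s1; lra)).
      assert (Split : forall p q x y : C, Cmod (p - q - (x - y)) <=
        Cmod p + Cmod q + Cmod x + Cmod y).
      { intros p q x y.
        assert (T1 := Cmod_triangle (p - q) (- (x - y))).
        assert (T2 := Cmod_triangle p (- q)). assert (T3 := Cmod_triangle x (- y)).
        rewrite Cmod_opp in T1, T2, T3. unfold Cminus in *. lra. }
      (* the increments of the primitive around the rectangle cancel *)
      replace (J t0 t1 s0 s1) with
        ((V t1 s0 s1 - (P (z + t1 * gamma s1) - P (z + t1 * gamma s0)))
         - (V t0 s0 s1 - (P (z + t0 * gamma s1) - P (z + t0 * gamma s0)))
         - ((H s1 t0 t1 - (P (z + t1 * gamma s1) - P (z + t0 * gamma s1)))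
            - (H s0 t0 t1 - (P (z + t1 * gamma s0) - P (z + t0 * gamma s0)))))%C
        by (unfold J; ring).
      apply Rle_trans with (1 := Split _ _ _ _).
      assert (Etot : 2 * ((s1 - s0) * (e / M * (L * r) * K))
               + 2 * ((t1 - t0) * (e / M * (L * r) * K))
             = (e / M) * (L * K * (2 * W)) * r ^ 2).
      { unfold s1, t1, W. field. lra. }
      assert (EM : (e / M) * (L * K * (2 * W)) <= e).
      { apply Rle_trans with (e / M * M); [|right; field; lra].
        apply Rmult_le_compat_l; [left; now apply Rdiv_lt_0_compat|unfold M; lra]. }
      assert (0 <= r ^ 2) by (apply pow_le; lra).
      assert (EM2 := Rmult_le_compat_r _ _ _ H2 EM).
      lra. }
  unfold J in J0.
  assert (EH : H v a 1 = H u a 1).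
  { unfold H. rewrite Hclosed. reflexivity. }
  rewrite EH in J0.
  apply Cmod_sub_0. change (Cmod (V 1 u v - V a u v) = 0).
  replace (V 1 u v - V a u v)%C
    with (V 1 u v - V a u v - (H u a 1 - H u a 1))%C by ring.
  rewrite J0. apply Cmod_0.
Qed.

(** * Series of complex numbers *)

Fixpoint csum (a : nat -> C) (n : nat) : C :=
  match n with O => RtoC 0 | S m => (csum a m + a m)%C end.

Definition is_cseries (a : nat -> C) (l : C) : Prop := clim eventually (csum a) l.

Lemma csum_ext (a b : nat -> C) (n : nat) :
  (forall k, (k < n)%nat -> a k = b k) -> csum a n = csum b n.
Proof.
  induction n as [|n IH]; intros H; [reflexivity|]. simpl. rewrite IH, H; auto with arith.
Qed.

Lemma csum_plus (a b : nat -> C) (n : nat) :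
  csum (fun k => (a k + b k)%C) n = (csum a n + csum b n)%C.
Proof. induction n as [|n IH]; simpl; [ring|]. rewrite IH. ring. Qed.

Lemma csum_scal (c : C) (a : nat -> C) (n : nat) :
  csum (fun k => (c * a k)%C) n = (c * csum a n)%C.
Proof. induction n as [|n IH]; simpl; [ring|]. rewrite IH. ring. Qed.

Lemma csum_shift (a : nat -> C) (n : nat) :
  csum a (S n) = (a O + csum (fun k => a (S k)) n)%C.
Proof. induction n as [|n IH]; [simpl; ring|]. simpl in *. rewrite IH. ring. Qed.

Lemma csum_geom (w : C) (n : nat) :
  (csum (fun k => (w ^ k)%C) n * (1 - w))%C = (1 - w ^ n)%C.
Proof.
  induction n as [|n IH]; simpl; [ring|].
  replace ((csum (fun k => (w ^ k)%C) n + w ^ n) * (1 - w))%C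
    with (csum (fun k => (w ^ k)%C) n * (1 - w) + w ^ n * (1 - w))%C by ring.
  rewrite IH. ring.
Qed.

Lemma clim_eventually_S (u : nat -> C) (l : C) :
  clim eventually u l <-> clim eventually (fun n => u (S n)) l.
Proof.
  split; intros H e He; destruct (H e He) as [N HN].
  - exists N. intros n Hn. apply HN. lia.
  - exists (S N). intros [|n] Hn; [lia|]. apply HN. lia.
Qed.

Lemma is_cseries_ext (a b : nat -> C) (l : C) :
  (forall k, a k = b k) -> is_cseries a l -> is_cseries b l.
Proof. intros E. apply clim_ext. intros n. now apply csum_ext. Qed.

Lemma is_cseries_plus (a b : nat -> C) (l m : C) :
  is_cseries a l -> is_cseries b m -> is_cseries (fun k => (a k + b k)%C) (l + m)%C.
Proof.
  intros Ha Hb. apply clim_ext with (fun n => (csum a n + csum b n)%C).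
  - intros n. symmetry. apply csum_plus.
  - now apply clim_plus.
Qed.

Lemma is_cseries_scal (c : C) (a : nat -> C) (l : C) :
  is_cseries a l -> is_cseries (fun k => (c * a k)%C) (c * l)%C.
Proof.
  intros Ha. apply clim_ext with (fun n => (c * csum a n)%C).
  - intros n. symmetry. apply csum_scal.
  - now apply (clim_mult (fun _ => c)); [apply clim_const|].
Qed.

Lemma is_cseries_minus (a b : nat -> C) (l m : C) :
  is_cseries a l -> is_cseries b m -> is_cseries (fun k => (a k - b k)%C) (l - m)%C.
Proof.
  intros Ha Hb. apply is_cseries_ext with (fun k => (a k + RtoC (-1) * b k)%C).
  - intros k. ring.
  - replace (l - m)%C with (l + RtoC (-1) * m)%C by ring.
    apply is_cseries_plus; [exact Ha|]. now apply is_cseries_scal.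
Qed.

Lemma is_cseries_shift (a : nat -> C) (l : C) :
  is_cseries a l <-> is_cseries (fun k => a (S k)) (l - a O)%C.
Proof.
  unfold is_cseries. rewrite (clim_eventually_S (csum a)).
  split; intros H.
  - apply clim_ext with (fun n => (csum a (S n) - a O)%C).
    + intros n. rewrite csum_shift. ring.
    + apply clim_minus; [exact H|apply clim_const].
  - apply clim_ext with (fun n => (a O + csum (fun k => a (S k)) n)%C).
    + intros n. now rewrite csum_shift.
    + replace l with (a O + (l - a O))%C by ring.
      apply (clim_plus (fun _ => a O)); [apply clim_const|exact H].
Qed.

Lemma is_cseries_shift_n (a : nat -> C) (l : C) (n : nat) :
  is_cseries a l -> is_cseries (fun k => a (n + k)%nat) (l - csum a n)%C.
Proof.
  revert a l. induction n as [|n IH]; intros a l H.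
  - simpl. replace (l - 0)%C with l by ring. exact H.
  - apply is_cseries_shift in H. apply IH in H.
    replace (l - csum a (S n))%C with (l - a O - csum (fun k => a (S k)) n)%C
      by (rewrite csum_shift; ring).
    exact H.
Qed.

Lemma is_cseries_single (a : nat -> C) :
  (forall k, (0 < k)%nat -> a k = 0) -> is_cseries a (a O).
Proof.
  intros H. apply is_cseries_shift.
  apply clim_ext with (fun _ => RtoC 0).
  - intros n. induction n as [|n IH]; simpl; [reflexivity|].
    rewrite <- IH, H by lia. ring.
  - replace (a O - a O)%C with (RtoC 0) by ring. apply clim_const.
Qed.

Lemma is_cseries_unique (a : nat -> C) (l m : C) :
  is_cseries a l -> is_cseries a m -> l = m.
Proof. apply (clim_unique eventually). Qed.

Lemma csum_geom_bound (a : nat -> C) (M q : R) (n : nat) :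
  0 <= M -> 0 <= q < 1 -> (forall k, Cmod (a k) <= M * q ^ k) ->
  Cmod (csum a n) <= M / (1 - q).
Proof.
  intros HM Hq H.
  assert (G : Cmod (csum a n) <= M * (1 - q ^ n) / (1 - q)).
  { induction n as [|n IH].
    - simpl. rewrite Cmod_0. right. field. lra.
    - simpl. apply Rle_trans with (1 := Cmod_triangle _ _).
      specialize (H n).
      replace (M * (1 - q * q ^ n) / (1 - q))
        with (M * (1 - q ^ n) / (1 - q) + M * q ^ n) by (field; lra). lra. }
  apply Rle_trans with (1 := G). unfold Rdiv.
  apply Rmult_le_compat_r; [left; apply Rinv_0_lt_compat; lra|].
  rewrite <- (Rmult_1_r M) at 2. apply Rmult_le_compat_l; [exact HM|].
  assert (0 <= q ^ n) by (apply pow_le; lra). lra.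
Qed.

Lemma is_cseries_geom_bound (a : nat -> C) (l : C) (M q : R) :
  0 <= M -> 0 <= q < 1 -> (forall k, Cmod (a k) <= M * q ^ k) -> is_cseries a l ->
  Cmod l <= M / (1 - q).
Proof.
  intros HM Hq H Hl. apply (clim_le eventually _ _ _ Hl).
  apply filter_forall. intros n. now apply csum_geom_bound.
Qed.

Lemma is_cseries_geom_tail (a : nat -> C) (l : C) (M q : R) (n : nat) :
  0 <= M -> 0 <= q < 1 -> (forall k, Cmod (a k) <= M * q ^ k) -> is_cseries a l ->
  Cmod (l - csum a n) <= M * q ^ n / (1 - q).
Proof.
  intros HM Hq H Hl.
  apply is_cseries_geom_bound with (fun k => a (n + k)%nat); [|exact Hq| |].
  - apply Rmult_le_pos; [exact HM|apply pow_le; lra].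
  - intros k. rewrite Rmult_assoc, <- pow_add. apply H.
  - now apply is_cseries_shift_n.
Qed.

Lemma ex_cseries_geom (a : nat -> C) (M q : R) :
  0 <= q < 1 -> (forall k, Cmod (a k) <= M * q ^ k) -> exists l, is_cseries a l.
Proof.
  intros Hq H.
  destruct (ex_series_le (V := C_CompleteNormedModule) a (fun k => M * q ^ k)) as [l Hl].
  - exact H.
  - apply (ex_series_scal (V := R_NormedModule) M). apply ex_series_geom.
    rewrite Rabs_pos_eq; lra.
  - exists l. apply clim_eventually_S.
    assert (E : forall n, sum_n (G := C_NormedModule) a n = csum a (S n)).
    { induction n as [|n IH].
      - rewrite sum_O. simpl. ring.
      - rewrite sum_Sn, IH. reflexivity. }
    intros e He.
    assert (He2 : 0 < e / sqrt 2) by (apply Rdiv_lt_0_compat; [exact He|apply sqrt_lt_R0; lra]).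
    generalize (proj1 (filterlim_locally _ _) Hl (mkposreal _ He2)).
    apply filter_imp. intros n Hn. rewrite <- E.
    apply C_NormedModule_mixin_compat2 in Hn. simpl in Hn.
    replace e with (sqrt 2 * (e / sqrt 2)); [exact Hn|].
    field. apply Rgt_not_eq, sqrt_lt_R0. lra.
Qed.

(** * Taylor expansion on the unit disk *)

Definition hol (f : C -> C) : Prop :=
  forall z, Cmod z < 1 -> exists l, cder f z l.

Lemma hol_iff (f : C -> C) : holomorphic_on unit_disk f <-> hol f.
Proof.
  split; intros H z Hz; destruct (H z Hz) as [l Hl]; exists l; now apply cder_iff.
Qed.

Definition circle (r : R) (s : C) : C := (r * cexp (Ci * s))%C.

Lemma Cmod_circle (r s : R) : 0 <= r -> Cmod (circle r s) = r.
Proof.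
  intros Hr. unfold circle. rewrite Cmod_mult, Cmod_R, Rabs_pos_eq by exact Hr.
  rewrite Cmod_cexp. unfold Ci, Cmult, RtoC; simpl.
  replace (0 * s - 1 * 0) with 0 by ring. rewrite exp_0. ring.
Qed.

Lemma circle_neq_0 (r s : R) : 0 < r -> circle r s <> 0.
Proof. intros Hr. apply Cmod_gt_0. rewrite Cmod_circle; lra. Qed.

Lemma circle_closed (r : R) : circle r 0 = circle r (2 * PI)%R.
Proof.
  unfold circle. f_equal.
  replace (Ci * 0)%C with (RtoC 0) by ring. rewrite cexp_0.
  replace (Ci * (2 * PI)%R)%C with ((0, 2 * PI) : C)
    by (unfold Ci, Cmult, RtoC; simpl; f_equal; ring).
  rewrite cexp_iR, cos_2PI, sin_2PI. reflexivity.
Qed.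

Lemma circle_scale (t r : R) (s : C) : circle (t * r) s = (t * circle r s)%C.
Proof. unfold circle. rewrite RtoC_mult. ring. Qed.

Lemma cder_circle (r : R) (s : C) : cder (circle r) s (Ci * circle r s)%C.
Proof.
  unfold circle.
  apply (eq_ind (r * (Ci * cexp (Ci * s)))%C (cder _ s)); [|ring].
  apply cder_scal. apply cder_comp with (g := fun y => (Ci * y)%C); [apply cder_cexp|].
  apply (eq_ind (Ci * 1)%C (cder _ s)); [|ring]. apply cder_scal, cder_id.
Qed.

Lemma ccont_circle (r s : R) : ccont (fun s : R => circle r s) s.
Proof. apply cder_ccont with (Ci * circle r s)%C. apply cder_circle. Qed.

Lemma ccont_pow (f : R -> C) (t : R) (k : nat) :
  ccont f t -> ccont (fun s => (f s ^ k)%C) t.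
Proof.
  intros Hf. induction k as [|k IH]; simpl; [apply ccont_const|now apply ccont_mult].
Qed.

Lemma cder_pow (k : nat) (z : C) : cder (fun y => (y ^ S k)%C) z (INR (S k) * z ^ k)%C.
Proof.
  induction k as [|k IH].
  - apply (eq_ind (RtoC 1) (cder _ z)); [|simpl; ring].
    apply cder_ext with (fun y => y); [intros y; simpl; ring|apply cder_id].
  - apply (eq_ind (1 * z ^ S k + z * (INR (S k) * z ^ k))%C (cder _ z)).
    + apply (cder_mult (fun y => y) (fun y => (y ^ S k)%C)); [apply cder_id|exact IH].
    + rewrite (S_INR (S k)), RtoC_plus. simpl. ring.
Qed.

(** The [k]-th Fourier coefficient of [phi] on the circle of radius [r], normalised
    so as not to depend on [r] when [phi] is the trace of a holomorphic function. *)
Definition coef (phi : R -> C) (r : R) (k : nat) : C :=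
  cint (fun s : R => (phi s * (/ circle r s) ^ k)%C) 0 (2 * PI).

Lemma Cmod_pow_inv_circle (r s : R) (k : nat) :
  0 < r -> Cmod ((/ circle r s) ^ k) = / r ^ k.
Proof.
  intros Hr. rewrite Cmod_pow, Cmod_inv by now apply circle_neq_0.
  rewrite Cmod_circle by lra. now rewrite pow_inv.
Qed.

Lemma ccont_inv_circle_pow (r s : R) (k : nat) :
  0 < r -> ccont (fun s : R => ((/ circle r s) ^ k)%C) s.
Proof.
  intros Hr. apply ccont_pow, ccont_inv; [apply ccont_circle|now apply circle_neq_0].
Qed.

Lemma is_cint_coef (phi : R -> C) (r : R) (k : nat) :
  0 < r -> (forall s, 0 <= s <= 2 * PI -> ccont phi s) ->
  is_cint (fun s : R => (phi s * (/ circle r s) ^ k)%C) 0 (2 * PI) (coef phi r k).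
Proof.
  intros Hr Hphi. apply ccont_is_cint; [assert (H := PI_RGT_0); lra|].
  intros s Hs. apply ccont_mult; [now apply Hphi|now apply ccont_inv_circle_pow].
Qed.

Lemma coef_bound (phi : R -> C) (r M : R) (k : nat) :
  0 < r -> (forall s, 0 <= s <= 2 * PI -> ccont phi s) ->
  (forall s, 0 <= s <= 2 * PI -> Cmod (phi s) <= M) ->
  Cmod (coef phi r k) * r ^ k <= 2 * PI * M.
Proof.
  intros Hr Hphi HM. assert (HPI := PI_RGT_0).
  assert (Hk : 0 < r ^ k) by now apply pow_lt.
  assert (B : Cmod (coef phi r k) <= (2 * PI - 0) * (M * / r ^ k)).
  { apply (is_cint_bound _ _ _ _ _) with (3 := is_cint_coef phi r k Hr Hphi); [lra|].
    intros s Hs. rewrite Cmod_mult, Cmod_pow_inv_circle by exact Hr.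
    apply Rmult_le_compat_r; [left; now apply Rinv_0_lt_compat|now apply HM]. }
  apply Rmult_le_compat_r with (r := r ^ k) in B; [|lra].
  apply Rle_trans with (1 := B). right. field. lra.
Qed.

Lemma coef_one (r : R) (k : nat) :
  0 < r -> (0 < k)%nat -> coef (fun _ => 1) r k = 0.
Proof.
  intros Hr Hk. apply is_cint_unique.
  assert (Hk0 : RtoC (INR k) <> 0).
  { intros E. apply RtoC_inj in E. apply (not_0_INR k); [lia|exact E]. }
  assert (HCi : Ci <> 0).
  { intros E. apply (f_equal snd) in E. simpl in E. lra. }
  (* a primitive of exp(-iks) takes the same value at 0 and 2 pi *)
  set (F := fun y : C => ((/ (- Ci * INR k)) * (/ circle r y) ^ k)%C).
  apply (eq_ind (F (2 * PI)%R - F 0)%C (is_cint _ 0 (2 * PI))).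
  - apply is_cint_cder; [assert (H := PI_RGT_0); lra| |].
    + intros t Ht. unfold F. assert (Hc := circle_neq_0 r t Hr).
      destruct k as [|k]; [lia|].
      apply (eq_ind (/ (- Ci * INR (S k)) *
        ((- (Ci * circle r t) / (circle r t * circle r t)) * (INR (S k) * (/ circle r t) ^ k)))%C
        (cder _ (RtoC t))).
      * apply cder_scal. apply (cder_comp (fun y => (y ^ S k)%C)); [apply cder_pow|].
        apply cder_inv; [apply cder_circle|exact Hc].
      * simpl pow. simpl Cpow. field. repeat split; assumption.
    + intros t Ht. apply ccont_mult; [apply ccont_const|now apply ccont_inv_circle_pow].
  - unfold F. rewrite <- circle_closed. ring.
Qed.

(** The Cauchy kernel [circle / (circle - z)] is the geometric series in [z / circle],
    which converges uniformly on the circle. *)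
Lemma kernel_series (phi : R -> C) (r : R) (z : C) :
  Cmod z < r -> (forall s, 0 <= s <= 2 * PI -> ccont phi s) ->
  (exists M, forall s, 0 <= s <= 2 * PI -> Cmod (phi s) <= M) ->
  is_cseries (fun k => (z ^ k * coef phi r k)%C)
    (cint (fun s : R => (phi s * (circle r s / (circle r s - z)))%C) 0 (2 * PI)).
Proof.
  intros Hz Hphi [M HM]. assert (HPI := PI_RGT_0).
  assert (Hr : 0 < r) by (assert (H := Cmod_ge_0 z); lra).
  assert (HM0 : 0 <= M) by (apply Rle_trans with (2 := HM 0 ltac:(lra)); apply Cmod_ge_0).
  set (q := Cmod z / r).
  assert (Hq : 0 <= q < 1).
  { apply Rdiv_lt_1_bounds; [apply Cmod_ge_0|exact Hz]. }
  assert (Hden : forall s : R, (circle r s - z)%C <> 0).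
  { intros s. apply Cmod_gt_0. assert (H := Cmod_triangle_rev (circle r s) z).
    rewrite Cmod_circle in H by lra. lra. }
  assert (Hw : forall s : R, Cmod (z / circle r s) = q).
  { intros s. rewrite Cmod_div by now apply circle_neq_0. now rewrite Cmod_circle by lra. }
  assert (Psum : forall n, is_cint
    (fun s : R => (phi s * csum (fun k => ((z / circle r s) ^ k)%C) n)%C) 0 (2 * PI)
    (csum (fun k => (z ^ k * coef phi r k)%C) n)).
  { induction n as [|n IH].
    - simpl. apply (eq_ind (RtoC (2 * PI - 0) * RtoC 0)%C (is_cint _ 0 (2 * PI))); [|ring].
      apply is_cint_ext with (fun _ => RtoC 0); [lra| |apply is_cint_const].
      intros t Ht. ring.
    - simpl. apply is_cint_ext with (fun s : R =>
        (phi s * csum (fun k => ((z / circle r s) ^ k)%C) n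
         + z ^ n * (phi s * (/ circle r s) ^ n))%C); [lra| |].
      + intros s Hs. unfold Cdiv. rewrite Cpow_mult_l. ring.
      + apply is_cint_plus; [exact IH|]. apply is_cint_scal.
        now apply is_cint_coef. }
  assert (Ker : is_cint (fun s : R => (phi s * (circle r s / (circle r s - z)))%C) 0 (2 * PI)
    (cint (fun s : R => (phi s * (circle r s / (circle r s - z)))%C) 0 (2 * PI))).
  { apply ccont_is_cint; [lra|]. intros s Hs.
    apply ccont_mult; [now apply Hphi|]. apply ccont_mult; [apply ccont_circle|].
    apply ccont_inv; [|apply Hden].
    apply ccont_minus; [apply ccont_circle|apply ccont_const]. }
  apply clim_squeeze with (u := fun n => q ^ n) (K := 2 * PI * (M / (1 - q))).
  - apply filter_forall. intros n.
    apply Rle_trans with ((2 * PI - 0) * (M * (q ^ n / (1 - q)))); [|right; field; lra].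
    apply (is_cint_bound _ _ _ _ _) with (3 := is_cint_minus _ _ _ _ _ _ (Psum n) Ker); [lra|].
    intros s Hs.
    set (w := (z / circle r s)%C).
    assert (Hw1 : (1 - w)%C <> 0).
    { apply Cmod_gt_0. assert (H := Cmod_triangle_rev 1 w).
      rewrite Cmod_1 in H. unfold w in H. rewrite Hw in H. unfold w. lra. }
    replace (circle r s / (circle r s - z))%C with (/ (1 - w))%C.
    2:{ assert (H1 := Hden s). assert (H2 := circle_neq_0 r s Hr).
        unfold w. field. now repeat split. }
    replace (phi s * csum (fun k => (w ^ k)%C) n - phi s * / (1 - w))%C
      with (phi s * (((csum (fun k => (w ^ k)%C) n * (1 - w)) - 1) / (1 - w)))%C
      by (field; exact Hw1).
    rewrite csum_geom. rewrite Cmod_mult.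
    replace ((1 - w ^ n - 1) / (1 - w))%C with (- (w ^ n / (1 - w)))%C by (field; exact Hw1).
    rewrite Cmod_opp, Cmod_div, Cmod_pow by exact Hw1.
    replace (Cmod w) with q by (symmetry; apply Hw).
    assert (Hqn : 0 <= q ^ n) by (apply pow_le; lra).
    apply Rmult_le_compat; [apply Cmod_ge_0| |now apply HM|].
    + apply Rmult_le_pos; [exact Hqn|]. left. apply Rinv_0_lt_compat. now apply Cmod_gt_0.
    + apply Rmult_le_compat_l; [exact Hqn|]. apply Rinv_le_contravar; [lra|].
      assert (H := Cmod_triangle_rev 1 w). rewrite Cmod_1 in H.
      unfold w in H at 1. rewrite Hw in H. lra.
  - intros e He. destruct (pow_lt_1_zero q ltac:(rewrite Rabs_pos_eq; lra) e He) as [N HN].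
    exists N. intros n Hn. specialize (HN n Hn).
    rewrite Rabs_pos_eq in HN; [exact HN|]. apply pow_le. lra.
  - apply Rmult_le_pos; [lra|]. apply Rmult_le_pos; [exact HM0|].
    left. apply Rinv_0_lt_compat. lra.
Qed.

Lemma hol_continuous (f : C -> C) (z : C) : hol f -> Cmod z < 1 -> clim (nbhd z) f (f z).
Proof. intros Hf Hz. destruct (Hf z Hz) as [l Hl]. now apply cder_continuous with l. Qed.

Lemma hol_ccont_circle (f : C -> C) (r s : R) :
  hol f -> 0 < r < 1 -> ccont (fun s : R => f (circle r s)) s.
Proof.
  intros Hf Hr. apply (ccont_comp (fun s : R => circle r s)); [apply ccont_circle|].
  apply hol_continuous; [exact Hf|]. rewrite Cmod_circle; lra.
Qed.

Lemma Ci_neq_0 : Ci <> 0.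
Proof. intros E. apply (f_equal snd) in E. simpl in E. lra. Qed.

(** [cone_integral] with apex [0], applied to [f x / x ^ (k + 1)]. *)
Lemma coef_radius (f : C -> C) (r1 r2 : R) (k : nat) :
  hol f -> 0 < r1 -> r1 < r2 -> r2 < 1 ->
  coef (fun s : R => f (circle r1 s)) r1 k = coef (fun s : R => f (circle r2 s)) r2 k.
Proof.
  intros Hf H1 H12 H2. assert (HPI := PI_RGT_0).
  set (a := r1 / r2).
  assert (Ha : 0 < a < 1).
  { unfold a. split; [apply Rdiv_lt_0_compat; lra|]. apply Rdiv_lt_1_bounds; lra. }
  assert (Ear : a * r2 = r1) by (unfold a; field; lra).
  assert (Cone := cone_integral (fun x => (f x * (/ x) ^ S k)%C) (circle r2)
    (fun s => (Ci * circle r2 s)%C) 0 0 (2 * PI) a).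
  assert (Side : forall t r, 0 < t -> 0 < t * r2 -> t * r2 = r -> r < 1 ->
    cint (fun s : R => (f (0 + t * circle r2 s) * (/ (0 + t * circle r2 s)) ^ S k
                        * (t * (Ci * circle r2 s)))%C) 0 (2 * PI)
    = (Ci * coef (fun s : R => f (circle r s)) r k)%C).
  { intros t r Ht Htr Er Hr1. apply is_cint_unique.
    apply is_cint_ext with (fun s : R => (Ci * (f (circle r s) * (/ circle r s) ^ k))%C).
    - lra.
    - intros s Hs.
      replace (0 + t * circle r2 s)%C with (circle r s)
        by (rewrite <- Er, circle_scale; ring).
      replace (t * (Ci * circle r2 s))%C with (Ci * circle r s)%C
        by (rewrite <- Er, circle_scale; ring).
      simpl. field. apply circle_neq_0. lra.
    - apply is_cint_scal. apply is_cint_coef; [lra|]. intros s Hs.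
      apply hol_ccont_circle; [exact Hf|lra]. }
  cbv beta in Cone.
  rewrite (Side 1 r2) in Cone by lra. rewrite (Side a r1) in Cone by lra.
  assert (E : (Ci * coef (fun s : R => f (circle r2 s)) r2 k)%C
            = (Ci * coef (fun s : R => f (circle r1 s)) r1 k)%C).
  { apply Cone; try lra.
    - intros s Hs. apply cder_circle.
    - intros s Hs. apply ccont_mult; [apply ccont_const|apply ccont_circle].
    - exists r2. intros s Hs. rewrite Cmod_mult, Cmod_Ci, Cmod_circle by lra. lra.
    - apply circle_closed.
    - intros t s Ht Hs.
      replace (0 + t * circle r2 s)%C with (circle (t * r2) s)
        by (rewrite circle_scale; ring).
      assert (P1 : 0 < t * r2) by (apply Rmult_lt_0_compat; lra).
      assert (P2 : t * r2 <= 1 * r2) by (apply Rmult_le_compat_r; lra).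
      destruct (Hf (circle (t * r2) s)) as [l Hl]; [rewrite Cmod_circle; lra|].
      eexists. apply cder_mult; [exact Hl|].
      apply (cder_comp (fun y => (y ^ S k)%C)); [apply cder_pow|].
      apply cder_inv; [apply cder_id|now apply circle_neq_0]. }
  symmetry. replace (coef (fun s : R => f (circle r2 s)) r2 k)
    with (/ Ci * (Ci * coef (fun s : R => f (circle r2 s)) r2 k))%C by (field; apply Ci_neq_0).
  rewrite E. field. apply Ci_neq_0.
Qed.

(** Cauchy's formula: shrinking the cone over the circle towards its apex [z], the
    integrand tends to zero, while by [cone_integral] the integral is constant. *)
Lemma cauchy_formula (f : C -> C) (r : R) (z : C) :
  hol f -> Cmod z < r -> r < 1 ->
  cint (fun s : R => ((f (circle r s) - f z) * (circle r s / (circle r s - z)))%C) 0 (2 * PI)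
  = 0.
Proof.
  intros Hf Hz Hr1. assert (HPI := PI_RGT_0). assert (Hz0 := Cmod_ge_0 z).
  assert (Hr : 0 < r) by lra.
  set (K := r / (r - Cmod z)).
  assert (HK : 0 < K) by (apply Rdiv_lt_0_compat; lra).
  assert (Hden : forall s : R, r - Cmod z <= Cmod (circle r s - z)).
  { intros s. assert (H := Cmod_triangle_rev (circle r s) z).
    rewrite Cmod_circle in H by lra. lra. }
  assert (Hden0 : forall s : R, (circle r s - z)%C <> 0).
  { intros s. apply Cmod_gt_0. specialize (Hden s). lra. }
  assert (Hin : forall t s : R, 0 <= t <= 1 -> Cmod (z + t * (circle r s - z)) < 1).
  { intros t s Ht.
    replace (z + t * (circle r s - z))%C with ((1 - t)%R * z + t * circle r s)%C
      by (rewrite RtoC_minus; ring).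
    apply Rle_lt_trans with (1 := Cmod_triangle _ _).
    rewrite !Cmod_mult, !Cmod_R, !Rabs_pos_eq, Cmod_circle by lra.
    assert ((1 - t) * Cmod z <= (1 - t) * r) by (apply Rmult_le_compat_l; lra).
    replace r with ((1 - t) * r + t * r) in Hr1 by ring. lra. }
  assert (Hshift : forall t s : R, t <> 0 ->
    ((f (z + t * (circle r s - z)) - f z) * / (z + t * (circle r s - z) - z)
       * (t * (Ci * circle r s)))%C
    = (Ci * ((f (z + t * (circle r s - z)) - f z) * (circle r s / (circle r s - z))))%C).
  { intros t s Ht. assert (H := Hden0 s).
    assert (Ht' : RtoC t <> 0) by (intros E; now apply RtoC_inj in E).
    replace (z + t * (circle r s - z) - z)%C with (t * (circle r s - z))%C by ring.
    field. now split. }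
  assert (Hint : forall t : R, 0 < t <= 1 -> is_cint (fun s : R =>
    ((f (z + t * (circle r s - z)) - f z) * (circle r s / (circle r s - z)))%C) 0 (2 * PI)
    (cint (fun s : R =>
    ((f (z + t * (circle r s - z)) - f z) * (circle r s / (circle r s - z)))%C) 0 (2 * PI))).
  { intros t Ht. apply ccont_is_cint; [lra|]. intros s Hs. apply ccont_mult.
    - apply ccont_minus; [|apply ccont_const].
      apply (ccont_comp (fun s : R => (z + t * (circle r s - z))%C)).
      + apply ccont_plus; [apply ccont_const|]. apply ccont_mult; [apply ccont_const|].
        apply ccont_minus; [apply ccont_circle|apply ccont_const].
      + apply hol_continuous; [exact Hf|]. apply Hin. lra.
    - apply ccont_mult; [apply ccont_circle|]. apply ccont_inv; [|apply Hden0].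
      apply ccont_minus; [apply ccont_circle|apply ccont_const]. }
  set (I := fun t : R => cint (fun s : R =>
    ((f (z + t * (circle r s - z)) - f z) * (circle r s / (circle r s - z)))%C) 0 (2 * PI)).
  assert (Const : forall t : R, 0 < t < 1 -> I 1 = I t).
  { intros t Ht.
    assert (Cone := cone_integral (fun x => ((f x - f z) * / (x - z))%C)
      (fun y => (circle r y - z)%C) (fun s => (Ci * circle r s)%C) z 0 (2 * PI) t).
    assert (Side : forall t : R, 0 < t <= 1 ->
      cint (fun s : R => ((f (z + t * (circle r s - z)) - f z)
        * / (z + t * (circle r s - z) - z) * (t * (Ci * circle r s)))%C) 0 (2 * PI)
      = (Ci * I t)%C).
    { intros t' Ht'. apply is_cint_unique.
      eapply is_cint_ext; [lra| |apply is_cint_scal, Hint, Ht'].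
      intros s Hs. symmetry. apply Hshift. lra. }
    cbv beta in Cone. rewrite (Side 1) in Cone by lra. rewrite (Side t) in Cone by lra.
    assert (E : (Ci * I 1)%C = (Ci * I t)%C).
    { apply Cone; try lra.
      - intros s Hs. apply (eq_ind (Ci * circle r s - 0)%C (cder _ (RtoC s))); [|ring].
        apply cder_minus; [apply cder_circle|apply cder_const].
      - intros s Hs. apply ccont_mult; [apply ccont_const|apply ccont_circle].
      - exists (r + 1). intros s Hs. rewrite Cmod_mult, Cmod_Ci, Cmod_circle by lra.
        split; [|lra]. apply Rle_trans with (1 := Cmod_triangle _ _).
        rewrite Cmod_opp, Cmod_circle; lra.
      - now rewrite circle_closed.
      - intros t' s Ht' Hs.
        destruct (Hf (z + t' * (circle r s - z))%C) as [l Hl]; [apply Hin; lra|].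
        eexists. apply cder_mult.
        + apply cder_minus; [exact Hl|apply cder_const].
        + apply cder_inv; [apply cder_minus; [apply cder_id|apply cder_const]|].
          replace (z + t' * (circle r s - z) - z)%C with (t' * (circle r s - z))%C by ring.
          apply Cmult_neq_0; [|apply Hden0]. intros E. apply RtoC_inj in E. lra. }
    replace (I 1) with (/ Ci * (Ci * I 1))%C by (field; apply Ci_neq_0).
    rewrite E. field. apply Ci_neq_0. }
  assert (E1 : cint (fun s : R =>
    ((f (circle r s) - f z) * (circle r s / (circle r s - z)))%C) 0 (2 * PI) = I 1).
  { apply is_cint_unique. eapply is_cint_ext; [lra| |apply Hint; lra].
    intros s Hs. cbv beta. replace (z + 1 * (circle r s - z))%C with (circle r s) by ring.
    reflexivity. }
  rewrite E1. apply Cmod_le_0. intros e He.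
  set (e' := e / (2 * PI * K)).
  assert (H2K : 0 < 2 * PI * K) by (apply Rmult_lt_0_compat; lra).
  assert (He' : 0 < e') by now apply Rdiv_lt_0_compat.
  destruct (hol_continuous f z Hf ltac:(lra) e' He') as [d [Hd Hcont]].
  set (t := Rmin (1 / 2) (d / 4)).
  assert (Ht : 0 < t) by (apply Rmin_pos; lra).
  assert (Ht1 : t <= 1 / 2) by apply Rmin_l.
  assert (Htd : t <= d / 4) by apply Rmin_r.
  rewrite (Const t) by lra.
  apply Rle_trans with ((2 * PI - 0) * (e' * K)).
  2:{ right. unfold e'. field. split; lra. }
  apply (is_cint_bound _ _ _ _ _) with (3 := Hint t ltac:(lra)); [lra|].
  intros s Hs. rewrite Cmod_mult.
  apply Rmult_le_compat; try apply Cmod_ge_0.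
  - left. apply Hcont.
    replace (z + t * (circle r s - z) - z)%C with (t * (circle r s - z))%C by ring.
    rewrite Cmod_mult, Cmod_R, Rabs_pos_eq by lra.
    assert (H : Cmod (circle r s - z) <= 2).
    { apply Rle_trans with (1 := Cmod_triangle _ _). rewrite Cmod_opp, Cmod_circle; lra. }
    assert (t * Cmod (circle r s - z) <= t * 2) by (apply Rmult_le_compat_l; lra). lra.
  - rewrite Cmod_div by apply Hden0. rewrite Cmod_circle by lra. unfold K.
    apply Rmult_le_compat_l; [lra|]. apply Rinv_le_contravar; [lra|apply Hden].
Qed.

(** The coefficients satisfy Cauchy's estimates on every circle at once because
    they are the Fourier coefficients of the restriction to any of them. *)
Lemma taylor (f : C -> C) :
  hol f -> exists a : nat -> C,
    (forall r M k, 0 < r < 1 ->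
       (forall s : R, 0 <= s <= 2 * PI -> Cmod (f (circle r s)) <= M) ->
       Cmod (a k) * r ^ k <= M) /\
    (forall z, Cmod z < 1 -> is_cseries (fun k => (a k * z ^ k)%C) (f z)).
Proof.
  intros Hf. assert (HPI := PI_RGT_0).
  set (b := fun k => coef (fun s : R => f (circle (1 / 2) s)) (1 / 2) k).
  assert (Hb : forall r k, 0 < r < 1 -> coef (fun s : R => f (circle r s)) r k = b k).
  { intros r k Hr. unfold b. destruct (Rtotal_order r (1 / 2)) as [H|[->|H]].
    - apply coef_radius; [exact Hf|lra..].
    - reflexivity.
    - symmetry. apply coef_radius; [exact Hf|lra..]. }
  assert (H2PI : RtoC (2 * PI) <> 0) by (intros E; apply RtoC_inj in E; lra).
  exists (fun k => (/ RtoC (2 * PI) * b k)%C). split.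
  - intros r M k Hr HM. rewrite <- (Hb r k Hr).
    rewrite Cmod_mult, Cmod_inv by exact H2PI. rewrite Cmod_R, Rabs_pos_eq by lra.
    assert (B := coef_bound (fun s : R => f (circle r s)) r M k (proj1 Hr)
      (fun s _ => hol_ccont_circle f r s Hf Hr) HM).
    apply Rmult_le_reg_l with (2 * PI); [lra|].
    rewrite <- !Rmult_assoc, Rinv_r, Rmult_1_l by lra. exact B.
  - intros z Hz. set (r := (Cmod z + 1) / 2).
    assert (Hz0 := Cmod_ge_0 z).
    assert (Hr : 0 < r < 1) by (unfold r; lra).
    assert (Hzr : Cmod z < r) by (unfold r; lra).
    assert (Cf : forall s, 0 <= s <= 2 * PI -> ccont (fun s : R => (f (circle r s) - f z)%C) s).
    { intros s Hs. apply ccont_minus; [now apply hol_ccont_circle|apply ccont_const]. }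
    assert (Bf : exists M, forall s, 0 <= s <= 2 * PI -> Cmod (f (circle r s) - f z) <= M)
      by (apply ccont_bounded; [lra|exact Cf]).
    assert (S := kernel_series (fun s : R => (f (circle r s) - f z)%C) r z Hzr Cf Bf).
    cbv beta in S. rewrite cauchy_formula in S by (try assumption; lra).
    (* the same expansion for the constant function gives the integral of the kernel itself *)
    assert (One := is_cseries_single (fun k => (z ^ k * coef (fun _ => 1) r k)%C)).
    cbv beta in One.
    assert (C0 : coef (fun _ => 1) r 0 = RtoC (2 * PI)).
    { apply is_cint_unique.
      apply is_cint_ext with (fun _ => RtoC 1); [lra| |].
      - intros s Hs. simpl. ring.
      - apply (eq_ind (RtoC (2 * PI - 0) * 1)%C (is_cint _ 0 (2 * PI))); [apply is_cint_const|].
        rewrite Rminus_0_r. ring. }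
    rewrite C0 in One.
    assert (One' := One ltac:(intros k Hk; rewrite coef_one by (lra || lia); ring)).
    assert (Tot := is_cseries_plus _ _ _ _ S (is_cseries_scal (f z) _ _ One')).
    apply is_cseries_scal with (c := (/ RtoC (2 * PI))%C) in Tot.
    replace (f z) with (/ RtoC (2 * PI) * (0 + f z * (z ^ 0 * RtoC (2 * PI))))%C
      by (simpl; field; exact H2PI).
    revert Tot. apply is_cseries_ext. intros k.
    assert (E : coef (fun s : R => (f (circle r s) - f z)%C) r k
              = (b k - f z * coef (fun _ => 1%C) r k)%C).
    { rewrite <- (Hb r k Hr). apply is_cint_unique.
      assert (D := is_cint_minus _ _ _ _ _ _
        (is_cint_coef (fun s : R => f (circle r s)) r k (proj1 Hr)
           (fun s _ => hol_ccont_circle f r s Hf Hr))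
        (is_cint_scal _ _ _ (f z) _ (is_cint_coef (fun _ => 1%C) r k (proj1 Hr)
           (fun s _ => ccont_const 1%C s)))).
      revert D. apply is_cint_ext; [lra|]. intros s Hs. ring. }
    rewrite E. ring.
Qed.

(** * Power series *)

(** Cauchy's estimates say that Taylor coefficients on the unit disk are tame;
    conversely tame coefficients define a holomorphic function there. *)
Definition tame (a : nat -> C) : Prop :=
  forall r, 0 < r < 1 -> exists M, 0 <= M /\ forall k, Cmod (a k) * r ^ k <= M.

Definition expands (a : nat -> C) (f : C -> C) : Prop :=
  forall z, Cmod z < 1 -> is_cseries (fun k => (a k * z ^ k)%C) (f z).

Definition deriv_coef (a : nat -> C) (k : nat) : C := (INR (S k) * a (S k))%C.

Lemma tame_geom (a : nat -> C) (x : R) :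
  tame a -> 0 <= x < 1 ->
  exists M q, 0 <= M /\ 0 <= q < 1 /\ forall k, Cmod (a k) * x ^ k <= M * q ^ k.
Proof.
  intros Ha Hx. set (r := (1 + x) / 2).
  destruct (Ha r) as [M [HM0 HM]]; [unfold r; lra|].
  assert (Hr : 0 < r) by (unfold r; lra).
  exists M, (x / r). split; [exact HM0|]. split.
  - apply Rdiv_lt_1_bounds; unfold r; lra.
  - intros k. unfold Rdiv. rewrite Rpow_mult_distr.
    rewrite pow_inv.
    assert (Hrk : 0 < r ^ k) by now apply pow_lt.
    replace (Cmod (a k) * x ^ k) with ((Cmod (a k) * r ^ k) * (x ^ k * / r ^ k)) by (field; lra).
    apply Rmult_le_compat_r; [|apply HM].
    apply Rmult_le_pos; [apply pow_le; lra|left; now apply Rinv_0_lt_compat].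
Qed.

Lemma tame_expands (a : nat -> C) : tame a -> exists f, expands a f.
Proof.
  intros Ha.
  exists (fun z => epsilon (inhabits (RtoC 0)) (is_cseries (fun k => (a k * z ^ k)%C))).
  intros z Hz. apply epsilon_spec.
  destruct (tame_geom a (Cmod z) Ha) as [M [q [HM [Hq H]]]].
  { split; [apply Cmod_ge_0|exact Hz]. }
  apply ex_cseries_geom with M q; [exact Hq|].
  intros k. rewrite Cmod_mult, Cmod_pow. apply H.
Qed.

Lemma expands_0 (a : nat -> C) (f : C -> C) : expands a f -> f 0 = a O.
Proof.
  intros H. apply is_cseries_unique with (fun k => (a k * 0 ^ k)%C).
  - apply H. rewrite Cmod_0. lra.
  - assert (S := is_cseries_single (fun k => (a k * 0 ^ k)%C)).
    cbv beta in S. simpl in S. rewrite Cmult_1_r in S. apply S.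
    intros [|k] Hk; [lia|]. simpl. ring.
Qed.

Lemma linear_geom_bound (q : R) (k : nat) : 0 <= q < 1 -> INR (S k) * q ^ k <= / (1 - q).
Proof.
  intros Hq.
  assert (G : INR (S k) * q ^ k <= (1 - q ^ S k) / (1 - q)).
  { induction k as [|k IH]; [simpl; right; field; lra|].
    rewrite S_INR.
    assert (Hqk : 0 <= q ^ S k <= 1).
    { split; [apply pow_le; lra|]. rewrite <- (pow1 (S k)). apply pow_incr. lra. }
    apply Rle_trans with (q * ((1 - q ^ S k) / (1 - q)) + q ^ S k).
    - replace ((INR (S k) + 1) * q ^ S k) with (q * (INR (S k) * q ^ k) + q ^ S k)
        by (simpl; ring).
      apply Rplus_le_compat_r. apply Rmult_le_compat_l; [lra|exact IH].
    - apply Rmult_le_reg_r with (1 - q); [lra|].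
      replace ((q * ((1 - q ^ S k) / (1 - q)) + q ^ S k) * (1 - q))
        with (q - q * q ^ S k + q ^ S k * (1 - q)) by (field; lra).
      replace ((1 - q ^ S (S k)) / (1 - q) * (1 - q)) with (1 - q * q ^ S k)
        by (simpl; field; lra).
      assert (q ^ S k * (1 - q) <= 1 * (1 - q)) by (apply Rmult_le_compat_r; lra). lra. }
  apply Rle_trans with (1 := G). unfold Rdiv. rewrite <- (Rmult_1_l (/ (1 - q))) at 2.
  apply Rmult_le_compat_r; [left; apply Rinv_0_lt_compat; lra|].
  assert (0 <= q ^ S k) by (apply pow_le; lra). lra.
Qed.

Lemma tame_deriv_coef (a : nat -> C) : tame a -> tame (deriv_coef a).
Proof.
  intros Ha x Hx. set (r := (1 + x) / 2).
  assert (Hr : 0 < r < 1) by (unfold r; lra).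
  destruct (Ha r Hr) as [M [HM0 HM]].
  set (q := x / r).
  assert (Hq : 0 <= q < 1).
  { apply Rdiv_lt_1_bounds; unfold r; lra. }
  assert (Hq1 : 0 < / (1 - q)) by (apply Rinv_0_lt_compat; lra).
  exists (M / r * / (1 - q)). split.
  - apply Rmult_le_pos; [|lra]. apply Rmult_le_pos; [exact HM0|].
    left. apply Rinv_0_lt_compat. lra.
  - intros k. unfold deriv_coef. rewrite Cmod_mult, Cmod_R, Rabs_pos_eq by apply pos_INR.
    assert (Ex : x ^ k = r ^ k * q ^ k).
    { rewrite <- Rpow_mult_distr. f_equal. unfold q. field. lra. }
    replace (INR (S k) * Cmod (a (S k)) * x ^ k)
      with ((Cmod (a (S k)) * r ^ S k) / r * (INR (S k) * q ^ k))
      by (rewrite Ex; simpl; field; lra).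
    apply Rmult_le_compat.
    + apply Rmult_le_pos; [|left; apply Rinv_0_lt_compat; lra].
      apply Rmult_le_pos; [apply Cmod_ge_0|apply pow_le; lra].
    + apply Rmult_le_pos; [apply pos_INR|apply pow_le; lra].
    + apply Rmult_le_compat_r; [left; apply Rinv_0_lt_compat; lra|apply HM].
    + now apply linear_geom_bound.
Qed.

(** By induction, as the error [e k] satisfies
    [e (k + 1) = y * e k + (k + 2) * z ^ (k + 1) * (y - z) ^ 2].  The constants are chosen
    to match the coefficients of the second derivative. *)
Lemma pow_taylor_bound (x : R) (y z : C) (k : nat) :
  Cmod y <= x -> Cmod z <= x ->
  Cmod (y ^ S (S k) - z ^ S (S k) - (y - z) * (INR (S (S k)) * z ^ S k))
    <= INR (S k) * INR (S (S k)) * x ^ k * Cmod (y - z) ^ 2.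
Proof.
  intros Hy Hz.
  assert (Hx : 0 <= x) by (apply Rle_trans with (2 := Hy); apply Cmod_ge_0).
  assert (Hd := Cmod_ge_0 (y - z)). set (d := Cmod (y - z)) in *.
  induction k as [|k IH].
  - replace (y ^ 2 - z ^ 2 - (y - z) * (INR 2 * z ^ 1))%C with ((y - z) * (y - z))%C
      by (simpl; rewrite RtoC_plus; ring).
    rewrite Cmod_mult. fold d. simpl. nra.
  - replace (y ^ S (S (S k)) - z ^ S (S (S k)) - (y - z) * (INR (S (S (S k))) * z ^ S (S k)))%C
      with (y * (y ^ S (S k) - z ^ S (S k) - (y - z) * (INR (S (S k)) * z ^ S k))
            + (INR (S (S k)) * z ^ S k) * ((y - z) * (y - z)))%C.
    2:{ rewrite (S_INR (S (S k))), RtoC_plus. simpl Cpow. ring. }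
    apply Rle_trans with (1 := Cmod_triangle _ _). rewrite !Cmod_mult, Cmod_pow.
    rewrite Cmod_R, Rabs_pos_eq by apply pos_INR. fold d.
    assert (Hxk : 0 <= x ^ k) by now apply pow_le.
    assert (HzS : Cmod z ^ S k <= x ^ S k) by (apply pow_incr; split; [apply Cmod_ge_0|exact Hz]).
    assert (Hn := pos_INR (S k)).
    rewrite (S_INR (S (S k))), (S_INR (S k)) in *. set (n := INR (S k)) in *.
    set (T := Cmod (y ^ S (S k) - z ^ S (S k) - (y - z) * (RtoC (n + 1) * z ^ S k))) in *.
    assert (HT : Cmod y * T <= x * (n * (n + 1) * x ^ k * d ^ 2)).
    { apply Rmult_le_compat; [apply Cmod_ge_0|apply Cmod_ge_0|exact Hy|exact IH]. }
    assert (Hdd : 0 <= (n + 1) * (d * d)) by (apply Rmult_le_pos; [lra|now apply Rmult_le_pos]).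
    assert (HS : (n + 1) * Cmod z ^ S k * (d * d) <= (n + 1) * x ^ S k * (d * d)).
    { apply Rmult_le_compat_r; [now apply Rmult_le_pos|].
      apply Rmult_le_compat_l; [lra|exact HzS]. }
    apply Rle_trans with (x * (n * (n + 1) * x ^ k * d ^ 2) + (n + 1) * x ^ S k * (d * d)); [lra|].
    assert (0 <= x ^ S k * ((n + 1) * (d * d))).
    { apply Rmult_le_pos; [apply pow_le; exact Hx|exact Hdd]. }
    simpl in *. nra.
Qed.

(** Termwise differentiation: the quadratic errors of the monomials add up to at most
    [|y - z| ^ 2] times a convergent series, that of the second derivative. *)
Lemma expands_cder (a : nat -> C) (f f' : C -> C) (z : C) :
  tame a -> expands a f -> expands (deriv_coef a) f' -> Cmod z < 1 -> cder f z (f' z).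
Proof.
  intros Ha Hf Hf' Hz. set (x := (1 + Cmod z) / 2).
  assert (Hz0 := Cmod_ge_0 z).
  destruct (tame_geom (deriv_coef (deriv_coef a)) x) as [M [q [HM [Hq HB]]]].
  { now apply tame_deriv_coef, tame_deriv_coef. }
  { unfold x. lra. }
  assert (Main : forall y, Cmod y <= x ->
    Cmod (f y - f z - (y - z) * f' z) <= M / (1 - q) * Cmod (y - z) ^ 2).
  { intros y Hy. assert (Hy1 : Cmod y < 1) by (unfold x in Hy; lra).
    assert (S1 := is_cseries_minus _ _ _ _ (Hf y Hy1) (Hf z Hz)).
    apply is_cseries_shift in S1. cbv beta in S1.
    assert (S2 := is_cseries_minus _ _ _ _ S1 (is_cseries_scal (y - z)%C _ _ (Hf' z Hz))).
    apply is_cseries_shift in S2. cbv beta in S2.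
    replace (f y - f z - (y - z) * f' z)%C with
      (f y - f z - (a O * y ^ 0 - a O * z ^ 0) - (y - z) * f' z -
       (a 1%nat * y ^ 1 - a 1%nat * z ^ 1 - (y - z) * (deriv_coef a 0 * z ^ 0)))%C
      by (unfold deriv_coef; simpl; ring).
    replace (M / (1 - q) * Cmod (y - z) ^ 2) with ((M * Cmod (y - z) ^ 2) / (1 - q))
      by (field; lra).
    apply is_cseries_geom_bound with (4 := S2); [|exact Hq|].
    - apply Rmult_le_pos; [exact HM|]. apply pow_le, Cmod_ge_0.
    - intros k. unfold deriv_coef at 1.
      replace (a (S (S k)) * y ^ S (S k) - a (S (S k)) * z ^ S (S k)
               - (y - z) * (INR (S (S k)) * a (S (S k)) * z ^ S k))%C
        with (a (S (S k)) *
              (y ^ S (S k) - z ^ S (S k) - (y - z) * (INR (S (S k)) * z ^ S k)))%C by ring.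
      rewrite Cmod_mult.
      apply Rle_trans with (Cmod (a (S (S k))) *
        (INR (S k) * INR (S (S k)) * x ^ k * Cmod (y - z) ^ 2)).
      { apply Rmult_le_compat_l; [apply Cmod_ge_0|].
        apply pow_taylor_bound; [exact Hy|unfold x; lra]. }
      specialize (HB k). unfold deriv_coef in HB.
      rewrite !Cmod_mult, !Cmod_R, !Rabs_pos_eq in HB by apply pos_INR.
      replace (M * Cmod (y - z) ^ 2 * q ^ k) with ((M * q ^ k) * Cmod (y - z) ^ 2) by ring.
      replace (Cmod (a (S (S k))) * (INR (S k) * INR (S (S k)) * x ^ k * Cmod (y - z) ^ 2))
        with ((INR (S k) * (INR (S (S k)) * Cmod (a (S (S k)))) * x ^ k) * Cmod (y - z) ^ 2)
        by ring.
      apply Rmult_le_compat_r; [apply pow_le, Cmod_ge_0|exact HB]. }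
  apply cder_eps. intros e He.
  set (K := M / (1 - q)) in *.
  assert (HK : 0 <= K) by (apply Rmult_le_pos; [exact HM|left; apply Rinv_0_lt_compat; lra]).
  exists (Rmin (x - Cmod z) (e / (K + 1))). split.
  { apply Rmin_pos; [unfold x; lra|apply Rdiv_lt_0_compat; lra]. }
  intros y Hy.
  assert (H1 := Rmin_l (x - Cmod z) (e / (K + 1))).
  assert (H2 := Rmin_r (x - Cmod z) (e / (K + 1))).
  assert (T := Cmod_le_sub y z).
  apply Rle_trans with (1 := Main y ltac:(lra)).
  assert (Hd := Cmod_ge_0 (y - z)). set (d := Cmod (y - z)) in *.
  replace (K * d ^ 2) with ((K * d) * d) by ring.
  apply Rmult_le_compat_r; [exact Hd|].
  apply Rle_trans with ((K + 1) * (e / (K + 1))); [|right; field; lra].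
  apply Rmult_le_compat; lra.
Qed.

Lemma expands_hol (a : nat -> C) (f : C -> C) : tame a -> expands a f -> hol f.
Proof.
  intros Ha Hf z Hz. destruct (tame_expands (deriv_coef a)) as [f' Hf']; [now apply tame_deriv_coef|].
  exists (f' z). now apply expands_cder with a.
Qed.

Lemma hol_expands (f : C -> C) :
  hol f -> exists a, tame a /\ expands a f /\
    (forall r M k, 0 < r < 1 -> (forall z, Cmod z = r -> Cmod (f z) <= M) ->
       Cmod (a k) * r ^ k <= M).
Proof.
  intros Hf. destruct (taylor f Hf) as [a [Est Ser]]. exists a. split; [|split].
  - intros r Hr. assert (HPI := PI_RGT_0).
    destruct (ccont_bounded (fun s : R => f (circle r s)) 0 (2 * PI)) as [M HM].
    + lra.
    + intros s Hs. now apply hol_ccont_circle.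
    + exists M. split.
      * apply Rle_trans with (2 := HM 0 ltac:(lra)). apply Cmod_ge_0.
      * intros k. apply Est; assumption.
  - exact Ser.
  - intros r M k Hr HM. apply Est; [exact Hr|]. intros s Hs. apply HM.
    apply Cmod_circle. lra.
Qed.

(** * Holomorphic functions on the unit disk *)

Lemma hol_deriv (f : C -> C) :
  hol f -> exists f', hol f' /\ forall z, Cmod z < 1 -> cder f z (f' z).
Proof.
  intros Hf. destruct (hol_expands f Hf) as [a [Ha [Ea _]]].
  destruct (tame_expands (deriv_coef a)) as [f' Hf']; [now apply tame_deriv_coef|].
  exists f'. split.
  - apply expands_hol with (deriv_coef a); [now apply tame_deriv_coef|exact Hf'].
  - intros z Hz. now apply expands_cder with a.
Qed.

Lemma hol_primitive (f : C -> C) :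
  hol f -> exists F : C -> C, F 0 = 0 /\ forall z, Cmod z < 1 -> cder F z (f z).
Proof.
  intros Hf. destruct (hol_expands f Hf) as [a [Ha [Ea _]]].
  set (b := fun k => match k with O => RtoC 0 | S j => (a j / INR (S j))%C end).
  assert (HS : forall j, RtoC (INR (S j)) <> 0).
  { intros j E. apply RtoC_inj in E. now apply (not_0_INR (S j)) in E. }
  assert (Hb : tame b).
  { intros r Hr. destruct (Ha r Hr) as [M [HM0 HM]]. exists M. split; [exact HM0|].
    intros [|j].
    - simpl. rewrite Cmod_0. lra.
    - specialize (HM j). unfold b. rewrite Cmod_div by apply HS.
      rewrite Cmod_R, Rabs_pos_eq by apply pos_INR.
      apply Rle_trans with (2 := HM). simpl pow. unfold Rdiv.
      assert (HI : 0 < / INR (S j) <= 1).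
      { assert (H1 : 1 <= INR (S j)) by (apply (le_INR 1); lia).
        split; [apply Rinv_0_lt_compat; lra|].
        rewrite <- Rinv_1. apply Rinv_le_contravar; lra. }
      replace (Cmod (a j) * / INR (S j) * (r * r ^ j))
        with ((Cmod (a j) * r ^ j) * (/ INR (S j) * r)) by ring.
      rewrite <- (Rmult_1_r (Cmod (a j) * r ^ j)) at 2.
      apply Rmult_le_compat_l.
      + apply Rmult_le_pos; [apply Cmod_ge_0|apply pow_le; lra].
      + rewrite <- (Rmult_1_r 1). apply Rmult_le_compat; lra. }
  assert (Eb : forall k, deriv_coef b k = a k).
  { intros k. unfold deriv_coef, b. field. apply HS. }
  destruct (tame_expands b Hb) as [F HF]. exists F. split.
  - now rewrite (expands_0 b F HF).
  - intros z Hz. apply expands_cder with b; try assumption.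
    intros y Hy. apply is_cseries_ext with (2 := Ea y Hy).
    intros k. now rewrite Eb.
Qed.

Lemma hol_sub_const (f : C -> C) (b : C) : hol f -> hol (fun z => (f z - b)%C).
Proof.
  intros Hf z Hz. destruct (Hf z Hz) as [l Hl]. eexists.
  apply cder_minus; [exact Hl|apply cder_const].
Qed.

Lemma hol_inv (f : C -> C) :
  hol f -> (forall z, Cmod z < 1 -> f z <> 0) -> hol (fun z => (/ f z)%C).
Proof.
  intros Hf H0 z Hz. destruct (Hf z Hz) as [l Hl]. eexists.
  apply cder_inv; [exact Hl|now apply H0].
Qed.

Lemma hol_mult (f g : C -> C) : hol f -> hol g -> hol (fun z => (f z * g z)%C).
Proof.
  intros Hf Hg z Hz. destruct (Hf z Hz) as [l Hl]. destruct (Hg z Hz) as [m Hm].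
  eexists. apply cder_mult; eassumption.
Qed.

Lemma hol_plus (f g : C -> C) : hol f -> hol g -> hol (fun z => (f z + g z)%C).
Proof.
  intros Hf Hg z Hz. destruct (Hf z Hz) as [l Hl]. destruct (Hg z Hz) as [m Hm].
  eexists. apply cder_plus; eassumption.
Qed.

Lemma hol_const (c : C) : hol (fun _ => c).
Proof. intros z Hz. eexists. apply cder_const. Qed.

Lemma hol_id : hol (fun z => z).
Proof. intros z Hz. eexists. apply cder_id. Qed.

Lemma hol_cexp (f : C -> C) : hol f -> hol (fun z => cexp (f z)).
Proof.
  intros Hf z Hz. destruct (Hf z Hz) as [l Hl]. eexists.
  apply (cder_comp cexp); [apply cder_cexp|exact Hl].
Qed.

Lemma disk_affine (c z : C) (r : R) :
  0 < r -> Cmod c + r <= 1 -> Cmod z < 1 -> Cmod (c + r * z) < 1.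
Proof.
  intros Hr Hc Hz. apply Rle_lt_trans with (1 := Cmod_triangle _ _).
  rewrite Cmod_mult, Cmod_R, Rabs_pos_eq by lra.
  assert (r * Cmod z < r * 1) by (apply Rmult_lt_compat_l; lra). lra.
Qed.

Lemma hol_affine (f : C -> C) (c : C) (r : R) :
  hol f -> 0 < r -> Cmod c + r <= 1 -> hol (fun z => f (c + r * z)%C).
Proof.
  intros Hf Hr Hc z Hz. destruct (Hf (c + r * z)%C) as [l Hl]; [now apply disk_affine|].
  eexists. apply cder_affine. exact Hl.
Qed.

(** The mean value inequality, by integrating along the segment from [0] to [z]. *)
Lemma hol_mean_value (f f' : C -> C) (z l : C) (B : R) :
  hol f' -> (forall y, Cmod y < 1 -> cder f y (f' y)) -> Cmod z < 1 ->
  (forall y, Cmod y <= Cmod z -> Cmod (f' y - l) <= B) ->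
  Cmod (f z - f 0 - z * l) <= B * Cmod z.
Proof.
  intros Hf' Df Hz HB.
  assert (Hseg : forall t : R, 0 <= t <= 1 -> Cmod (t * z) <= Cmod z).
  { intros t Ht. rewrite Cmod_mult, Cmod_R, Rabs_pos_eq by lra.
    rewrite <- (Rmult_1_l (Cmod z)) at 2. apply Rmult_le_compat_r; [apply Cmod_ge_0|lra]. }
  assert (I : is_cint (fun t : R => (z * (f' (t * z) - l))%C) 0 1 (f z - f 0 - z * l)%C).
  { apply (eq_ind ((f (0 + z * 1) - z * l * 1) - (f (0 + z * 0) - z * l * 0))%C (is_cint _ 0 1)).
    - apply (is_cint_cder (fun y => (f (0 + z * y) - z * l * y)%C)); [lra| |].
      + intros t Ht.
        apply (eq_ind (z * f' (t * z) - z * l * 1)%C (cder _ (RtoC t))); [|ring].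
        apply cder_minus; [|apply cder_scal, cder_id].
        apply cder_affine. replace (0 + z * t)%C with (t * z)%C by ring.
        apply Df. specialize (Hseg t Ht). lra.
      + intros t Ht. apply ccont_mult; [apply ccont_const|].
        apply ccont_minus; [|apply ccont_const].
        apply (ccont_comp (fun t : R => (t * z)%C)).
        * apply ccont_mult; [apply ccont_RtoC|apply ccont_const].
        * apply hol_continuous; [exact Hf'|]. specialize (Hseg t Ht). lra.
    - replace (0 + z * 1)%C with z by ring. replace (0 + z * 0)%C with (RtoC 0) by ring. ring. }
  replace (B * Cmod z) with ((1 - 0) * (Cmod z * B)) by ring.
  apply (is_cint_bound _ _ _ _ _) with (3 := I); [lra|].
  intros t Ht. rewrite Cmod_mult. apply Rmult_le_compat_l; [apply Cmod_ge_0|].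
  now apply HB, Hseg.
Qed.

Lemma hol_bounded (f : C -> C) (r : R) :
  hol f -> 0 <= r < 1 -> exists M, forall z, Cmod z <= r -> Cmod (f z) <= M.
Proof.
  intros Hf Hr. destruct (hol_expands f Hf) as [a [Ha [Ea _]]].
  destruct (tame_geom a r Ha Hr) as [M [q [HM [Hq H]]]].
  exists (M / (1 - q)). intros z Hz.
  apply is_cseries_geom_bound with (fun k => (a k * z ^ k)%C); try assumption.
  - intros k. rewrite Cmod_mult, Cmod_pow. apply Rle_trans with (2 := H k).
    apply Rmult_le_compat_l; [apply Cmod_ge_0|].
    apply pow_incr. split; [apply Cmod_ge_0|exact Hz].
  - apply Ea. lra.
Qed.

(** Cauchy's estimate for the constant coefficient. *)
Lemma hol_max_principle (f : C -> C) (r M : R) :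
  hol f -> 0 < r < 1 -> (forall z, Cmod z = r -> Cmod (f z) <= M) -> Cmod (f 0) <= M.
Proof.
  intros Hf Hr HM. destruct (hol_expands f Hf) as [a [Ha [Ea Est]]].
  rewrite (expands_0 a f Ea). specialize (Est r M O Hr HM). simpl in Est. lra.
Qed.

Lemma hol_min_principle (f : C -> C) (r m : R) :
  hol f -> (forall z, Cmod z < 1 -> f z <> 0) -> 0 < r < 1 -> 0 < m ->
  (forall z, Cmod z = r -> m <= Cmod (f z)) -> m <= Cmod (f 0).
Proof.
  intros Hf H0 Hr Hm H.
  assert (B : Cmod (/ f 0) <= / m).
  { apply (hol_max_principle (fun z => (/ f z)%C) r); [now apply hol_inv|exact Hr|].
    intros z Hz. rewrite Cmod_inv by (apply H0; lra).
    apply Rinv_le_contravar; [exact Hm|now apply H]. }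
  assert (Hf0 : f 0 <> 0) by (apply H0; rewrite Cmod_0; lra).
  rewrite Cmod_inv in B by exact Hf0.
  apply Rinv_le_contravar in B.
  - rewrite !Rinv_inv in B. exact B.
  - apply Rinv_0_lt_compat. now apply Cmod_gt_0.
Qed.

(** Without its constant term, the Taylor series is dominated by a geometric series with
    first term [M * |z| / r]. *)
Lemma hol_oscillation (f : C -> C) (z : C) (r M : R) :
  hol f -> 0 < r < 1 -> (forall y, Cmod y = r -> Cmod (f y) <= M) -> Cmod z < r ->
  Cmod (f z - f 0) <= M * (Cmod z / r) / (1 - Cmod z / r).
Proof.
  intros Hf Hr HM Hz. destruct (hol_expands f Hf) as [a [Ha [Ea Est]]].
  rewrite (expands_0 a f Ea).
  set (q := Cmod z / r).
  assert (Hq : 0 <= q < 1).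
  { apply Rdiv_lt_1_bounds; [apply Cmod_ge_0|exact Hz]. }
  assert (HM0 : 0 <= M).
  { apply Rle_trans with (2 := Est r M O Hr HM). simpl. rewrite Rmult_1_r. apply Cmod_ge_0. }
  assert (T := is_cseries_geom_tail (fun k => (a k * z ^ k)%C) (f z) M q 1 HM0 Hq).
  simpl in T. rewrite Cmult_1_r, Cplus_0_l, Rmult_1_r in T.
  apply T; [|apply Ea; lra].
  intros k. rewrite Cmod_mult, Cmod_pow.
  replace (Cmod z) with (r * q) by (unfold q; field; lra).
  rewrite Rpow_mult_distr, <- Rmult_assoc.
  apply Rmult_le_compat_r; [apply pow_le; lra|]. now apply Est.
Qed.

Lemma hol_cauchy_deriv (f : C -> C) (l : C) (r M : R) :
  hol f -> cder f 0 l -> 0 < r < 1 -> (forall z, Cmod z = r -> Cmod (f z) <= M) ->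
  Cmod l * r <= M.
Proof.
  intros Hf Hl Hr HM. destruct (hol_expands f Hf) as [a [Ha [Ea Est]]].
  destruct (tame_expands (deriv_coef a)) as [f' Hf']; [now apply tame_deriv_coef|].
  assert (H0 : Cmod 0 < 1) by (rewrite Cmod_0; lra).
  assert (D := expands_cder a f f' 0 Ha Ea Hf' H0).
  rewrite (cder_unique _ _ _ _ Hl D), (expands_0 _ _ Hf').
  unfold deriv_coef. simpl. rewrite Cmult_1_l.
  specialize (Est r M 1%nat Hr HM). simpl in Est. now rewrite Rmult_1_r in Est.
Qed.

(** The Taylor series starts at its first nonzero coefficient; the shifted sequence of
    coefficients is still tame. *)
Lemma hol_factor_first (f : C -> C) :
  hol f -> (exists z, Cmod z < 1 /\ f z <> 0) ->
  exists (m : nat) (g : C -> C), hol g /\ g 0 <> 0 /\ forall z, Cmod z < 1 -> f z = (z ^ m * g z)%C.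
Proof.
  intros Hf [z0 [Hz0 Hfz0]]. destruct (hol_expands f Hf) as [a [Ha [Ea _]]].
  assert (Ex : exists k, a k <> 0).
  { destruct (excluded_middle_informative (exists k, a k <> 0)) as [E|E]; [exact E|].
    exfalso. apply Hfz0. apply is_cseries_unique with (2 := is_cseries_single (fun _ => RtoC 0)
      (fun _ _ => eq_refl)).
    apply is_cseries_ext with (2 := Ea z0 Hz0). intros k.
    destruct (excluded_middle_informative (a k = 0)) as [->|N]; [ring|].
    exfalso. apply E. now exists k. }
  destruct Ex as [k0 Hk0].
  assert (Least : exists m, a m <> 0 /\ forall k, (k < m)%nat -> a k = 0).
  { induction k0 as [k IH] using (well_founded_induction lt_wf).
    destruct (excluded_middle_informative (exists j, (j < k)%nat /\ a j <> 0)) as [[j [Hj Hj0]]|N].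
    - now apply IH with j.
    - exists k. split; [exact Hk0|]. intros j Hj.
      destruct (excluded_middle_informative (a j = 0)) as [E|E]; [exact E|].
      exfalso. apply N. now exists j. }
  destruct Least as [m [Hm Hlow]].
  assert (Hb : tame (fun k => a (m + k)%nat)).
  { intros r Hr. destruct (Ha r Hr) as [M [HM0 HM]].
    assert (Hrm : 0 < r ^ m) by (apply pow_lt; lra).
    exists (M / r ^ m). split.
    - apply Rmult_le_pos; [exact HM0|left; now apply Rinv_0_lt_compat].
    - intros k. apply Rmult_le_reg_r with (r ^ m); [exact Hrm|].
      replace (M / r ^ m * r ^ m) with M by (field; lra).
      rewrite Rmult_assoc, <- pow_add, (Nat.add_comm k m). apply HM. }
  destruct (tame_expands _ Hb) as [g Hg]. exists m, g. split; [|split].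
  - now apply expands_hol with (2 := Hg).
  - rewrite (expands_0 _ _ Hg). now rewrite Nat.add_0_r.
  - intros z Hz.
    assert (S1 := is_cseries_shift_n _ _ m (Ea z Hz)).
    assert (E0 : csum (fun k => (a k * z ^ k)%C) m = 0).
    { clear S1 Hm Hb g Hg. induction m as [|m IH]; [reflexivity|]. simpl.
      rewrite IH by (intros k Hk; apply Hlow; lia). rewrite Hlow by lia. ring. }
    rewrite E0 in S1. replace (f z - 0)%C with (f z) in S1 by ring.
    apply is_cseries_unique with (1 := S1).
    apply is_cseries_ext with (2 := is_cseries_scal (z ^ m)%C _ _ (Hg z Hz)).
    intros k. rewrite Cpow_add_r. ring.
Qed.

Lemma hol_factor_zero (f : C -> C) (l : C) :
  hol f -> f 0 = 0 -> cder f 0 l -> l <> 0 ->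
  exists q : C -> C, hol q /\ q 0 = l /\ forall z, Cmod z < 1 -> f z = (z * q z)%C.
Proof.
  intros Hf Hf0 Dl Hl.
  assert (Ex : exists z, Cmod z < 1 /\ f z <> 0).
  { destruct (excluded_middle_informative (exists z, Cmod z < 1 /\ f z <> 0)) as [E|E]; [exact E|].
    exfalso. apply Hl. apply cder_unique with (1 := Dl).
    apply cder_ext_loc with (fun _ => RtoC 0); [|apply cder_const].
    exists 1. split; [lra|]. intros y Hy. replace (y - 0)%C with y in Hy by ring.
    destruct (excluded_middle_informative (f y = 0)) as [E0|N]; [now symmetry|].
    exfalso. apply E. now exists y. }
  destruct (hol_factor_first f Hf Ex) as [m [g [Hg [Hg0 E]]]].
  assert (H0 : Cmod 0 < 1) by (rewrite Cmod_0; lra).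
  destruct m as [|m].
  { exfalso. apply Hg0. rewrite E in Hf0 by exact H0. simpl in Hf0.
    now rewrite Cmult_1_l in Hf0. }
  assert (Hq : hol (fun z => (z ^ m * g z)%C)).
  { apply hol_mult; [|exact Hg]. clear. induction m as [|m IH].
    - apply (hol_const 1).
    - apply (hol_mult (fun z => z) (fun z => (z ^ m)%C)); [apply hol_id|exact IH]. }
  exists (fun z => (z ^ m * g z)%C). split; [exact Hq|].
  assert (E' : forall z, Cmod z < 1 -> f z = (z * (z ^ m * g z))%C).
  { intros z Hz. rewrite (E z Hz). simpl. ring. }
  split; [|exact E'].
  destruct (Hq 0 H0) as [k Hk].
  assert (D := cder_mult _ _ _ _ _ (cder_id 0) Hk). cbv beta in D.
  apply cder_unique with f (RtoC 0); [|exact Dl].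
  apply cder_ext_loc with (fun z => (z * (z ^ m * g z))%C).
  - exists 1. split; [lra|]. intros y Hy. replace (y - 0)%C with y in Hy by ring.
    symmetry. now apply E'.
  - replace (0 ^ m * g 0)%C with (1 * (0 ^ m * g 0) + 0 * k)%C by ring. exact D.
Qed.

(** The factor [g] of [hol_factor_first] stays away from zero near the centre, by
    continuity. *)
Lemma hol_isolated (f : C -> C) :
  hol f -> (exists z, Cmod z < 1 /\ f z <> 0) ->
  exists d, 0 < d /\ forall t, 0 < t < d ->
    exists mu, 0 < mu /\ forall z, Cmod z = t -> mu <= Cmod (f z).
Proof.
  intros Hf Ex. destruct (hol_factor_first f Hf Ex) as [m [g [Hg [Hg0 E]]]].
  assert (Cg : clim (nbhd 0) g (g 0)).
  { apply hol_continuous; [exact Hg|]. rewrite Cmod_0. lra. }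
  assert (Hp : 0 < Cmod (g 0)) by now apply Cmod_gt_0.
  destruct (clim_Cmod_gt _ _ (Cmod (g 0) / 2) Cg ltac:(lra)) as [d [Hd H]].
  exists (Rmin d 1). split; [apply Rmin_pos; lra|].
  intros t Ht. assert (H1 := Rmin_l d 1). assert (H2 := Rmin_r d 1).
  assert (Htm : 0 < t ^ m) by (apply pow_lt; lra).
  exists (t ^ m * (Cmod (g 0) / 2)). split; [apply Rmult_lt_0_compat; lra|].
  intros z Hz. rewrite E by lra. rewrite Cmod_mult, Cmod_pow, Hz.
  apply Rmult_le_compat_l; [lra|]. left. apply H.
  replace (z - 0)%C with z by ring. lra.
Qed.

(** A function equal to [b] near [x] equals [b] on the disk of radius [1 - |x|] around [x].
    Steps shorter than [1 - |c|] lead from [c] along a radius to the centre, where this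
    disk is everything. *)
Lemma hol_identity (f : C -> C) (b c : C) (d : R) :
  hol f -> Cmod c < 1 -> 0 < d -> (forall z, Cmod (z - c) < d -> f z = b) ->
  forall z, Cmod z < 1 -> f z = b.
Proof.
  intros Hf Hc Hd H.
  set (P := fun x : C => exists d, 0 < d /\ forall z, Cmod (z - x) < d -> f z = b).
  assert (Spread : forall x, Cmod x < 1 -> P x ->
    forall z, Cmod (z - x) < 1 - Cmod x -> f z = b).
  { intros x Hx [e [He Hxe]].
    set (r := 1 - Cmod x). assert (Hr : 0 < r) by (unfold r; lra).
    assert (Hh : hol (fun z => (f (x + r * z) - b)%C)).
    { apply hol_sub_const, hol_affine; [exact Hf|exact Hr|unfold r; lra]. }
    intros z Hz.
    destruct (excluded_middle_informative (f z = b)) as [E|N]; [exact E|]. exfalso.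
    assert (Hr0 : RtoC r <> 0) by (intros E; apply RtoC_inj in E; lra).
    destruct (hol_isolated _ Hh) as [d' [Hd' Iso]].
    { exists ((z - x) / r)%C. split.
      - rewrite Cmod_div, Cmod_R, Rabs_pos_eq by (assumption || lra).
        apply Rdiv_lt_1_bounds; [apply Cmod_ge_0|exact Hz].
      - replace (x + r * ((z - x) / r))%C with z by (field; exact Hr0).
        now apply Csub_neq_0. }
    set (t := Rmin (d' / 2) (e / 2)).
    assert (Ht : 0 < t) by (apply Rmin_pos; lra).
    assert (Ht1 : t <= d' / 2) by apply Rmin_l. assert (Ht2 : t <= e / 2) by apply Rmin_r.
    destruct (Iso t ltac:(lra)) as [mu [Hmu Bmu]].
    specialize (Bmu (RtoC t)). rewrite Cmod_R, Rabs_pos_eq in Bmu by lra.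
    specialize (Bmu eq_refl). rewrite Hxe in Bmu.
    - replace (b - b)%C with (RtoC 0) in Bmu by ring. rewrite Cmod_0 in Bmu. lra.
    - replace (x + r * t - x)%C with (RtoC (r * t)) by (rewrite RtoC_mult; ring).
      assert (r * t <= 1 * t).
      { apply Rmult_le_compat_r; [lra|]. assert (H0 := Cmod_ge_0 x). unfold r. lra. }
      assert (0 < r * t) by now apply Rmult_lt_0_compat.
      rewrite Cmod_R, Rabs_pos_eq; lra. }
  assert (P0 : P 0).
  { destruct (archimed (Cmod c / (1 - Cmod c))) as [HN _].
    set (N := Z.to_nat (up (Cmod c / (1 - Cmod c)))).
    assert (Hq : 0 <= Cmod c / (1 - Cmod c)).
    { apply Rmult_le_pos; [apply Cmod_ge_0|left; apply Rinv_0_lt_compat; lra]. }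
    assert (EN : INR N = IZR (up (Cmod c / (1 - Cmod c)))).
    { unfold N. rewrite INR_IZR_INZ, Z2Nat.id; [reflexivity|]. apply le_IZR. lra. }
    assert (HN0 : 0 < INR N) by lra.
    assert (Chain : forall j, (j <= N)%nat -> P ((1 - INR j / INR N)%R * c)%C).
    { induction j as [|j IH]; intros Hj.
      - exists d. split; [exact Hd|]. intros z Hz. apply H.
        replace (RtoC (1 - INR 0 / INR N) * c)%C with c in Hz; [exact Hz|].
        simpl. unfold Rdiv. rewrite Rmult_0_l, Rminus_0_r. ring.
      - assert (Hj' : (j <= N)%nat) by lia. specialize (IH Hj').
        set (x := (RtoC (1 - INR j / INR N) * c)%C) in *.
        set (y := (RtoC (1 - INR (S j) / INR N) * c)%C).
        assert (Hx : Cmod x <= Cmod c).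
        { unfold x. rewrite Cmod_mult, Cmod_R.
          rewrite <- (Rmult_1_l (Cmod c)) at 2. apply Rmult_le_compat_r; [apply Cmod_ge_0|].
          apply le_INR in Hj'. assert (H0 := pos_INR j).
          assert (0 <= INR j / INR N <= 1).
          { split.
            - apply Rmult_le_pos; [exact H0|left; now apply Rinv_0_lt_compat].
            - apply Rmult_le_reg_r with (INR N); [exact HN0|]. unfold Rdiv.
              rewrite Rmult_assoc, Rinv_l by lra. lra. }
          apply Rabs_le. lra. }
        assert (Hyx : Cmod (y - x) < 1 - Cmod x).
        { unfold y, x. rewrite S_INR.
          replace (RtoC (1 - (INR j + 1) / INR N) * c - RtoC (1 - INR j / INR N) * c)%C
            with (- (RtoC (/ INR N) * c))%C.
          2:{ replace (1 - (INR j + 1) / INR N) with ((1 - INR j / INR N) + - / INR N)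
                by (field; lra).
              rewrite RtoC_plus, RtoC_opp. ring. }
          fold x. rewrite Cmod_opp, Cmod_mult, Cmod_R, Rabs_pos_eq
            by (left; now apply Rinv_0_lt_compat).
          apply Rlt_le_trans with (1 - Cmod c); [|lra].
          apply Rmult_lt_reg_l with (INR N); [exact HN0|].
          rewrite <- Rmult_assoc, Rinv_r, Rmult_1_l by lra.
          rewrite EN.
          apply Rmult_lt_reg_r with (/ (1 - Cmod c)); [apply Rinv_0_lt_compat; lra|].
          rewrite Rmult_assoc, Rinv_r by lra. unfold Rdiv in HN. lra. }
        exists (1 - Cmod x - Cmod (y - x)). split; [lra|].
        intros z Hz. apply Spread with x; [lra|exact IH|].
        assert (T := Cmod_sub_triangle z y x). fold y in Hz. lra. }
    specialize (Chain N (le_n N)).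
    replace (RtoC (1 - INR N / INR N) * c)%C with (RtoC 0) in Chain; [exact Chain|].
    unfold Rdiv. rewrite Rinv_r by lra. rewrite Rminus_diag. ring. }
  intros z Hz. apply Spread with (x := RtoC 0); rewrite ?Cmod_0; [lra|exact P0|].
  replace (z - 0)%C with z by ring. lra.
Qed.

(** * Logarithms and inverse hyperbolic cosines *)

Lemma disk_0 : Cmod 0 < 1.
Proof. rewrite Cmod_0. lra. Qed.

Lemma hol_deriv_0_const (f : C -> C) (z : C) :
  (forall y, Cmod y < 1 -> cder f y 0) -> Cmod z < 1 -> f z = f 0.
Proof.
  intros Df Hz. apply Cmod_sub_0, Rle_antisym; [|apply Cmod_ge_0].
  assert (M := hol_mean_value f (fun _ => RtoC 0) z 0 0 (hol_const 0) Df Hz).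
  rewrite Rmult_0_l in M. replace (f z - f 0)%C with (f z - f 0 - z * 0)%C by ring.
  apply M. intros y _. replace (0 - 0)%C with (RtoC 0) by ring. rewrite Cmod_0. lra.
Qed.

(** The logarithm is a primitive of the logarithmic derivative. *)
Lemma hol_log (h : C -> C) :
  hol h -> (forall z, Cmod z < 1 -> h z <> 0) ->
  exists M : C -> C, hol M /\ M 0 = 0 /\ forall z, Cmod z < 1 -> h z = (h 0 * cexp (M z))%C.
Proof.
  intros Hh H0. destruct (hol_deriv h Hh) as [h' [Hh' Dh]].
  destruct (hol_primitive (fun z => (h' z * / h z)%C)) as [M [M0 DM]].
  { apply hol_mult; [exact Hh'|now apply hol_inv]. }
  exists M. split; [|split; [exact M0|]].
  - intros z Hz. exists (h' z * / h z)%C. now apply DM.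
  - intros z Hz.
    assert (E : (h z * cexp (- M z))%C = (h 0 * cexp (- M 0))%C).
    { apply (hol_deriv_0_const (fun z => (h z * cexp (- M z))%C)); [|exact Hz].
      intros y Hy.
      apply (eq_ind (h' y * cexp (- M y) + h y * ((- (h' y * / h y)) * cexp (- M y)))%C
        (cder _ y)).
      - apply (cder_mult h (fun z => cexp (- M z))); [now apply Dh|].
        apply (cder_comp cexp (fun z => (- M z)%C)); [apply cder_cexp|]. now apply cder_opp, DM.
      - field. now apply H0. }
    rewrite M0 in E. replace (- (0))%C with (RtoC 0) in E by ring.
    rewrite cexp_0, Cmult_1_r in E. rewrite <- E, cexp_opp.
    field. apply cexp_neq_0.
Qed.

Definition ccosh (z : C) : C := ((cexp z + cexp (- z)) / 2)%C.

Lemma RtoC_2_neq_0 : RtoC 2 <> 0.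
Proof. intros E. apply RtoC_inj in E. lra. Qed.

Lemma Cmod_ccosh_le (z : C) (K : R) : Cmod z <= K -> Cmod (ccosh z) <= exp K.
Proof.
  intros H. unfold ccosh. rewrite Cmod_div, Cmod_R, Rabs_pos_eq by (apply RtoC_2_neq_0 || lra).
  assert (T := Cmod_triangle (cexp z) (cexp (- z))). rewrite !Cmod_cexp in T.
  assert (Mono : forall x, x <= K -> exp x <= exp K).
  { intros x [Hx| ->]; [left; now apply exp_increasing|now right]. }
  assert (B := re_le_Cmod z). apply Rabs_le_between in B.
  assert (B1 := Mono (Re z) ltac:(lra)).
  assert (B2 : exp (Re (- z)) <= exp K).
  { apply Mono. replace (Re (- z)) with (- Re z) by reflexivity. lra. }
  lra.
Qed.

(** Since [F^2 - 1] has no zeros it is the square of some [S], and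
    [(F + S) (F - S) = 1], so [F + S] has a logarithm [L] and [F = cosh L]. *)
Lemma hol_arccosh (F : C -> C) (c : C) :
  hol F -> (forall z, Cmod z < 1 -> F z <> 1 /\ F z <> RtoC (-1)) -> ccosh c = F 0 ->
  exists L : C -> C, hol L /\ L 0 = c /\ forall z, Cmod z < 1 -> F z = ccosh (L z).
Proof.
  intros HF Hom Hc.
  assert (H2 := RtoC_2_neq_0).
  set (s := ((cexp c - cexp (- c)) / 2)%C).
  assert (Hcs : (F 0 * F 0 - 1 = s * s)%C).
  { rewrite <- Hc. unfold ccosh, s. rewrite cexp_opp. field. apply cexp_neq_0. }
  destruct (hol_log (fun z => (F z * F z - 1)%C)) as [M [HM [M0 EM]]].
  { apply hol_sub_const. now apply hol_mult. }
  { intros z Hz. destruct (Hom z Hz) as [N1 N2].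
    replace (F z * F z - 1)%C with ((F z - 1) * (F z - RtoC (-1)))%C by ring.
    apply Cmult_neq_0; now apply Csub_neq_0. }
  cbv beta in EM. rewrite Hcs in EM.
  set (S := fun z => (s * cexp (M z * / 2))%C).
  assert (HS : hol S).
  { apply (hol_mult (fun _ => s)); [apply hol_const|]. apply hol_cexp.
    apply (hol_mult M (fun _ => (/ 2)%C)); [exact HM|apply hol_const]. }
  assert (ES : forall z, Cmod z < 1 -> ((F z + S z) * (F z - S z))%C = 1).
  { intros z Hz. replace ((F z + S z) * (F z - S z))%C with (F z * F z - S z * S z)%C by ring.
    assert (E : (S z * S z)%C = (F z * F z - 1)%C).
    { rewrite (EM z Hz). unfold S.
      replace (M z) with (M z * / 2 + M z * / 2)%C at 3 by (field; exact H2).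
      rewrite cexp_plus. ring. }
    rewrite E. ring. }
  assert (NZ : forall z, Cmod z < 1 -> (F z + S z)%C <> 0).
  { intros z Hz E. specialize (ES z Hz). rewrite E in ES.
    apply (f_equal fst) in ES. simpl in ES. lra. }
  assert (S0 : S 0 = s).
  { unfold S. rewrite M0. replace (0 * / 2)%C with (RtoC 0) by ring. rewrite cexp_0. ring. }
  assert (FS0 : (F 0 + S 0)%C = cexp c).
  { rewrite S0, <- Hc. unfold ccosh, s. field. }
  destruct (hol_log (fun z => (F z + S z)%C)) as [N [HN [N0 EN]]].
  { now apply hol_plus. }
  { exact NZ. }
  cbv beta in EN. rewrite FS0 in EN.
  exists (fun z => (c + N z)%C). split; [|split].
  - apply (hol_plus (fun _ => c)); [apply hol_const|exact HN].
  - rewrite N0. ring.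
  - intros z Hz. unfold ccosh. rewrite cexp_opp, cexp_plus, <- (EN z Hz).
    replace (/ (F z + S z))%C with (F z - S z)%C.
    + field.
    + replace (F z - S z)%C with ((F z + S z) * (F z - S z) * / (F z + S z))%C
        by (field; now apply NZ).
      rewrite (ES z Hz). ring.
Qed.

Lemma cexp_ipi (m : Z) :
  exists e : R, (e = 1 \/ e = -1) /\ cexp (0, (IZR m * PI)%R) = RtoC e.
Proof.
  exists (cos (IZR m * PI)).
  assert (S : sin (IZR m * PI) = 0) by (apply sin_eq_0_1; now exists m).
  split.
  - assert (H := sin2_cos2 (IZR m * PI)). rewrite S in H. unfold Rsqr in H.
    set (x := cos (IZR m * PI)) in *.
    assert (E : (x - 1) * (x + 1) = 0) by lra.
    apply Rmult_integral in E. destruct E as [E|E]; [left|right]; lra.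
  - rewrite cexp_iR, S. reflexivity.
Qed.

Lemma ccosh_shift_ipi (x : R) (m : Z) :
  exists e : R, (e = 1 \/ e = -1) /\
    ccosh (x, (IZR m * PI)%R) = RtoC (e * ((exp x + exp (- x)) / 2)).
Proof.
  destruct (cexp_ipi m) as [e [He E]]. exists e. split; [exact He|].
  assert (H2 := RtoC_2_neq_0).
  set (y := (IZR m * PI)%R) in *.
  assert (E1 : cexp (x, y) = (exp x * e)%C).
  { replace ((x, y) : C) with (RtoC x + (0, y))%C
      by (unfold RtoC, Cplus; simpl; f_equal; ring).
    now rewrite cexp_plus, cexp_R, E. }
  unfold ccosh. rewrite cexp_opp, E1.
  assert (Hx : RtoC (exp x) <> 0).
  { intros E0. apply RtoC_inj in E0. assert (P := exp_pos x). lra. }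
  rewrite exp_Ropp, RtoC_mult. unfold Rdiv. rewrite RtoC_mult, RtoC_plus, !RtoC_inv
    by (assert (P := exp_pos x); lra).
  destruct He as [-> | ->]; field; assumption.
Qed.

(** For [u >= 0] the hyperbolic cosine grows by at least [1] between [u] and [u + 2], hence
    takes an integer value there; it is even. *)
Lemma cosh_integer_near (u : R) :
  exists (x : R) (n : Z), Rabs (x - u) <= 2 /\ (exp x + exp (- x)) / 2 = IZR n.
Proof.
  assert (Pos : forall u, 0 <= u ->
    exists (x : R) (n : Z), Rabs (x - u) <= 2 /\ (exp x + exp (- x)) / 2 = IZR n).
  { clear u. intros u Hu. set (ch := fun x => (exp x + exp (- x)) / 2).
    assert (Grow : ch u + 1 <= ch (u + 2)).
    { unfold ch.
      assert (E1 : 2 < exp 1) by (assert (H := exp_ineq1 1 ltac:(lra)); lra).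
      assert (E2 : 4 <= exp 2).
      { replace 2 with (1 + 1) by ring. rewrite exp_plus.
        assert (2 * 2 <= exp 1 * exp 1) by (apply Rmult_le_compat; lra). lra. }
      assert (Eu : 1 <= exp u).
      { rewrite <- exp_0. destruct Hu as [Hu|<-]; [left; now apply exp_increasing|lra]. }
      assert (Eu' : exp (- u) <= 1).
      { rewrite <- exp_0. destruct Hu as [Hu|<-].
        - left. apply exp_increasing. lra.
        - rewrite Ropp_0. lra. }
      assert (Ep := exp_pos (- (u + 2))).
      rewrite exp_plus. assert (exp u * 4 <= exp u * exp 2) by (apply Rmult_le_compat_l; lra).
      lra. }
    assert (Cont : forall y x, u <= x <= u + 2 -> continuity_pt (fun x => ch x - y) x).
    { intros y x _. unfold ch. reg. }
    destruct (archimed (ch u)) as [A1 A2].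
    set (n := up (ch u)) in *.
    destruct (IVT_cor (fun x => ch x - IZR n) u (u + 2)) as [x [Hx Ex]].
    - unfold ch. reg.
    - lra.
    - assert (ch u - IZR n <= 0) by lra. assert (0 <= ch (u + 2) - IZR n) by lra.
      replace ((ch u - IZR n) * (ch (u + 2) - IZR n))
        with (- ((IZR n - ch u) * (ch (u + 2) - IZR n))) by ring.
      assert (0 <= (IZR n - ch u) * (ch (u + 2) - IZR n)) by (apply Rmult_le_pos; lra). lra.
    - exists x, n. split; [apply Rabs_le; lra|]. unfold ch in Ex. lra. }
  destruct (Rle_dec 0 u) as [H|H]; [now apply Pos|].
  destruct (Pos (- u) ltac:(lra)) as [x [n [Hx Ex]]].
  exists (- x), n. split.
  - replace (- x - u) with (- (x - - u)) by ring. now rewrite Rabs_Ropp.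
  - rewrite Ropp_involutive, Rplus_comm. exact Ex.
Qed.

(** * The theorems of Bloch, Landau and Schottky *)

(** As [|g'|] is at most four times its central value [mu], near the centre [g] is close to
    a linear map and [|g - g 0|] at least [mu / 40] on the circle of radius [1 / 20].  An
    omitted value [b] cannot be close to [g 0], or [1 / (g - b)] would violate the
    maximum principle. *)
Lemma omitted_value_far (g g' : C -> C) (b : C) (mu : R) :
  hol g -> hol g' -> (forall z, Cmod z < 1 -> cder g z (g' z)) ->
  0 < mu -> Cmod (g' 0) = mu -> (forall z, Cmod z < 1 -> Cmod (g' z) <= 4 * mu) ->
  (forall z, Cmod z < 1 -> g z <> b) -> mu <= 80 * Cmod (b - g 0).
Proof.
  intros Hg Hg' Dg Hmu E0 Hbd Hom.
  destruct (Rle_dec mu (80 * Cmod (b - g 0))) as [H|H]; [exact H|exfalso].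
  apply Rnot_le_lt in H.
  assert (Circ : forall z, Cmod z = / 20 -> mu / 40 <= Cmod (g z - g 0)).
  { intros z Hz.
    assert (MV : Cmod (g z - g 0 - z * g' 0) <= mu / 2 * Cmod z).
    { apply hol_mean_value with g'; [exact Hg'|exact Dg|lra|].
      intros y Hy.
      assert (O := hol_oscillation g' y (1 / 2) (4 * mu) Hg' ltac:(lra)
        ltac:(intros w Hw; apply Hbd; lra) ltac:(lra)).
      apply Rle_trans with (1 := O).
      assert (Hy0 := Cmod_ge_0 y).
      set (x := Cmod y / (1 / 2)) in *.
      assert (Hx : 0 <= x <= / 10) by (unfold x; lra).
      apply Rmult_le_reg_r with (1 - x); [lra|].
      unfold Rdiv. rewrite Rmult_assoc, Rinv_l by lra. nra. }
    assert (T := Cmod_triangle_rev (z * g' 0) (z * g' 0 - (g z - g 0))).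
    replace (z * g' 0 - (z * g' 0 - (g z - g 0)))%C with (g z - g 0)%C in T by ring.
    rewrite (Cmod_sub_sym (z * g' 0) (g z - g 0)) in T.
    rewrite Cmod_mult, E0, Hz in T. rewrite Hz in MV.
    lra. }
  assert (Far : mu / 80 <= Cmod (g 0 - b)).
  { apply (hol_min_principle (fun z => (g z - b)%C) (/ 20)); [now apply hol_sub_const| |lra|lra|].
    - intros z Hz. now apply Csub_neq_0, Hom.
    - intros z Hz. specialize (Circ z Hz).
      assert (T := Cmod_sub_triangle (g z) b (g 0)). lra. }
  rewrite Cmod_sub_sym in Far. lra.
Qed.

(** Bloch's choice of the point [a] that nearly maximises [(1/2 - |z|) |H' z|]: on the
    disk of half the distance to the circle, [|H'|] is at most [4 |H' a|], and so the
    previous lemma applies there.  The constant is [80 * 6 * 8]: passing from [a] back to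
    [0] costs the factor [8]. *)
Lemma bloch_net (H : C -> C) (l : C) :
  hol H -> cder H 0 l ->
  (forall c : C, exists b : C, Cmod (b - c) <= 6 /\ forall z, Cmod z < 1 -> H z <> b) ->
  Cmod l <= 3840.
Proof.
  intros HH Dl Net.
  destruct (hol_deriv H HH) as [H' [HH' DH]].
  rewrite (cder_unique _ _ _ _ Dl (DH 0 disk_0)).
  destruct (Rle_dec (Cmod (H' 0)) 0) as [N|N]; [lra|]. apply Rnot_le_lt in N.
  set (phi := fun z => (1 / 2 - Cmod z) * Cmod (H' z)).
  destruct (hol_bounded H' (1 / 2) HH' ltac:(lra)) as [B HB].
  set (E := fun y => exists z, Cmod z < 1 / 2 /\ y = phi z).
  assert (Hphi0 : phi 0 = Cmod (H' 0) / 2) by (unfold phi; rewrite Cmod_0; field).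
  assert (E0 : E (phi 0)) by (exists (RtoC 0); split; [rewrite Cmod_0; lra|reflexivity]).
  destruct (completeness E) as [s [Hs1 Hs2]].
  { exists (1 / 2 * B). intros y [z [Hz ->]]. unfold phi. assert (P := Cmod_ge_0 z).
    apply Rmult_le_compat; [lra|apply Cmod_ge_0|lra|apply HB; lra]. }
  { exists (phi 0). exact E0. }
  assert (Hs0 := Hs1 _ E0).
  assert (Ex : exists a, Cmod a < 1 / 2 /\ s / 2 < phi a).
  { destruct (excluded_middle_informative (exists a, Cmod a < 1 / 2 /\ s / 2 < phi a))
      as [X|X]; [exact X|exfalso].
    assert (s <= s / 2); [|lra]. apply Hs2. intros y [z [Hz ->]].
    apply Rnot_lt_le. intros L. apply X. now exists z. }
  destruct Ex as [a [Ha Hphia]].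
  set (m := Cmod (H' a)). set (r := (1 / 2 - Cmod a) / 2).
  assert (Ha0 := Cmod_ge_0 a).
  assert (Hr : 0 < r) by (unfold r; lra).
  assert (Ephi : phi a = 2 * (r * m)) by (unfold phi, r, m; field).
  assert (Hrm : 0 < r * m) by lra.
  assert (Ha1 : Cmod a + r <= 1) by (unfold r; lra).
  destruct (Net (H a)) as [b [Hb Hom]].
  assert (G : r * m <= 80 * Cmod (b - H (a + r * 0)%C)).
  { apply (omitted_value_far (fun z => H (a + r * z)%C) (fun z => (r * H' (a + r * z))%C)).
    - now apply hol_affine.
    - apply (hol_mult (fun _ => RtoC r)); [apply hol_const|now apply hol_affine].
    - intros z Hz. apply cder_affine, DH. now apply disk_affine.
    - exact Hrm.
    - replace (a + r * 0)%C with a by ring. rewrite Cmod_mult, Cmod_R, Rabs_pos_eq by lra.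
      reflexivity.
    - intros z Hz. rewrite Cmod_mult, Cmod_R, Rabs_pos_eq by lra.
      set (y := (a + r * z)%C).
      assert (Hy : Cmod y <= Cmod a + r).
      { apply Rle_trans with (1 := Cmod_triangle _ _).
        rewrite Cmod_mult, Cmod_R, Rabs_pos_eq by lra.
        assert (r * Cmod z <= r * 1) by (apply Rmult_le_compat_l; lra). lra. }
      assert (Hy2 : r <= 1 / 2 - Cmod y) by (unfold r in *; lra).
      apply Rle_trans with (phi y).
      + unfold phi. apply Rmult_le_compat_r; [apply Cmod_ge_0|exact Hy2].
      + apply Rle_trans with s; [apply Hs1; exists y; split; [lra|reflexivity]|lra].
    - intros z Hz. apply Hom. now apply disk_affine. }
  replace (a + r * 0)%C with a in G by ring. lra.
Qed.

(** A function omitting [1] and [-1] is [cosh (i pi cosh H)], and [H] then omits a net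
    of points, namely those where [cosh] is an integer; so Bloch's theorem bounds
    [H'], hence [H], hence the function. *)
Lemma schottky (r : R) :
  0 <= r < 1 -> exists K, forall F : C -> C,
    hol F -> F 0 = 0 -> (forall z, Cmod z < 1 -> F z <> 1 /\ F z <> RtoC (-1)) ->
    forall z, Cmod z <= r -> Cmod (F z) <= K.
Proof.
  intros Hr.
  set (KH := PI / 3 + 3840 / (1 - r)).
  exists (exp (PI * exp KH)).
  intros F HF F0 Hom z Hz.
  assert (HPI := PI_RGT_0). assert (H2 := RtoC_2_neq_0).
  (* cosh (i pi / 2) = 0 *)
  destruct (hol_arccosh F (0, (PI / 2)%R)) as [L [HL [L0 EL]]]; [exact HF|exact Hom| |].
  { rewrite F0. unfold ccosh. rewrite cexp_opp, cexp_iR, cos_PI2, sin_PI2.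
    fold Ci. replace (/ Ci)%C with (- Ci)%C.
    - field.
    - unfold Ci, Copp, Cinv; simpl. f_equal; field. }
  set (ipi := ((0, PI) : C)).
  assert (Hipi : Cmod ipi = PI).
  { unfold ipi, Cmod; simpl. replace (0 * (0 * 1) + PI * (PI * 1)) with (PI * PI) by ring.
    apply sqrt_square. lra. }
  assert (Hipi0 : ipi <> 0) by (apply Cmod_gt_0; lra).
  set (G := fun z => (L z * / ipi)%C).
  assert (HG : hol G) by (apply (hol_mult L (fun _ => (/ ipi)%C)); [exact HL|apply hol_const]).
  assert (GZ : forall z n, Cmod z < 1 -> G z <> RtoC (IZR n)).
  { intros y n Hy E.
    assert (EL' : L y = (0, (IZR n * PI)%R)).
    { replace (L y) with (G y * ipi)%C by (unfold G; field; exact Hipi0).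
      rewrite E. unfold ipi, RtoC, Cmult; simpl. f_equal; ring. }
    destruct (ccosh_shift_ipi 0 n) as [e [He Ee]].
    rewrite Ropp_0, exp_0 in Ee. replace (e * ((1 + 1) / 2)) with e in Ee by field.
    assert (EF := EL y Hy). rewrite EL', Ee in EF.
    destruct (Hom y Hy) as [N1 N2]. destruct He as [-> | ->]; contradiction. }
  (* cosh (i pi / 3) = 1 / 2, and G 0 = 1 / 2 *)
  destruct (hol_arccosh G (0, (PI / 3)%R)) as [H [HH [H0 EH]]]; [exact HG| | |].
  { intros y Hy. split; [apply (GZ y 1%Z Hy)|apply (GZ y (-1)%Z Hy)]. }
  { unfold G. rewrite L0. unfold ccosh. rewrite cexp_opp, cexp_iR, cos_PI3, sin_PI3.
    assert (S3 : sqrt 3 * sqrt 3 = 3) by (apply sqrt_sqrt; lra).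
    replace ((0, (PI / 2)%R) * / ipi)%C with (RtoC (1 / 2))
      by (unfold ipi, RtoC, Cmult, Cinv; simpl; f_equal; field; lra).
    replace (/ ((1 / 2)%R, (sqrt 3 / 2)%R))%C with ((1 / 2, - (sqrt 3 / 2)) : C).
    - unfold RtoC, Cdiv, Cplus, Cmult, Cinv; simpl. f_equal; field.
    - assert (D : 1 / 2 * (1 / 2 * 1) + sqrt 3 / 2 * (sqrt 3 / 2 * 1) = 1) by lra.
      unfold Cinv; simpl. rewrite D. f_equal; field. }
  (* the net: within distance 2 horizontally, and pi vertically *)
  assert (Net : forall c : C, exists b : C, Cmod (b - c) <= 6 /\
    forall z, Cmod z < 1 -> H z <> b).
  { intros [u v].
    destruct (cosh_integer_near u) as [x [n [Hx En]]].
    destruct (archimed (v / PI)) as [A1 A2]. set (m := up (v / PI)) in *.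
    exists (x, (IZR m * PI)%R). split.
    - replace ((x, (IZR m * PI)%R) - (u, v))%C with ((x - u, IZR m * PI - v) : C)
        by (unfold Cminus, Copp, Cplus; reflexivity).
      apply Rle_trans with (1 := Cmod_le_abs _ _).
      assert (Hv : Rabs (IZR m * PI - v) <= 4).
      { assert (P4 := PI_4).
        replace (IZR m * PI - v) with ((IZR m - v / PI) * PI) by (field; lra).
        rewrite Rabs_mult, (Rabs_pos_eq PI), Rabs_pos_eq by lra.
        apply Rle_trans with (1 * PI); [apply Rmult_le_compat_r; lra|lra]. }
      lra.
    - intros y Hy E. destruct (ccosh_shift_ipi x m) as [e [He Ee]].
      rewrite En in Ee. assert (EG := EH y Hy). rewrite E, Ee in EG.
      destruct He as [-> | ->].
      + rewrite Rmult_1_l in EG. now apply (GZ y n Hy).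
      + apply (GZ y (- n)%Z Hy). rewrite EG, opp_IZR. f_equal. ring. }
  destruct (hol_deriv H HH) as [H' [HH' DH]].
  assert (BH : Cmod (H z) <= KH).
  { assert (D : forall y, Cmod y <= Cmod z -> Cmod (H' y - 0) <= 3840 / (1 - r)).
    { intros y Hy. replace (H' y - 0)%C with (H' y) by ring.
      assert (Hy0 := Cmod_ge_0 y).
      assert (Hd : 0 < 1 - Cmod y) by lra.
      assert (B := bloch_net (fun x => H (y + (1 - Cmod y)%R * x)%C) ((1 - Cmod y)%R * H' y)%C).
      rewrite Cmod_mult, Cmod_R, Rabs_pos_eq in B by lra.
      apply Rmult_le_reg_l with (1 - r); [lra|].
      replace ((1 - r) * (3840 / (1 - r))) with 3840 by (field; lra).
      apply Rle_trans with ((1 - Cmod y) * Cmod (H' y)).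
      - apply Rmult_le_compat_r; [apply Cmod_ge_0|lra].
      - apply B.
        + apply hol_affine; [exact HH|exact Hd|lra].
        + apply cder_affine. replace (y + RtoC (1 - Cmod y) * 0)%C with y by ring.
          apply DH. lra.
        + intros c. destruct (Net c) as [b [Hb Ho]]. exists b. split; [exact Hb|].
          intros x Hx. apply Ho. apply disk_affine; [exact Hd|lra|exact Hx]. }
    assert (MV := hol_mean_value H H' z 0 _ HH' DH ltac:(lra) D).
    replace (H z - H 0 - z * 0)%C with (H z - H 0)%C in MV by ring.
    assert (T := Cmod_le_sub (H z) (H 0)).
    assert (E0 : Cmod (H 0) <= PI / 3).
    { rewrite H0. apply Rle_trans with (1 := Cmod_le_abs _ _).
      rewrite Rabs_R0, Rabs_pos_eq by lra. lra. }
    assert (3840 / (1 - r) * Cmod z <= 3840 / (1 - r) * 1).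
    { apply Rmult_le_compat_l; [|lra]. left. apply Rdiv_lt_0_compat; lra. }
    unfold KH. lra. }
  assert (Hz1 : Cmod z < 1) by lra.
  rewrite (EL z Hz1). apply Cmod_ccosh_le.
  replace (L z) with (ipi * G z)%C by (unfold G; field; exact Hipi0).
  rewrite Cmod_mult, Hipi, (EH z Hz1). apply Rmult_le_compat_l; [lra|].
  now apply Cmod_ccosh_le.
Qed.

(** * Normal families *)

Definition subsequence (phi : nat -> nat) : Prop := forall n, (phi n < phi (S n))%nat.

Lemma subsequence_lt (phi : nat -> nat) (n m : nat) :
  subsequence phi -> (n < m)%nat -> (phi n < phi m)%nat.
Proof.
  intros H Hnm. induction Hnm as [|m _ IH]; [apply H|]. specialize (H m). lia.
Qed.

Lemma subsequence_ge (phi : nat -> nat) (n : nat) : subsequence phi -> (n <= phi n)%nat.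
Proof. intros H. induction n as [|n IH]; [lia|]. specialize (H n). lia. Qed.

Lemma subsequence_comp (phi psi : nat -> nat) :
  subsequence phi -> subsequence psi -> subsequence (fun n => phi (psi n)).
Proof. intros H1 H2 n. apply subsequence_lt; [exact H1|apply H2]. Qed.

Lemma eventually_subsequence (P : nat -> Prop) (phi : nat -> nat) :
  subsequence phi -> eventually P -> eventually (fun n => P (phi n)).
Proof.
  intros Hphi [N HN]. exists N. intros n Hn. apply HN.
  assert (H := subsequence_ge phi n Hphi). lia.
Qed.

Lemma bounded_subsequence_R (u : nat -> R) (B : R) :
  (forall n, Rabs (u n) <= B) ->
  exists phi l, subsequence phi /\
    forall e, 0 < e -> eventually (fun n => Rabs (u (phi n) - l) < e).
Proof.
  intros HB.
  destruct (Bolzano_Weierstrass u _ (compact_P3 (- B) B)) as [l Hl].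
  { intros n. specialize (HB n). apply Rabs_le_between in HB. lra. }
  assert (Next : forall (n N : nat), exists p, (N <= p)%nat /\ Rabs (u p - l) < / INR (S n)).
  { intros n N.
    assert (Hp : 0 < / INR (S n)) by (apply Rinv_0_lt_compat, lt_0_INR; lia).
    destruct (Hl (disc l (mkposreal _ Hp)) N) as [p [Hp1 Hp2]].
    - exists (mkposreal _ Hp). now intros x Hx.
    - exists p. split; [exact Hp1|exact Hp2]. }
  set (next := fun n N => epsilon (inhabits O)
    (fun p => (N <= p)%nat /\ Rabs (u p - l) < / INR (S n))).
  assert (Hnext : forall n N, (N <= next n N)%nat /\ Rabs (u (next n N) - l) < / INR (S n)).
  { intros n N. unfold next. apply epsilon_spec, Next. }
  set (phi := fix phi n := match n with O => next O O | S m => next (S m) (S (phi m)) end).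
  assert (Hphi : forall n, Rabs (u (phi n) - l) < / INR (S n)).
  { intros [|n]; simpl phi; apply Hnext. }
  exists phi, l. split.
  - intros n. destruct (Hnext (S n) (S (phi n))) as [H _]. simpl phi. lia.
  - intros e He. destruct (archimed_cor1 e He) as [N [HN HN0]]. exists N. intros n Hn.
    apply Rlt_trans with (1 := Hphi n). apply Rle_lt_trans with (2 := HN).
    apply Rinv_le_contravar; [now apply lt_0_INR|]. apply le_INR. lia.
Qed.

Lemma bounded_subsequence (u : nat -> C) (B : R) :
  (forall n, Cmod (u n) <= B) ->
  exists phi l, subsequence phi /\ clim eventually (fun n => u (phi n)) l.
Proof.
  intros HB.
  destruct (bounded_subsequence_R (fun n => fst (u n)) B) as [phi [x [Hphi Hx]]].
  { intros n. apply Rle_trans with (2 := HB n). apply re_le_Cmod. }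
  destruct (bounded_subsequence_R (fun n => snd (u (phi n))) B) as [psi [y [Hpsi Hy]]].
  { intros n. apply Rle_trans with (2 := HB (phi n)).
    apply Rle_trans with (2 := Rmax_Cmod _). apply Rmax_r. }
  exists (fun n => phi (psi n)), (x, y). split; [now apply subsequence_comp|].
  intros e He. assert (He2 : 0 < e / 2) by lra.
  generalize (filter_and _ _ (eventually_subsequence _ _ Hpsi (Hx _ He2)) (Hy _ He2)).
  apply filter_imp. intros n [H1 H2].
  replace (u (phi (psi n)) - (x, y))%C
    with ((fst (u (phi (psi n))) - x, snd (u (phi (psi n))) - y) : C)
    by (unfold Cminus, Cplus, Copp; simpl; reflexivity).
  apply Rle_lt_trans with (1 := Cmod_le_abs _ _). lra.
Qed.

(** Each selection [Psi (k + 1)] refines [Psi k]; so the diagonal is, from its [k]-th term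
    on, a subsequence of [Psi k]. *)
Lemma diagonal_subsequence (u : nat -> nat -> C) (B : nat -> R) :
  (forall n k, Cmod (u n k) <= B k) ->
  exists phi a, subsequence phi /\ forall k, clim eventually (fun n => u (phi n) k) (a k).
Proof.
  intros HB.
  assert (Ext : forall (psi : nat -> nat) k, exists theta, subsequence theta /\
    exists l, clim eventually (fun n => u (psi (theta n)) k) l).
  { intros psi k. destruct (bounded_subsequence (fun n => u (psi n) k) (B k)) as [th [l [H1 H2]]].
    - intros n. apply HB.
    - exists th. split; [exact H1|]. now exists l. }
  set (theta := fun psi k => epsilon (inhabits (fun n : nat => n)) (fun theta => subsequence theta /\
    exists l, clim eventually (fun n => u (psi (theta n)) k) l)).
  assert (Htheta : forall psi k, subsequence (theta psi k) /\
    exists l, clim eventually (fun n => u (psi (theta psi k n)) k) l).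
  { intros psi k. unfold theta. apply epsilon_spec, Ext. }
  set (Psi := fix Psi k := match k with
    | O => theta (fun n => n) O
    | S j => fun n => Psi j (theta (Psi j) (S j) n) end).
  assert (HPsi : forall k, subsequence (Psi k)).
  { induction k as [|k IH]; simpl; [apply Htheta|].
    apply subsequence_comp; [exact IH|apply Htheta]. }
  assert (Conv : forall k, exists l, clim eventually (fun n => u (Psi k n) k) l).
  { intros [|k]; [exact (proj2 (Htheta (fun n => n) O))|].
    exact (proj2 (Htheta (Psi k) (S k))). }
  set (a := fun k => epsilon (inhabits (RtoC 0)) (clim eventually (fun n => u (Psi k n) k))).
  assert (Ha : forall k, clim eventually (fun n => u (Psi k n) k) (a k)).
  { intros k. unfold a. apply epsilon_spec, Conv. }
  assert (Sub : forall k d, exists rho, subsequence rho /\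
    forall n, Psi (d + k)%nat n = Psi k (rho n)).
  { intros k d. induction d as [|d [rho [H1 H2]]].
    - exists (fun n => n). split; [intros n; lia|reflexivity].
    - exists (fun n => rho (theta (Psi (d + k)%nat) (S (d + k)) n)). split.
      + apply subsequence_comp; [exact H1|apply Htheta].
      + intros n. simpl. apply H2. }
  exists (fun n => Psi n n), a. split.
  - intros n. simpl.
    apply Nat.lt_le_trans with (Psi n (S n)); [apply HPsi|].
    assert (H := subsequence_ge _ (S n) (proj1 (Htheta (Psi n) (S n)))).
    destruct (Nat.eq_dec (S n) (theta (Psi n) (S n) (S n))) as [E|E].
    + rewrite <- E. lia.
    + apply Nat.lt_le_incl. apply subsequence_lt; [apply HPsi|lia].
  - intros k e He. destruct (Ha k e He) as [N HN].
    exists (N + k)%nat. intros n Hn.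
    destruct (Sub k (n - k)%nat) as [rho [H1 H2]].
    replace (n - k + k)%nat with n in H2 by lia.
    rewrite H2. apply HN. assert (H := subsequence_ge _ n H1). lia.
Qed.

Definition locally_uniform (f : nat -> C -> C) (g : C -> C) : Prop :=
  forall r e, 0 <= r < 1 -> 0 < e ->
    eventually (fun n => forall z, Cmod z <= r -> Cmod (f n z - g z) < e).

(** Montel's theorem, on Taylor coefficients: by Cauchy's estimates these are
    bounded, so they converge along a subsequence, and the tails of the
    expansions are uniformly small. *)
Lemma montel (f : nat -> C -> C) :
  (forall n, hol (f n)) ->
  (forall r, 0 <= r < 1 -> exists M, forall n z, Cmod z <= r -> Cmod (f n z) <= M) ->
  exists phi g, subsequence phi /\ hol g /\ locally_uniform (fun n => f (phi n)) g.
Proof.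
  intros Hf Bd.
  set (a := fun n => epsilon (inhabits (fun _ : nat => RtoC 0)) (fun a => tame a /\ expands a (f n) /\
    (forall r M k, 0 < r < 1 -> (forall z, Cmod z = r -> Cmod (f n z) <= M) ->
       Cmod (a k) * r ^ k <= M))).
  assert (Ha : forall n, tame (a n) /\ expands (a n) (f n) /\
    (forall r M k, 0 < r < 1 -> (forall z, Cmod z = r -> Cmod (f n z) <= M) ->
       Cmod (a n k) * r ^ k <= M)).
  { intros n. unfold a. apply epsilon_spec, hol_expands, Hf. }
  assert (Est : forall r, 0 < r < 1 -> exists M, 0 <= M /\ forall n k, Cmod (a n k) * r ^ k <= M).
  { intros r Hr. destruct (Bd r ltac:(lra)) as [M HM].
    assert (HE : forall n k, Cmod (a n k) * r ^ k <= M).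
    { intros n k. apply Ha; [exact Hr|]. intros z Hz. apply HM. lra. }
    exists M. split; [|exact HE].
    apply Rle_trans with (2 := HE O O). simpl. rewrite Rmult_1_r. apply Cmod_ge_0. }
  destruct (Est (1 / 2) ltac:(lra)) as [M0 [HM0 HE0]].
  destruct (diagonal_subsequence a (fun k => M0 / (1 / 2) ^ k)) as [phi [b [Hphi Hb]]].
  { intros n k. assert (P : 0 < (1 / 2) ^ k) by (apply pow_lt; lra).
    apply Rmult_le_reg_r with ((1 / 2) ^ k); [exact P|].
    replace (M0 / (1 / 2) ^ k * (1 / 2) ^ k) with M0 by (field; lra). apply HE0. }
  assert (Estb : forall r M, 0 < r < 1 -> (forall n k, Cmod (a n k) * r ^ k <= M) ->
    forall k, Cmod (b k) * r ^ k <= M).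
  { intros r M Hr HM k. assert (P : 0 < r ^ k) by (apply pow_lt; lra).
    apply Rmult_le_reg_r with (/ r ^ k); [now apply Rinv_0_lt_compat|].
    rewrite Rmult_assoc, Rinv_r, Rmult_1_r by lra.
    apply (clim_le eventually _ _ _ (Hb k)). apply filter_forall. intros n.
    apply Rmult_le_reg_r with (r ^ k); [exact P|].
    rewrite (Rmult_assoc M), Rinv_l, Rmult_1_r by lra. apply HM. }
  assert (Tb : tame b).
  { intros r Hr. destruct (Est r Hr) as [M [HM HE]]. exists M. split; [exact HM|].
    now apply Estb. }
  destruct (tame_expands b Tb) as [g Hg].
  exists phi, g. split; [exact Hphi|]. split; [now apply expands_hol with b|].
  intros r e Hr He. set (R := (1 + r) / 2).
  assert (HR : 0 < R < 1) by (unfold R; lra).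
  destruct (Est R HR) as [M [HM HE]].
  assert (HEb := Estb R M HR HE).
  set (q := r / R).
  assert (Hq : 0 <= q < 1).
  { apply Rdiv_lt_1_bounds; unfold R; lra. }
  assert (Geo : forall c z k, Cmod c * R ^ k <= M -> Cmod z <= r -> Cmod (c * z ^ k) <= M * q ^ k).
  { intros c z k Hc Hz. rewrite Cmod_mult, Cmod_pow.
    apply Rle_trans with (Cmod c * r ^ k).
    - apply Rmult_le_compat_l; [apply Cmod_ge_0|].
      apply pow_incr. split; [apply Cmod_ge_0|exact Hz].
    - replace r with (R * q) at 1 by (unfold q; field; lra).
      rewrite Rpow_mult_distr, <- Rmult_assoc.
      apply Rmult_le_compat_r; [apply pow_le; lra|exact Hc]. }
  assert (Small : exists N, M * q ^ N / (1 - q) < e / 4).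
  { set (d := e / 4 * (1 - q) / (M + 1)).
    assert (Hd : 0 < d).
    { apply Rdiv_lt_0_compat; [|lra]. apply Rmult_lt_0_compat; lra. }
    destruct (pow_lt_1_zero q ltac:(rewrite Rabs_pos_eq; lra) d Hd) as [N HN].
    specialize (HN N (le_n N)). rewrite Rabs_pos_eq in HN by (apply pow_le; lra).
    exists N. apply Rmult_lt_reg_r with (1 - q); [lra|].
    unfold Rdiv. rewrite (Rmult_assoc (M * q ^ N)), Rinv_l, Rmult_1_r by lra.
    assert (Hp : 0 <= q ^ N) by (apply pow_le; lra).
    apply Rle_lt_trans with ((M + 1) * q ^ N); [lra|].
    apply Rlt_le_trans with ((M + 1) * d); [apply Rmult_lt_compat_l; lra|].
    right. unfold d. field. lra. }
  destruct Small as [N HN].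
  (* finitely many coefficients decide, up to the tails *)
  assert (Head : eventually (fun n => forall z, Cmod z <= r ->
    Cmod (csum (fun k => (a (phi n) k * z ^ k)%C) N - csum (fun k => (b k * z ^ k)%C) N) <= e / 4)).
  { clear HN. assert (He4 : 0 < e / 4) by lra. revert He4. generalize (e / 4).
    induction N as [|N IH]; intros d Hd.
    - apply filter_forall. intros n z Hz. simpl.
      replace (0 - 0)%C with (RtoC 0) by ring. rewrite Cmod_0. lra.
    - assert (Hd2 : 0 < d / 2) by lra.
      generalize (filter_and _ _ (IH _ Hd2) (Hb N _ Hd2)). apply filter_imp.
      intros n [H1 H2] z Hz. simpl.
      replace (csum (fun k => (a (phi n) k * z ^ k)%C) N + a (phi n) N * z ^ N
               - (csum (fun k => (b k * z ^ k)%C) N + b N * z ^ N))%C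
        with ((csum (fun k => (a (phi n) k * z ^ k)%C) N - csum (fun k => (b k * z ^ k)%C) N)
              + (a (phi n) N - b N) * z ^ N)%C by ring.
      apply Rle_trans with (1 := Cmod_triangle _ _).
      specialize (H1 z Hz). rewrite Cmod_mult, Cmod_pow.
      assert (Hp : 0 <= Cmod z ^ N <= 1).
      { split; [apply pow_le, Cmod_ge_0|]. rewrite <- (pow1 N). apply pow_incr.
        split; [apply Cmod_ge_0|lra]. }
      assert (Cmod (a (phi n) N - b N) * Cmod z ^ N <= Cmod (a (phi n) N - b N) * 1).
      { apply Rmult_le_compat_l; [apply Cmod_ge_0|lra]. }
      lra. }
  revert Head. apply filter_imp. intros n Hn z Hz. specialize (Hn z Hz).
  assert (Hz1 : Cmod z < 1) by lra.
  assert (T1 := is_cseries_geom_tail _ _ M q N HM Hq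
    (fun k => Geo (a (phi n) k) z k (HE (phi n) k) Hz) (proj1 (proj2 (Ha (phi n))) z Hz1)).
  assert (T2 := is_cseries_geom_tail _ _ M q N HM Hq
    (fun k => Geo (b k) z k (HEb k) Hz) (Hg z Hz1)).
  set (A := csum (fun k => (a (phi n) k * z ^ k)%C) N) in *.
  set (B := csum (fun k => (b k * z ^ k)%C) N) in *.
  assert (U1 := Cmod_sub_triangle (f (phi n) z) A (g z)).
  assert (U2 := Cmod_sub_triangle A B (g z)).
  rewrite (Cmod_sub_sym B) in U2. lra.
Qed.

Lemma locally_uniform_pointwise (f : nat -> C -> C) (g : C -> C) (z : C) :
  locally_uniform f g -> Cmod z < 1 -> clim eventually (fun n => f n z) (g z).
Proof.
  intros H Hz e He. assert (Hz0 := Cmod_ge_0 z).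
  generalize (H (Cmod z) e ltac:(lra) He). apply filter_imp. intros n Hn. apply Hn. lra.
Qed.

(** Cauchy's estimate for the derivative of the difference. *)
Lemma locally_uniform_deriv (f : nat -> C -> C) (g : C -> C) (l : nat -> C) (m : C) :
  (forall n, hol (f n)) -> hol g -> locally_uniform f g ->
  (forall n, cder (f n) 0 (l n)) -> cder g 0 m -> clim eventually l m.
Proof.
  intros Hf Hg H Hl Hm e He. assert (He4 : 0 < e / 4) by lra.
  generalize (H (1 / 2) (e / 4) ltac:(lra) He4). apply filter_imp. intros n Hn.
  assert (B := hol_cauchy_deriv (fun z => (f n z - g z)%C) (l n - m)%C (1 / 2) (e / 4)).
  assert (HB : Cmod (l n - m) * (1 / 2) <= e / 4); [|lra].
  apply B; [|now apply cder_minus|lra|].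
  - intros z Hz. destruct (Hf n z Hz) as [p Hp]. destruct (Hg z Hz) as [q Hq].
    eexists. apply cder_minus; eassumption.
  - intros z Hz. left. apply Hn. lra.
Qed.

(** Hurwitz's theorem: if the limit takes the value [b] at [c] without being constant,
    it stays away from [b] on a small circle around [c]; so do the [f n], and then
    the minimum principle keeps [f n c] away from [b n]. *)
Lemma hurwitz_limit (f : nat -> C -> C) (g : C -> C) (b : nat -> C) (b0 c : C) (r : R) :
  (forall n, hol (f n)) -> hol g -> locally_uniform f g -> clim eventually b b0 ->
  0 < r -> Cmod c + r <= 1 ->
  (forall n z, Cmod (z - c) < r -> f n z <> b n) ->
  g c = b0 -> forall z, Cmod z < 1 -> g z = b0.
Proof.
  intros Hf Hg Lim Hb Hr Hc Hom Egc.
  assert (Hc1 : Cmod c < 1) by lra. assert (Hc0 := Cmod_ge_0 c).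
  destruct (excluded_middle_informative
    (exists z, Cmod z < 1 /\ (g (c + r * z) - b0)%C <> 0)) as [Ex|No].
  - exfalso.
    destruct (hol_isolated (fun z => (g (c + r * z) - b0)%C)) as [d [Hd Iso]].
    { apply hol_sub_const. now apply hol_affine. }
    { exact Ex. }
    set (t := Rmin (d / 2) (1 / 2)).
    assert (Ht : 0 < t) by (apply Rmin_pos; lra).
    assert (Ht1 : t <= d / 2) by apply Rmin_l. assert (Ht2 : t <= 1 / 2) by apply Rmin_r.
    destruct (Iso t ltac:(lra)) as [mu [Hmu Gap]].
    assert (Hmu4 : 0 < mu / 4) by lra.
    assert (Hrt : r * t <= r * (1 / 2)) by (apply Rmult_le_compat_l; lra).
    assert (Hc2 : 0 <= Cmod c + r * (1 / 2) < 1) by lra.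
    destruct (filter_ex (F := eventually) _ (filter_and _ _
      (Lim _ _ Hc2 Hmu4) (Hb _ Hmu4))) as [n [H1 H2]].
    assert (Far : mu / 2 <= Cmod (f n (c + r * 0)%C - b n)).
    { apply (hol_min_principle (fun z => (f n (c + r * z) - b n)%C) t); [| |lra|lra|].
      - apply hol_sub_const. now apply hol_affine.
      - intros z Hz. apply Csub_neq_0, Hom.
        replace (c + r * z - c)%C with (r * z)%C by ring.
        rewrite Cmod_mult, Cmod_R, Rabs_pos_eq by lra.
        rewrite <- (Rmult_1_r r) at 2. apply Rmult_lt_compat_l; lra.
      - intros z Hz. specialize (Gap z Hz).
        assert (Hin : Cmod (c + r * z) <= Cmod c + r * (1 / 2)).
        { apply Rle_trans with (1 := Cmod_triangle _ _).
          rewrite Cmod_mult, Cmod_R, Rabs_pos_eq, Hz by lra. lra. }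
        specialize (H1 _ Hin).
        set (y := (c + r * z)%C) in *.
        assert (U1 := Cmod_sub_triangle (g y) (f n y) b0).
        assert (U2 := Cmod_sub_triangle (f n y) (b n) b0).
        rewrite (Cmod_sub_sym (g y) (f n y)) in U1. lra. }
    replace (c + r * 0)%C with c in Far by ring.
    assert (H3 : Cmod (f n c - g c) < mu / 4).
    { apply H1. assert (0 <= r * (1 / 2)) by (apply Rmult_le_pos; lra). lra. }
    rewrite Egc in H3.
    assert (U := Cmod_sub_triangle (f n c) b0 (b n)).
    rewrite (Cmod_sub_sym b0) in U. lra.
  - apply hol_identity with c r; [exact Hg|exact Hc1|exact Hr|].
    intros z Hz.
    destruct (excluded_middle_informative (g z = b0)) as [E|N]; [exact E|].
    exfalso. apply No. exists ((z - c) / r)%C.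
    assert (Hr0 : RtoC r <> 0) by (intros E; apply RtoC_inj in E; lra).
    split.
    + rewrite Cmod_div, Cmod_R, Rabs_pos_eq by (assumption || lra).
      apply Rdiv_lt_1_bounds; [apply Cmod_ge_0|exact Hz].
    + replace (c + r * ((z - c) / r))%C with z by (field; exact Hr0).
      now apply Csub_neq_0.
Qed.

(** * The extremal problem *)

Definition attains (Omega : C -> Prop) (w : C) (r : R) : Prop :=
  exists f : C -> C,
    hol f /\ (forall z, Cmod z < 1 -> Omega (f z)) /\ f 0 = w /\
    (forall s, Cmod s < 1 -> s <> 0 -> f s <> w) /\ cder f 0 r /\ 0 < r.

Lemma attains_iff (Omega : C -> Prop) (w : C) (r : R) :
  attains Omega w r <->
  exists f, hurwitz_family Omega w f /\ C_derive f (RtoC 0) = RtoC r.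
Proof.
  split.
  - intros [f [Hf [Hmap [H0 [Hom [Df Hr]]]]]]. exists f.
    rewrite (C_derive_eq _ _ _ Df). split; [|reflexivity].
    unfold hurwitz_family. rewrite (C_derive_eq _ _ _ Df).
    repeat split; try assumption.
    + now apply hol_iff.
    + intros s [Hs Hs0]. now apply Hom.
  - intros [f [[Hf [Hmap [H0 [Hom [_ Hre]]]]] E]].
    apply hol_iff in Hf. exists f. rewrite E in Hre.
    repeat split; try assumption.
    + intros s Hs Hs0. apply Hom. now split.
    + destruct (Hf 0 disk_0) as [l Hl]. rewrite (C_derive_eq _ _ _ Hl) in E. now rewrite <- E.
Qed.

(** [u = p + i q] or [p - i q], according to the sign of [y], where [p ^ 2] and [q ^ 2] are
    half of [|z| + x] and half of [|z| - x]. *)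
Lemma ex_Csqrt (z : C) : exists u : C, (u * u)%C = z.
Proof.
  destruct z as [x y].
  set (m := Cmod (x, y)).
  assert (Hx : Rabs x <= m) by apply (re_le_Cmod (x, y)).
  apply Rabs_le_between in Hx.
  assert (Em : m * m = x * x + y * y).
  { unfold m, Cmod. simpl. rewrite sqrt_sqrt; [ring|]. nra. }
  set (p := sqrt ((m + x) / 2)). set (q := sqrt ((m - x) / 2)).
  assert (Hp : p * p = (m + x) / 2) by (apply sqrt_sqrt; lra).
  assert (Hq : q * q = (m - x) / 2) by (apply sqrt_sqrt; lra).
  assert (Hpq : 2 * (p * q) = Rabs y).
  { unfold p, q. rewrite <- sqrt_mult by lra.
    replace ((m + x) / 2 * ((m - x) / 2)) with ((y / 2)²) by (unfold Rsqr; lra).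
    rewrite sqrt_Rsqr_abs. unfold Rdiv.
    rewrite Rabs_mult, (Rabs_pos_eq (/ 2)) by lra. lra. }
  destruct (Rle_dec 0 y) as [Hy|Hy].
  - rewrite Rabs_pos_eq in Hpq by exact Hy.
    exists (p, q). unfold Cmult; simpl. f_equal; lra.
  - rewrite Rabs_left in Hpq by lra.
    exists (p, - q). unfold Cmult; simpl. f_equal; lra.
Qed.

(** Let [f] take the value [w] at [0] only and omit [a].  Dividing [f - w] by [z] leaves
    a function without zeros; so [(f (z^2) - w) / (a - w)] is the square of a
    holomorphic function, which omits [1] and [-1] and vanishes at [0].  Schottky's
    theorem thus bounds [f] on smaller disks. *)
Lemma hurwitz_family_bound (r : R) :
  0 <= r < 1 -> exists K, 0 <= K /\ forall (f : C -> C) (w a : C) (d : R),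
    hol f -> f 0 = w -> (forall s, Cmod s < 1 -> s <> 0 -> f s <> w) ->
    cder f 0 d -> 0 < d -> (forall z, Cmod z < 1 -> f z <> a) ->
    forall z, Cmod z <= r -> Cmod (f z - w) <= Cmod (a - w) * K.
Proof.
  intros Hr.
  assert (Hsr : 0 <= sqrt r < 1).
  { split; [apply sqrt_pos|]. rewrite <- sqrt_1. apply sqrt_lt_1; lra. }
  destruct (schottky (sqrt r) Hsr) as [K HK].
  exists (K * K). split; [nra|].
  intros f w a d Hf Hf0 Hom Df Hd Ha z Hz.
  assert (Haw : (a - w)%C <> 0).
  { apply Csub_neq_0. intros E. apply (Ha 0 disk_0). now rewrite Hf0. }
  destruct (hol_factor_zero (fun y => (f y - w)%C) d) as [q [Hq [Hq0 Eq]]].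
  { now apply hol_sub_const. }
  { rewrite Hf0. ring. }
  { apply (eq_ind (d - 0)%C (cder _ 0)); [|ring].
    apply cder_minus; [exact Df|apply cder_const]. }
  { intros E. apply RtoC_inj in E. lra. }
  assert (Hqn : forall y, Cmod y < 1 -> q y <> 0).
  { intros y Hy E. destruct (excluded_middle_informative (y = 0)) as [->|N].
    - rewrite Hq0 in E. apply RtoC_inj in E. lra.
    - apply (Hom y Hy N). apply Cmod_sub_0. rewrite (Eq y Hy), E, Cmult_0_r. apply Cmod_0. }
  destruct (hol_log q Hq Hqn) as [M [HM [_ EM]]].
  destruct (ex_Csqrt (q 0 / (a - w))%C) as [s Hs].
  set (F := fun y => (y * (s * cexp (M (y * y) * / 2)))%C).
  assert (Hsq : forall y, Cmod y < 1 -> Cmod (y * y) < 1).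
  { intros y Hy. rewrite Cmod_mult. assert (H := Cmod_ge_0 y). nra. }
  assert (HF : hol F).
  { apply (hol_mult (fun y => y)); [apply hol_id|].
    apply (hol_mult (fun _ => s)); [apply hol_const|]. apply hol_cexp.
    apply (hol_mult (fun y => M (y * y)%C) (fun _ => (/ 2)%C)); [|apply hol_const].
    intros y Hy. destruct (HM (y * y)%C (Hsq y Hy)) as [l Hl].
    eexists. apply (cder_comp M (fun y => (y * y)%C)); [exact Hl|].
    apply (cder_mult (fun y => y) (fun y => y)); apply cder_id. }
  assert (EF : forall y, Cmod y < 1 -> (F y * F y * (a - w))%C = (f (y * y) - w)%C).
  { intros y Hy. rewrite (Eq _ (Hsq y Hy)), (EM _ (Hsq y Hy)). unfold F.
    set (x := M (y * y)%C).
    replace (cexp x) with (cexp (x * / 2) * cexp (x * / 2))%C.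
    2:{ rewrite <- cexp_plus. f_equal. field. }
    replace (q 0) with (s * s * (a - w))%C by (rewrite Hs; field; exact Haw). ring. }
  assert (HFom : forall y, Cmod y < 1 -> F y <> 1 /\ F y <> RtoC (-1)).
  { intros y Hy. split; intros E; apply (Ha (y * y)%C (Hsq y Hy));
      assert (X := EF y Hy); rewrite E in X;
      replace (f (y * y)%C) with ((f (y * y) - w) + w)%C by ring; rewrite <- X; ring. }
  destruct (ex_Csqrt z) as [u Hu].
  assert (Hur : Cmod u <= sqrt r).
  { apply Rsqr_incr_0_var; [|apply sqrt_pos].
    rewrite Rsqr_sqrt by lra. unfold Rsqr. now rewrite <- Cmod_mult, Hu. }
  assert (BF := HK F HF ltac:(unfold F; ring) HFom u Hur).
  rewrite <- Hu, <- (EF u ltac:(lra)), !Cmod_mult, Rmult_comm.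
  apply Rmult_le_compat_l; [apply Cmod_ge_0|].
  apply Rmult_le_compat; try apply Cmod_ge_0; exact BF.
Qed.

Lemma attains_bound (Omega : C -> Prop) (a : C) :
  ~ Omega a -> exists K, forall w r, attains Omega w r -> r <= Cmod (a - w) * K.
Proof.
  intros Ha. destruct (hurwitz_family_bound (1 / 2) ltac:(lra)) as [K [HK0 HK]].
  exists (K * 2). intros w r [f [Hf [Hmap [H0 [Hom [Df Hr]]]]]].
  assert (B := hol_cauchy_deriv (fun z => (f z - w)%C) r (1 / 2) (Cmod (a - w) * K)).
  rewrite Cmod_R, Rabs_pos_eq in B by lra.
  assert (r * (1 / 2) <= Cmod (a - w) * K); [|lra].
  apply B; [now apply hol_sub_const| |lra|].
  - apply (eq_ind (r - 0)%C (cder _ 0)); [|ring].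
    apply cder_minus; [exact Df|apply cder_const].
  - intros z Hz. apply HK with r; try assumption; [|lra].
    intros y Hy E. apply Ha. rewrite <- E. now apply Hmap.
Qed.

(** Compactness of the extremal problem: the bound makes the competitors a normal
    family, and by Hurwitz's theorem a limit with positive derivative still lies in
    [Omega] and takes the value [w] at [0] only. *)
Lemma attains_limit (Omega : C -> Prop) (a w : C) (ws : nat -> C) (rs : nat -> R) (r : R) :
  ~ Omega a -> (forall n, attains Omega (ws n) (rs n)) ->
  (forall n, Cmod (ws n - w) <= 1) -> clim eventually ws w ->
  clim eventually (fun n => RtoC (rs n)) r -> 0 < r -> attains Omega w r.
Proof.
  intros Ha Hatt Hws1 Hws Hrs Hr.
  set (P := fun n (f : C -> C) =>
    hol f /\ (forall z, Cmod z < 1 -> Omega (f z)) /\ f 0 = ws n /\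
    (forall s, Cmod s < 1 -> s <> 0 -> f s <> ws n) /\ cder f 0 (rs n) /\ 0 < rs n).
  set (f := fun n => epsilon (inhabits (fun z : C => z)) (P n)).
  assert (Hf : forall n, P n (f n)) by (intros n; apply epsilon_spec, Hatt).
  destruct (montel f) as [phi [g [Hphi [Hg Lim]]]].
  { intros n. apply Hf. }
  { intros x Hx. destruct (hurwitz_family_bound x Hx) as [K [HK0 HK]].
    exists (Cmod w + 1 + (Cmod (a - w) + 1) * K). intros n z Hz.
    destruct (Hf n) as [F1 [F2 [F3 [F4 [F5 F6]]]]].
    assert (B : Cmod (f n z - ws n) <= Cmod (a - ws n) * K).
    { apply HK with (rs n); try assumption.
      intros y Hy E. apply Ha. rewrite <- E. now apply F2. }
    assert (T1 := Cmod_le_sub (f n z) (ws n)). assert (T2 := Cmod_le_sub (ws n) w).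
    assert (T3 := Cmod_sub_triangle a w (ws n)). rewrite (Cmod_sub_sym w) in T3.
    specialize (Hws1 n).
    assert (Cmod (a - ws n) * K <= (Cmod (a - w) + 1) * K) by (apply Rmult_le_compat_r; lra).
    lra. }
  assert (Hfh : forall n, hol (f (phi n))) by (intros n; apply Hf).
  assert (Hwphi : clim eventually (fun n => ws (phi n)) w).
  { intros e He. apply (eventually_subsequence _ _ Hphi (Hws e He)). }
  assert (Hrphi : clim eventually (fun n => RtoC (rs (phi n))) r).
  { intros e He. apply (eventually_subsequence _ _ Hphi (Hrs e He)). }
  assert (Hg0 : g 0 = w).
  { apply (clim_unique eventually (fun n => f (phi n) 0)).
    - now apply locally_uniform_pointwise; [|apply disk_0].
    - revert Hwphi. apply clim_ext. intros n. symmetry. apply Hf. }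
  assert (Dg : cder g 0 r).
  { destruct (Hg 0 disk_0) as [l Hl].
    replace (RtoC r) with l; [exact Hl|].
    apply (clim_unique eventually (fun n => RtoC (rs (phi n)))); [|exact Hrphi].
    apply (locally_uniform_deriv (fun n => f (phi n)) g); try assumption.
    intros n. apply Hf. }
  assert (NonConst : forall b, ~ (forall z, Cmod z < 1 -> g z = b)).
  { intros b Hb. assert (E : RtoC r = 0); [|apply RtoC_inj in E; lra].
    apply cder_unique with (1 := Dg). apply cder_ext_loc with (fun _ => b); [|apply cder_const].
    exists 1. split; [lra|]. intros y Hy. symmetry. apply Hb.
    now replace (y - 0)%C with y in Hy by ring. }
  exists g. split; [exact Hg|]. split; [|split; [exact Hg0|split; [|now split]]].
  - intros z Hz. destruct (excluded_middle_informative (Omega (g z))) as [O|O]; [exact O|exfalso].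
    apply (NonConst (g z)).
    apply (hurwitz_limit (fun n => f (phi n)) g (fun _ => g z) (g z) z (1 - Cmod z));
      try assumption; try lra; [apply clim_const| |reflexivity].
    intros n y Hy E. apply O. rewrite <- E. apply Hf.
    assert (T := Cmod_le_sub y z). lra.
  - intros s Hs Hs0 E. apply (NonConst w).
    assert (Hs1 : 0 < Cmod s) by now apply Cmod_gt_0.
    set (x := Rmin (Cmod s) (1 - Cmod s)).
    assert (Hx : 0 < x) by (apply Rmin_pos; lra).
    assert (Hx1 : x <= Cmod s) by apply Rmin_l. assert (Hx2 : x <= 1 - Cmod s) by apply Rmin_r.
    apply (hurwitz_limit (fun n => f (phi n)) g (fun n => ws (phi n)) w s x);
      try assumption; [lra|].
    intros n y Hy. apply Hf.
    + assert (T := Cmod_le_sub y s). lra.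
    + intros Ey. rewrite Ey, Cmod_sub_sym in Hy.
      replace (s - 0)%C with s in Hy by ring. lra.
Qed.

Lemma attains_small (Omega : C -> Prop) (w : C) :
  open (T := C_UniformSpace) Omega -> Omega w -> exists r, attains Omega w r.
Proof.
  intros HO Hw. destruct (open_nbhd Omega w HO Hw) as [d [Hd H]].
  assert (Hd0 : RtoC d <> 0) by (intros E; apply RtoC_inj in E; lra).
  exists d, (fun z => (w + d * z)%C). split; [|split; [|split; [|split; [|split]]]].
  - apply (hol_plus (fun _ => w)); [apply hol_const|].
    apply (hol_mult (fun _ => RtoC d)); [apply hol_const|apply hol_id].
  - intros z Hz. apply H. replace (w + d * z - w)%C with (d * z)%C by ring.
    rewrite Cmod_mult, Cmod_R, Rabs_pos_eq by lra.
    rewrite <- (Rmult_1_r d) at 2. now apply Rmult_lt_compat_l.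
  - ring.
  - intros s Hs Hs0 E. apply Hs0.
    replace s with ((w + d * s - w) / d)%C by (field; exact Hd0). rewrite E. field. exact Hd0.
  - apply (eq_ind (0 + d * 1)%C (cder _ 0)); [|ring].
    apply (cder_plus (fun _ => w)); [apply cder_const|apply cder_scal, cder_id].
  - exact Hd.
Qed.

Lemma RtoC_clim (rs : nat -> R) (r : R) :
  (forall n, Rabs (rs n - r) < / INR (S n)) -> clim eventually (fun n => RtoC (rs n)) r.
Proof.
  intros H e He. destruct (archimed_cor1 e He) as [N [HN HN0]]. exists N. intros n Hn.
  rewrite <- RtoC_minus, Cmod_R. apply Rlt_trans with (1 := H n).
  apply Rle_lt_trans with (2 := HN).
  apply Rinv_le_contravar; [now apply lt_0_INR|]. apply le_INR. lia.
Qed.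

(** The supremum is finite by [attains_bound] and attained by [attains_limit]; so the choice
    in [hurwitz_radius] returns it. *)
Lemma hurwitz_radius_max (Omega : C -> Prop) (w : C) :
  open (T := C_UniformSpace) Omega -> (exists a, ~ Omega a) -> Omega w ->
  attains Omega w (hurwitz_radius Omega w) /\
  forall r, attains Omega w r -> r <= hurwitz_radius Omega w.
Proof.
  intros HO [a Ha] Hw.
  assert (Ex : exists m, is_max (attains Omega w) m).
  { destruct (attains_bound Omega a Ha) as [K HK].
    destruct (attains_small Omega w HO Hw) as [r0 Hr0].
    destruct (completeness (attains Omega w)) as [m [Hm1 Hm2]].
    - exists (Cmod (a - w) * K). intros r Hr. now apply HK.
    - now exists r0.
    - exists m. split; [|exact Hm1].
      assert (Near : forall n, exists r, attains Omega w r /\ Rabs (r - m) < / INR (S n)).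
      { intros n. assert (Hp : 0 < / INR (S n)) by (apply Rinv_0_lt_compat, lt_0_INR; lia).
        destruct (excluded_middle_informative
          (exists r, attains Omega w r /\ m - / INR (S n) < r)) as [[r [H1 H2]]|N].
        - exists r. split; [exact H1|]. assert (H3 := Hm1 r H1).
          apply Rabs_def1; lra.
        - exfalso. assert (m <= m - / INR (S n)); [|lra].
          apply Hm2. intros r Hr. apply Rnot_lt_le. intros L. apply N. now exists r. }
      set (rs := fun n => epsilon (inhabits 0)
        (fun r => attains Omega w r /\ Rabs (r - m) < / INR (S n))).
      assert (Hrs : forall n, attains Omega w (rs n) /\ Rabs (rs n - m) < / INR (S n)).
      { intros n. unfold rs. apply epsilon_spec, Near. }
      apply (attains_limit Omega a w (fun _ => w) rs m); try assumption.
      + intros n. apply Hrs.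
      + intros n. replace (w - w)%C with (RtoC 0) by ring. rewrite Cmod_0. lra.
      + apply clim_const.
      + apply RtoC_clim. intros n. apply Hrs.
      + apply Rlt_le_trans with (2 := Hm1 r0 Hr0).
        destruct Hr0 as [f Hf]. apply Hf. }
  assert (Spec : is_max (fun r => exists f, hurwitz_family Omega w f /\
                                C_derive f (RtoC 0) = RtoC r) (hurwitz_radius Omega w)).
  { unfold hurwitz_radius. apply epsilon_spec. destruct Ex as [m [H1 H2]].
    exists m. split; [now apply attains_iff|].
    intros r Hr. apply H2. now apply attains_iff. }
  destruct Spec as [H1 H2]. split; [now apply attains_iff|].
  intros r Hr. apply H2. now apply attains_iff.
Qed.

(** A sequence of points of the complement approaching the image of the closed disk would
    have a limit in that image, by compactness of the disk. *)
Lemma image_room (Omega : C -> Prop) (f : C -> C) (r : R) :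
  open (T := C_UniformSpace) Omega -> hol f ->
  (forall z, Cmod z < 1 -> Omega (f z)) -> r < 1 ->
  exists d, 0 < d /\ forall z y, Cmod z <= r -> Cmod (y - f z) < d -> Omega y.
Proof.
  intros HO Hf Hmap Hr.
  destruct (excluded_middle_informative
    (exists d, 0 < d /\ forall z y, Cmod z <= r -> Cmod (y - f z) < d -> Omega y))
    as [Ex|No]; [exact Ex|exfalso].
  assert (Bad : forall n, exists p : C * C, Cmod (fst p) <= r /\
    Cmod (snd p - f (fst p)) < / INR (S n) /\ ~ Omega (snd p)).
  { intros n.
    destruct (excluded_middle_informative (exists p : C * C, Cmod (fst p) <= r /\
      Cmod (snd p - f (fst p)) < / INR (S n) /\ ~ Omega (snd p))) as [Ex|N]; [exact Ex|exfalso].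
    apply No. exists (/ INR (S n)). split; [apply Rinv_0_lt_compat, lt_0_INR; lia|].
    intros z y Hz Hy. destruct (excluded_middle_informative (Omega y)) as [O|O]; [exact O|].
    exfalso. apply N. now exists (z, y). }
  set (p := fun n => epsilon (inhabits (RtoC 0, RtoC 0)) (fun p : C * C => Cmod (fst p) <= r /\
    Cmod (snd p - f (fst p)) < / INR (S n) /\ ~ Omega (snd p))).
  assert (Hp : forall n, Cmod (fst (p n)) <= r /\
    Cmod (snd (p n) - f (fst (p n))) < / INR (S n) /\ ~ Omega (snd (p n))).
  { intros n. unfold p. apply epsilon_spec, Bad. }
  destruct (bounded_subsequence (fun n => fst (p n)) r) as [phi [z [Hphi Hz]]].
  { intros n. apply Hp. }
  assert (Hzr : Cmod z <= r).
  { apply (clim_le eventually _ _ _ Hz). apply filter_forall. intros n. apply Hp. }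
  assert (Hfz := clim_comp _ f _ _ Hz (hol_continuous f z Hf ltac:(lra))).
  destruct (open_nbhd Omega (f z) HO (Hmap z ltac:(lra))) as [d [Hd Hball]].
  assert (Hd2 : 0 < d / 2) by lra.
  destruct (archimed_cor1 (d / 2) Hd2) as [N [HN HN0]].
  assert (Late : eventually (fun n => (N <= n)%nat)) by (now exists N).
  destruct (filter_ex (F := eventually) _ (filter_and _ _ (Hfz _ Hd2) Late)) as [n [H1 H2]].
  destruct (Hp (phi n)) as [_ [H3 H4]]. apply H4, Hball.
  assert (T := Cmod_sub_triangle (snd (p (phi n))) (f (fst (p (phi n)))) (f z)).
  assert (/ INR (S (phi n)) <= / INR N); [|lra].
  apply Rinv_le_contravar; [now apply lt_0_INR|]. apply le_INR.
  assert (H := subsequence_ge phi n Hphi). lia.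
Qed.

(** Shrinking the extremal function for [w] makes room to translate it: if [f] takes
    the value [w] at [0] only, so does [f (t z) + (w' - w)] the value [w']. *)
Lemma hurwitz_radius_lsc (Omega : C -> Prop) (w : C) (e : R) :
  open (T := C_UniformSpace) Omega -> (exists a, ~ Omega a) -> Omega w -> 0 < e ->
  nbhd w (fun w' => Omega w' -> hurwitz_radius Omega w - e < hurwitz_radius Omega w').
Proof.
  intros HO Hex Hw He.
  destruct (hurwitz_radius_max Omega w HO Hex Hw) as [[f [Hf [Hmap [H0 [Hom [Df Hr]]]]]] _].
  set (r := hurwitz_radius Omega w) in *.
  set (t := Rmax (1 / 2) (1 - e / (2 * r))).
  assert (Her : 0 < e / (2 * r)) by (apply Rdiv_lt_0_compat; lra).
  assert (Ht1 : t < 1) by (apply Rmax_lub_lt; lra).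
  assert (Ht0 : 1 / 2 <= t) by apply Rmax_l.
  assert (Htr : r - e < t * r).
  { assert (H : 1 - e / (2 * r) <= t) by apply Rmax_r.
    apply Rmult_le_compat_r with (r := r) in H; [|lra].
    replace ((1 - e / (2 * r)) * r) with (r - e / 2) in H by (field; lra). lra. }
  destruct (image_room Omega f t HO Hf Hmap Ht1) as [d [Hd Room]].
  exists d. split; [exact Hd|]. intros w' Hw' HOw'.
  apply Rlt_le_trans with (1 := Htr).
  apply (hurwitz_radius_max Omega w' HO Hex HOw').
  assert (Hsmall : forall z, Cmod z < 1 -> Cmod (0 + t * z) < t).
  { intros z Hz. replace (0 + t * z)%C with (t * z)%C by ring.
    rewrite Cmod_mult, Cmod_R, Rabs_pos_eq by lra.
    rewrite <- (Rmult_1_r t) at 2. apply Rmult_lt_compat_l; lra. }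
  exists (fun z => (f (0 + t * z) + (w' - w))%C).
  split; [|split; [|split; [|split; [|split]]]].
  - apply (hol_plus (fun z => f (0 + t * z)%C) (fun _ => (w' - w)%C)); [|apply hol_const].
    apply hol_affine; [exact Hf|lra|]. rewrite Cmod_0. lra.
  - intros z Hz. apply Room with (0 + t * z)%C.
    + left. now apply Hsmall.
    + replace (f (0 + t * z) + (w' - w) - f (0 + t * z))%C with (w' - w)%C by ring. exact Hw'.
  - replace (0 + t * 0)%C with (RtoC 0) by ring. rewrite H0. ring.
  - intros s Hs Hs0 E. apply (Hom (0 + t * s)%C).
    + specialize (Hsmall s Hs). lra.
    + replace (0 + t * s)%C with (t * s)%C by ring. apply Cmult_neq_0; [|exact Hs0].
      intros X. apply RtoC_inj in X. lra.
    + replace (f (0 + t * s)%C) with (f (0 + t * s) + (w' - w) - (w' - w))%C by ring.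
      rewrite E. ring.
  - apply (eq_ind (t * r + 0)%C (cder _ 0)); [|rewrite RtoC_mult; ring].
    apply (cder_plus _ (fun _ => (w' - w)%C)); [|apply cder_const].
    apply cder_affine. now replace (0 + t * 0)%C with (RtoC 0) by ring.
  - apply Rmult_lt_0_compat; lra.
Qed.

(** Extremal functions at points tending to [w] have a limit that competes at [w]. *)
Lemma hurwitz_radius_usc (Omega : C -> Prop) (w : C) (e : R) :
  open (T := C_UniformSpace) Omega -> (exists a, ~ Omega a) -> Omega w -> 0 < e ->
  nbhd w (fun w' => Omega w' -> hurwitz_radius Omega w' < hurwitz_radius Omega w + e).
Proof.
  intros HO Hex Hw He.
  destruct (excluded_middle_informative (nbhd w (fun w' => Omega w' ->
    hurwitz_radius Omega w' < hurwitz_radius Omega w + e))) as [Y|No]; [exact Y|exfalso].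
  destruct (hurwitz_radius_max Omega w HO Hex Hw) as [Hmax Hub].
  assert (Hr0 : 0 < hurwitz_radius Omega w) by (destruct Hmax as [f Hf]; apply Hf).
  set (r := hurwitz_radius Omega w) in *.
  assert (Bad : forall n, exists w', Cmod (w' - w) < / INR (S n) /\ Omega w' /\
    r + e <= hurwitz_radius Omega w').
  { intros n.
    destruct (excluded_middle_informative (exists w', Cmod (w' - w) < / INR (S n) /\ Omega w' /\
      r + e <= hurwitz_radius Omega w')) as [Ex|N]; [exact Ex|exfalso].
    apply No. exists (/ INR (S n)). split; [apply Rinv_0_lt_compat, lt_0_INR; lia|].
    intros w' Hw' HOw'. apply Rnot_le_lt. intros L. apply N. now exists w'. }
  set (ws := fun n => epsilon (inhabits w) (fun w' => Cmod (w' - w) < / INR (S n) /\ Omega w' /\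
    r + e <= hurwitz_radius Omega w')).
  assert (Hws : forall n, Cmod (ws n - w) < / INR (S n) /\ Omega (ws n) /\
    r + e <= hurwitz_radius Omega (ws n)).
  { intros n. unfold ws. apply epsilon_spec, Bad. }
  assert (Hws1 : forall n, Cmod (ws n - w) <= 1).
  { intros n. left. apply Rlt_le_trans with (1 := proj1 (Hws n)).
    rewrite <- Rinv_1. apply Rinv_le_contravar; [lra|]. apply (le_INR 1). lia. }
  set (rs := fun n => hurwitz_radius Omega (ws n)).
  assert (Hatt : forall n, attains Omega (ws n) (rs n)).
  { intros n. apply hurwitz_radius_max; [exact HO|exact Hex|apply Hws]. }
  destruct Hex as [a Ha].
  destruct (attains_bound Omega a Ha) as [K HK].
  destruct (bounded_subsequence_R rs ((Cmod (a - w) + 1) * Rabs K)) as [phi [L [Hphi HL]]].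
  { intros n. assert (B := HK _ _ (Hatt n)).
    assert (Hn : 0 < rs n) by (destruct (Hws n) as [_ [_ H]]; unfold rs; lra).
    rewrite Rabs_pos_eq by lra. apply Rle_trans with (1 := B).
    apply Rle_trans with (Cmod (a - ws n) * Rabs K).
    - apply Rmult_le_compat_l; [apply Cmod_ge_0|apply Rle_abs].
    - apply Rmult_le_compat_r; [apply Rabs_pos|].
      assert (T := Cmod_sub_triangle a w (ws n)). rewrite (Cmod_sub_sym w) in T.
      specialize (Hws1 n). lra. }
  assert (HrL : r + e <= L).
  { apply Rnot_lt_le. intros X. assert (Hp : 0 < r + e - L) by lra.
    destruct (filter_ex (F := eventually) _ (HL _ Hp)) as [n Hn].
    destruct (Hws (phi n)) as [_ [_ H]]. fold (rs (phi n)) in H.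
    apply Rabs_lt_between in Hn. lra. }
  assert (Hlim : attains Omega w L).
  { apply (attains_limit Omega a w (fun n => ws (phi n)) (fun n => rs (phi n)) L Ha).
    - intros n. apply Hatt.
    - intros n. apply Hws1.
    - intros d Hd. destruct (archimed_cor1 d Hd) as [N [HN HN0]]. exists N. intros n Hn.
      apply Rlt_trans with (1 := proj1 (Hws (phi n))). apply Rle_lt_trans with (2 := HN).
      apply Rinv_le_contravar; [now apply lt_0_INR|]. apply le_INR.
      assert (H := subsequence_ge phi n Hphi). lia.
    - intros d Hd. generalize (HL d Hd). apply filter_imp. intros n Hn.
      now rewrite <- RtoC_minus, Cmod_R.
    - lra. }
  specialize (Hub L Hlim). lra.
Qed.

Lemma nbhd_locally (z : C) (P : C -> Prop) :
  nbhd z P -> locally (T := C_UniformSpace) z P.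
Proof.
  intros [d [Hd H]]. assert (Hd2 : 0 < d / 2) by lra.
  exists (mkposreal _ Hd2). intros y Hy. apply H.
  apply C_NormedModule_mixin_compat2 in Hy. simpl in Hy.
  apply Rlt_le_trans with (1 := Hy).
  assert (S : sqrt 2 <= 2).
  { rewrite <- (sqrt_square 2) at 2 by lra. apply sqrt_le_1; lra. }
  apply Rle_trans with (2 * (d / 2)); [apply Rmult_le_compat_r; lra|lra].
Qed.

Theorem theorem3p2 :
  forall Omega : C -> Prop,
    is_domain Omega ->
    (exists z : C, ~ Omega z) ->
    (forall w : C, Omega w -> 0 < hurwitz_density Omega w) /\
    continuous_on (T := C_UniformSpace) (U := R_UniformSpace)
      Omega (hurwitz_density Omega).
Proof.
  intros Omega [_ [HO _]] Hex.
  assert (Pos : forall w, Omega w -> 0 < hurwitz_radius Omega w).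
  { intros w Hw. destruct (hurwitz_radius_max Omega w HO Hex Hw) as [[f Hf] _]. apply Hf. }
  split.
  - intros w Hw. unfold hurwitz_density. apply Rdiv_lt_0_compat; [lra|now apply Pos].
  - intros w Hw. unfold hurwitz_density.
    apply filterlim_comp with (G := locally (hurwitz_radius Omega w))
      (f := hurwitz_radius Omega) (g := fun x : R => 2 / x).
    + apply filterlim_locally. intros e. apply nbhd_locally.
      generalize (filter_and _ _
        (hurwitz_radius_lsc Omega w e HO Hex Hw (cond_pos e))
        (hurwitz_radius_usc Omega w e HO Hex Hw (cond_pos e))).
      apply filter_imp. intros y [H1 H2] Hy. specialize (H1 Hy). specialize (H2 Hy).
      apply Rabs_def1; unfold minus, plus, opp; simpl; lra.
    + apply (continuity_pt_filterlim (fun x => 2 / x)).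
      assert (H := Pos w Hw).
      apply continuity_pt_div; [apply continuity_pt_const; now intros ? ?|apply continuity_pt_id|].
      unfold id. lra.
Qed.
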